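(* Let $n_1,\dots,n_s$ ($s\ge1$) be arbitrary positive integers, and let $l\ge s$ be an integer. Then there is a finite dimensional algebra $\Lambda$, together with a local $\Lambda$-module $M=P/C$ (where $P$ is a projective cover of $M$ and $C\subseteq JP$), such that the poset of top-stable degenerations of $M$ has the following properties: $$\text{max-topdeg}(M)\cong\mathbb P^{n_1}\times\dots\times\mathbb P^{n_s},$$ the integer $l$ is the minimal length of a saturated chain of top-stable degenerations of $M$, and $\dim\mathrm{Aut}_\Lambda(P).C=l+\sum_{1\le i\le s}n_i$. In addition, one may require that either (i) the lengths of the saturated chains of top-stable degenerations of $P/C$ trace all values between $l$ and $(l-s)+\sum_{1\le i\le s}n_i$, or else (ii) the saturated chains of top-stable degenerations of $P/C$ have constant length $l$. (That is, both the version with (i) and the version with (ii) can be realized.)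
   Context: $K$ is an algebraically closed field and algebras considered are basic finite dimensional $K$-algebras $\Lambda=KQ/I$, $Q$ a quiver, $I$ an admissible ideal of the path algebra $KQ$; $J$ is the Jacobson radical of $\Lambda$. All modules are finite dimensional left modules. The top of $M$ is $M/JM$; $M$ is local if its top is simple. Degenerations: fix algebra generators $a_1,\dots,a_r$ of $\Lambda$. The affine variety $\mathbf{Mod}^\Lambda_d$ consists of the tuples $(x_1,\dots,x_r)\in\mathrm{End}_K(K^d)^r$ satisfying all relations satisfied by the $a_i$; $\mathrm{GL}_d$ acts by simultaneous conjugation and the orbits correspond to the isomorphism classes of $d$-dimensional modules. If $M,M'$ are $d$-dimensional modules represented by points $x,x'$, then $M'$ is a degeneration of $M$, written $M\le_{\deg}M'$, if $x'$ lies in the closure of $\mathrm{GL}_d.x$; it is top-stable if $M/JM\cong M'/JM'$. The poset of top-stable degenerations of $M$ consists of the isomorphism classes of top-stable degenerations of $M$ (including $M$), ordered by $\le_{\deg}$. A saturated chain of top-stable degenerations of $M$ is a chain $M=M_0<_{\deg}M_1<_{\deg}\cdots<_{\deg}M_r$ of top-stable degenerations of $M$, ending in a maximal element $M_r$ of this poset and admitting no refinement; its length is $r$. With $T=M/JM$, $d=\dim_K M$ and $d'=\dim_KP-d$, $\mathfrak{Grass}^T_d$ is the closed subvariety of the classical Grassmannian $\mathrm{Gr}(d',JP)$ of $d'$-dimensional $K$-subspaces of $JP$ consisting of those subspaces that are $\Lambda$-submodules of $JP$. The group $\mathrm{Aut}_\Lambda(P)$ acts by $f.C=f(C)$. For $M=P/C$,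 $$\text{max-topdeg}(M)=\{C'\in\overline{\mathrm{Aut}_\Lambda(P).C}\mid\mathrm{Aut}_\Lambda(P).C'\text{ is a singleton}\}$$ (closure in $\mathfrak{Grass}^T_d$), a projective variety whose points $C'$ classify the maximal top-stable degenerations $P/C'$ of $M$ up to isomorphism. *)

(* Defs.v *)
From HB Require Import structures.
From mathcomp Require Import all_boot all_order all_algebra all_field.
From mathcomp Require Import finmap monalg.

Set Implicit Arguments.
Unset Strict Implicit.
Unset Printing Implicit Defensive.

Import GRing.Theory.
Local Open Scope ring_scope.

(** * Quivers and path algebras *)

(* The vertex set is required to be nonempty so that KQ is a nonzero ring. *)
Record quiver := Quiver {
  vertex : finType;
  arrow : finType;
  arr_src : arrow -> vertex;
  arr_tgt : arrow -> vertex;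
  vertex_nonempty : (0 < #|vertex|)%N
}.

(* [walk x s]: the arrows in [s], listed in the order in which they are
   traversed, form a path starting at the vertex [x]. *)
Fixpoint walk (Q : quiver) (x : vertex Q) (s : seq (arrow Q)) : bool :=
  if s is a :: s' then (arr_src a == x) && walk (arr_tgt a) s' else true.

(* The starting vertex is recorded because of the paths of length 0. *)
Definition qpath (Q : quiver) : Type :=
  {p : vertex Q * seq (arrow Q) | walk p.1 p.2}.
HB.instance Definition _ (Q : quiver) := Choice.on (qpath Q).

Section Paths.
Context (Q : quiver).
Implicit Types (p q r : qpath Q) (x : vertex Q).

Definition path_start p : vertex Q := (val p).1.
Definition path_arrows p : seq (arrow Q) := (val p).2.
Definition path_end p : vertex Q :=
  last (path_start p) [seq arr_tgt a | a <- path_arrows p].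
Definition path_length p : nat := size (path_arrows p).

Definition trivial_path x : qpath Q := exist _ (x, [::]) isT.

(* The product [q p] is "first p, then q"; it is undefined ([None]) unless p
   ends where q starts. *)
Definition path_comp q p : option (qpath Q) :=
  if path_end p == path_start q
  then (insub (path_start p, path_arrows p ++ path_arrows q) : option (qpath Q))
  else None.

Lemma walk_cat x s t :
  walk x (s ++ t) = walk x s && walk (last x [seq arr_tgt a | a <- s]) t.
Proof. by elim: s x => //= a s IH x; rewrite IH andbA. Qed.

Variant path_comp_spec q p : option (qpath Q) -> Type :=
| PathCompSome r of path_end p = path_start q & path_start r = path_start p
    & path_arrows r = path_arrows p ++ path_arrows q
    & path_end r = path_end q : path_comp_spec q p (Some r)
| PathCompNone of path_end p != path_start q : path_comp_spec q p None.

Lemma path_compP q p : path_comp_spec q p (path_comp q p).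
Proof.
rewrite /path_comp; case: eqP => [e|/eqP]; last exact: PathCompNone.
case: insubP => [r _ er|].
  apply: PathCompSome; rewrite // /path_start /path_arrows ?er //.
  rewrite /path_end /path_start /path_arrows er /= map_cat last_cat.
  by move: e; rewrite /path_end => ->.
by rewrite /= walk_cat (valP p : walk _ _) -/(path_end p) e (valP q : walk _ _).
Qed.

Lemma path_eq p q :
  path_start p = path_start q -> path_arrows p = path_arrows q -> p = q.
Proof.
rewrite /path_start /path_arrows => e1 e2; apply: val_inj.
by rewrite [LHS]surjective_pairing e1 e2 -surjective_pairing.
Qed.

Lemma path_compA r q p :
  obind (path_comp r) (path_comp q p) = obind (path_comp^~ p) (path_comp r q).
Proof.
case: (path_compP q p) => [u e1 us ua ue|n1];
  case: (path_compP r q) => [v e2 vs va ve|n2] //=.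
- case: (path_compP r u) => [w1 f1 w1s w1a _|]; last by rewrite ue e2 eqxx.
  case: (path_compP v p) => [w2 f2 w2s w2a _|]; last by rewrite vs e1 eqxx.
  by congr Some; apply: path_eq; rewrite ?w1s ?w2s // w1a w2a ua va catA.
- by case: (path_compP r u) => // w f _ _ _; move: n2; rewrite -ue f eqxx.
- by case: (path_compP v p) => // w f _ _ _; move: n1; rewrite -vs f eqxx.
Qed.

Lemma path_comp_trivl x p :
  path_comp (trivial_path x) p = if x == path_end p then Some p else None.
Proof.
case: (path_compP (trivial_path x) p) => [r e rs ra re|].
  rewrite e eqxx; congr Some; apply: path_eq => //.
  by rewrite ra cats0.
by rewrite eq_sym => /negPf; rewrite {1}/path_start /= => ->.
Qed.

Lemma path_comp_trivr x p :
  path_comp p (trivial_path x) = if x == path_start p then Some p else None.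
Proof.
case: (path_compP p (trivial_path x)) => [r e rs ra re|].
  by rewrite -e eqxx; congr Some; apply: path_eq; rewrite ?rs ?ra //.
by move=> /negPf; rewrite {1}/path_end /= => ->.
Qed.

End Paths.

Lemma bilinear_assoc (K : fieldType) (V : lmodType K) (T : Type) (e : T -> V)
    (mul : V -> V -> V) :
  (forall S : V -> Prop, S 0 -> (forall c f g, S f -> S g -> S (c *: f + g)) ->
     (forall p, S (e p)) -> forall f, S f) ->
  (forall c f g h, mul (c *: f + g) h = c *: mul f h + mul g h) ->
  (forall c f g h, mul h (c *: f + g) = c *: mul h f + mul h g) ->
  (forall p q r, mul (e p) (mul (e q) (e r)) = mul (mul (e p) (e q)) (e r)) ->
  associative mul.
Proof.
move=> ind Dl Dr A.
have l0 h : mul 0 h = 0.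
  by have := Dl 1 0 0 h; rewrite !scale1r addr0 => /eqP; rewrite -subr_eq subrr eq_sym => /eqP.
have r0 h : mul h 0 = 0.
  by have := Dr 1 0 0 h; rewrite !scale1r addr0 => /eqP; rewrite -subr_eq subrr eq_sym => /eqP.
move=> f g h; elim/ind: f => [|c f f' IH IH'|r]; first by rewrite !l0.
  by rewrite !Dl IH IH'.
elim/ind: g => [|c g g' IH IH'|q]; first by rewrite l0 !r0 l0.
  by rewrite Dl !Dr IH IH' Dl.
elim/ind: h => [|c h h' IH IH'|p]; first by rewrite !r0.
  by rewrite !Dr IH IH'.
exact: A.
Qed.

Lemma scale_of_linear (K : fieldType) (V : lmodType K) (F : V -> V) :
  (forall c f g, F (c *: f + g) = c *: F f + F g) ->
  forall c f, c *: F f = F (c *: f).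
Proof.
move=> H c f; have F0 : F 0 = 0.
  have := H 1 0 0; rewrite !scale1r addr0 => /eqP.
  by rewrite -subr_eq subrr eq_sym => /eqP.
by have := H c f 0; rewrite F0 !addr0.
Qed.

(* Finitely supported functions on the set of all paths; [f@_p] is the
   coefficient of the path [p]. *)
Definition pathalg (K : fieldType) (Q : quiver) : Type := {malg K[qpath Q]}.
HB.instance Definition _ K Q := GRing.Lmodule.on (pathalg K Q).

Section PathAlgebra.
Context (K : fieldType) (Q : quiver).
Local Notation KQ := (pathalg K Q).

Definition path_elt (p : qpath Q) : KQ := << 1 *g p >>.
Definition path_elto (o : option (qpath Q)) : KQ :=
  if o is Some p then path_elt p else 0.

Definition linext (h : qpath Q -> KQ) (f : KQ) : KQ :=
  \sum_(p <- msupp f) f@_p *: h p.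

Definition pathalg_mul (f g : KQ) : KQ :=
  linext (fun q => linext (fun p => path_elto (path_comp q p)) g) f.
Definition pathalg_one : KQ := \sum_(x : vertex Q) path_elt (trivial_path x).

Lemma linextEw h (f : KQ) (D : {fset qpath Q}) :
  (msupp f `<=` D)%fset -> linext h f = \sum_(p <- D) f@_p *: h p.
Proof.
move=> le; rewrite /linext (big_fset_incl _ le) // => p _ /mcoeff_outdom ->.
by rewrite scale0r.
Qed.

Lemma linext_is_linear h : linear (linext h).
Proof.
move=> c f g; pose D := (msupp f `|` msupp g `|` msupp (c *: f + g))%fset.
have sf : (msupp f `<=` D)%fset by rewrite /D -fsetUA fsubsetUl.
have sg : (msupp g `<=` D)%fset by rewrite /D fsetUAC fsubsetUr.
rewrite (linextEw h sf) (linextEw h sg) (@linextEw h _ D) ?fsubsetUr //.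
rewrite scaler_sumr -big_split /=; apply: eq_bigr => p _.
by rewrite mcoeffD mcoeffZ scalerDl scalerA.
Qed.

Lemma linextU h p : linext h (path_elt p) = h p.
Proof.
by rewrite /linext msuppU oner_eq0 big_seq_fset1 mcoeffUU scale1r.
Qed.

HB.instance Definition _ h :=
  GRing.isLinear.Build K KQ KQ _ (linext h) (linext_is_linear h).

Lemma pathalgE (f : KQ) : f = \sum_(p <- msupp f) f@_p *: path_elt p.
Proof.
rewrite {1}[f]monalgE; apply: eq_bigr => p _; apply/malgP => k.
by rewrite mcoeffU mcoeffZ /path_elt mcoeffU mulrnAr mulr1.
Qed.

Lemma pathalg_ind (S : KQ -> Prop) :
  S 0 -> (forall c f g, S f -> S g -> S (c *: f + g)) ->
  (forall p, S (path_elt p)) -> forall f, S f.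
Proof.
move=> S0 SD Sp f; rewrite [f]pathalgE; elim: (X in \sum_(p <- X) _) => [|p s IH].
  by rewrite big_nil.
by rewrite big_cons; apply: SD.
Qed.

Lemma pmulDl c (f g h : KQ) :
  pathalg_mul (c *: f + g) h = c *: pathalg_mul f h + pathalg_mul g h.
Proof. exact: linearP. Qed.

Lemma pmulDr c (f g h : KQ) :
  pathalg_mul h (c *: f + g) = c *: pathalg_mul h f + pathalg_mul h g.
Proof.
rewrite /pathalg_mul {1 3 5}/linext scaler_sumr -big_split /=.
apply: eq_bigr => p _; rewrite linearP scalerDr !scalerA.
by rewrite [c * _]mulrC.
Qed.

Lemma pmul0l (h : KQ) : pathalg_mul 0 h = 0.
Proof. exact: linear0. Qed.

Lemma pmul0r (h : KQ) : pathalg_mul h 0 = 0.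
Proof.
by rewrite -[X in pathalg_mul h X](subrr (0 : KQ)) -scaleN1r addrC pmulDr scaleN1r addNr.
Qed.

Lemma pmulUU p q :
  pathalg_mul (path_elt q) (path_elt p) = path_elto (path_comp q p).
Proof. by rewrite /pathalg_mul !linextU. Qed.

Lemma pmulA : associative pathalg_mul.
Proof.
apply: (bilinear_assoc pathalg_ind pmulDl pmulDr) => r q p.
have eL o : pathalg_mul (path_elt r) (path_elto o)
            = path_elto (obind (path_comp r) o).
  by case: o => [u|]; [exact: pmulUU | exact: pmul0r].
have eR o : pathalg_mul (path_elto o) (path_elt p)
            = path_elto (obind (fun u : qpath Q => path_comp u p) o).
  by case: o => [u|]; [exact: pmulUU | exact: pmul0l].
transitivity (path_elto (obind (path_comp r) (path_comp q p))).
  by rewrite -eL; congr pathalg_mul; exact: pmulUU.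
rewrite path_compA -eR; congr pathalg_mul; exact/esym/pmulUU.
Qed.

Lemma pmul1l : left_id pathalg_one pathalg_mul.
Proof.
move=> f; elim/pathalg_ind: f => [|c f f' IH IH'|p]; first by rewrite pmul0r.
  rewrite (pmulDr c f f'); exact: (congr2 (fun a b => c *: a + b) IH IH').
transitivity (\sum_(x : vertex Q) pathalg_mul (path_elt (trivial_path x)) (path_elt p)).
  exact: (raddf_sum (linext _)).
under eq_bigr => x _ do rewrite pmulUU path_comp_trivl.
rewrite (bigD1 (path_end p)) //= eqxx big1 ?addr0 // => x /negPf -> //.
Qed.

Lemma pmul1r : right_id pathalg_one pathalg_mul.
Proof.
move=> f; elim/pathalg_ind: f => [|c f f' IH IH'|p]; first by rewrite pmul0l.
  rewrite (pmulDl c f f'); exact: (congr2 (fun a b => c *: a + b) IH IH').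
transitivity (\sum_(x : vertex Q) pathalg_mul (path_elt p) (path_elt (trivial_path x))).
  by rewrite [LHS]linextU raddf_sum; apply: eq_bigr => x _; exact: etrans (linextU _ _) (esym (pmulUU _ _)).
under eq_bigr => x _ do rewrite pmulUU path_comp_trivr.
rewrite (bigD1 (path_start p)) //= eqxx big1 ?addr0 // => x /negPf -> //.
Qed.

Lemma pmulDl1 : left_distributive pathalg_mul +%R.
Proof. by move=> f g h; have := pmulDl 1 f g h; rewrite !scale1r. Qed.

Lemma pmulDr1 : right_distributive pathalg_mul +%R.
Proof. by move=> f g h; have := pmulDr 1 g h f; rewrite !scale1r. Qed.

Lemma pone_neq0 : pathalg_one != 0.
Proof.
have /card_gt0P[x _] := vertex_nonempty Q.
have E : (pathalg_one)@_(trivial_path x) = 1.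
  transitivity (\sum_(y : vertex Q) (y == x)%:R : K); last first.
    by rewrite (bigD1 x) //= eqxx big1 ?addr0 // => y /negPf ->.
  rewrite /pathalg_one raddf_sum; apply: eq_bigr => y _.
  apply: etrans (mcoeffU _ _ _) _; congr (_ *+ nat_of_bool _).
  apply/eqP/eqP => [/(congr1 (@path_start Q)) //|-> //].
apply/eqP => E0; have := oner_neq0 K; rewrite -E E0.
by rewrite (_ : mcoeff _ 0 = 0) ?eqxx //; exact: mcoeff0.
Qed.

HB.instance Definition _ :=
  GRing.Zmodule_isNzRing.Build KQ pmulA pmul1l pmul1r pmulDl1 pmulDr1 pone_neq0.

Lemma pscaleAl (c : K) (f g : KQ) : c *: (f * g) = (c *: f) * g.
Proof.
exact: (@scale_of_linear K KQ (pathalg_mul^~ g) (fun c a b => pmulDl c a b g)).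
Qed.

HB.instance Definition _ := GRing.Lmodule_isLalgebra.Build K KQ pscaleAl.

Lemma pscaleAr (c : K) (f g : KQ) : c *: (f * g) = f * (c *: g).
Proof.
exact: (@scale_of_linear K KQ (pathalg_mul f) (fun c a b => pmulDr c a b f)).
Qed.

HB.instance Definition _ := GRing.Lalgebra_isAlgebra.Build K KQ pscaleAr.

(* The m-th power of the ideal of KQ generated by the arrows: the span of the
   paths of length at least m. *)
Definition arrow_ideal_pow (m : nat) (f : KQ) : Prop :=
  forall p : qpath Q, f@_p != 0 -> (m <= path_length p)%N.

Definition two_sided_ideal (I : KQ -> Prop) : Prop :=
  [/\ I 0, forall f g, I f -> I g -> I (f + g)
    & forall f g, I f -> I (g * f) /\ I (f * g)].

Definition admissible (I : KQ -> Prop) : Prop :=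
  [/\ two_sided_ideal I, forall f, I f -> arrow_ideal_pow 2 f
    & exists2 m, (2 <= m)%N & forall f, arrow_ideal_pow m f -> I f].

End PathAlgebra.

Definition is_bound_quiver_algebra (K : fieldType) (L : falgType K) : Prop :=
  exists (Q : quiver) (I : pathalg K Q -> Prop),
    admissible I /\
    exists phi : {lrmorphism pathalg K Q -> L},
      (forall x, exists f, phi f = x) /\ (forall f, phi f = 0 <-> I f).

(** * Modules *)

(* A d-dimensional left module is given on the space K^d of column vectors. *)
Definition module (K : fieldType) (L : falgType K) (d : nat) : Type :=
  {lrmorphism L -> 'M[K]_d}.

Section Modules.
Context (K : fieldType) (L : falgType K).
Local Notation module := (module L).

Definition left_ideal (I : {vspace L}) : Prop :=
  forall x y : L, y \in I -> x * y \in I.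

Definition maximal_left_ideal (I : {vspace L}) : Prop :=
  [/\ left_ideal I, I <> fullv
    & forall I' : {vspace L}, left_ideal I' -> (I <= I')%VS ->
        I' = I \/ I' = fullv].

Definition jacobson (x : L) : Prop :=
  forall I : {vspace L}, maximal_left_ideal I -> x \in I.

(* The submodule JM of M. *)
Definition rad d (M : module d) (v : 'cV[K]_d) : Prop :=
  exists (k : nat) (x : 'I_k -> L) (u : 'I_k -> 'cV[K]_d),
    (forall i, jacobson (x i)) /\ v = \sum_(i < k) M (x i) *m u i.

Definition submodule d (M : module d) (W : {vspace 'cV[K]_d}) : Prop :=
  forall (x : L) (v : 'cV[K]_d), v \in W -> M x *m v \in W.

Definition modhom m n (M : module m) (N : module n) (f : 'M[K]_(n, m)) : Prop :=
  forall x : L, f *m M x = N x *m f.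

Definition surj m n (f : 'M[K]_(n, m)) : Prop :=
  forall w : 'cV[K]_n, exists v : 'cV[K]_m, f *m v = w.

Definition modiso d (M N : module d) : Prop :=
  exists2 g : 'M[K]_d, g \in unitmx & modhom M N g.

(* N is isomorphic to the quotient of M by the subspace W. *)
Definition is_quotient m n (M : module m) (W : 'cV[K]_m -> Prop) (N : module n) :
    Prop :=
  exists f : 'M[K]_(n, m),
    [/\ modhom M N f, surj f & forall v : 'cV[K]_m, W v <-> f *m v = 0].

Definition simple d (M : module d) : Prop :=
  (0 < d)%N /\
  forall W : {vspace 'cV[K]_d}, submodule M W -> W = 0%VS \/ W = fullv.

Definition is_top d t (M : module d) (T : module t) : Prop :=
  is_quotient M (rad M) T.

Definition local_module d (M : module d) : Prop :=
  exists (t : nat) (T : module t), is_top M T /\ simple T.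

Definition same_top d (M M' : module d) : Prop :=
  exists (t : nat) (T : module t), is_top M T /\ is_top M' T.

Definition projective p (P : module p) : Prop :=
  forall m n (X : module m) (Y : module n) (f : 'M[K]_(n, m)) (g : 'M[K]_(n, p)),
    modhom X Y f -> surj f -> modhom P Y g ->
    exists2 h : 'M[K]_(m, p), modhom P X h & f *m h = g.

(* The last condition says that the kernel of f is superfluous. *)
Definition projective_cover p d (P : module p) (M : module d)
    (f : 'M[K]_(d, p)) : Prop :=
  [/\ projective P, modhom P M f, surj f
    & forall W : {vspace 'cV[K]_p}, submodule P W ->
        (forall v, exists2 w, w \in W & f *m (v - w) = 0) -> W = fullv].

Definition algebra_generators r (a : 'I_r -> L) : Prop :=
  (agenv <<[seq a i | i <- enum 'I_r]>>%VS = fullv)%VS.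

End Modules.

(** * Spaces with coordinates, Zariski topology and regular functions *)

(* Imported only here because mpoly and monalg share names and notations; for
   the same reason the type {mpoly K[n]} is written [mpoly n K]. *)
From mathcomp Require Import mpoly.

(* A set each of whose points is represented by one or several coordinate
   vectors: by one for an affine space, by all admissible choices of
   (multi)homogeneous coordinates for a (multi)projective space. *)
Record coord_space (K : fieldType) := CoordSpace {
  point :> Type;
  coord : finType;
  represents : point -> (coord -> K) -> Prop
}.

Section Zariski.
Context (K : fieldType).
Implicit Types X : coord_space K.

Definition poly_in X : Type := mpoly #|coord X| K.

Definition peval X (F : poly_in X) (v : coord X -> K) : K :=
  F.@[fun k : 'I_#|coord X| => v (enum_val k)].

(* For infinite K, if a polynomial vanishes at all representatives of a point
   then so do its (multi)homogeneous components, whence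
   homogeneity need not be imposed. *)
Definition vanishes X (F : poly_in X) (x : X) : Prop :=
  forall v, represents x v -> peval F v = 0.

Definition zclosure X (A : X -> Prop) (x : X) : Prop :=
  forall F : poly_in X, (forall y, A y -> vanishes F y) -> vanishes F x.

Definition zclosed_in X (Y Z : X -> Prop) : Prop :=
  (forall x, Z x -> Y x) /\ (forall x, Y x -> zclosure Z x -> Z x).

Definition zopen_in X (Y U : X -> Prop) : Prop :=
  (forall x, U x -> Y x) /\ zclosed_in Y (fun x => Y x /\ ~ U x).

(* Locally a quotient F/G of polynomials.  As the value of the quotient is
   the same for all representatives of a point, F and G may be replaced by
   (multi)homogeneous components of the same (multi)degree. *)
Definition regular_on X (U : X -> Prop) (f : X -> K) : Prop :=
  forall x, U x -> exists F G : poly_in X,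
    (exists2 v, represents x v & peval G v != 0) /\
    (forall y v, U y -> represents y v -> peval G v != 0 ->
       f y = peval F v / peval G v).

(* A morphism from the subspace Y of X to the subspace Y' of X'; the values of
   f outside Y are irrelevant. *)
Definition morphism_on X X' (Y : X -> Prop) (Y' : X' -> Prop) (f : X -> X') :
    Prop :=
  [/\ forall x, Y x -> Y' (f x),
      forall Z, zclosed_in Y' Z -> zclosed_in Y (fun x => Y x /\ Z (f x))
    & forall U h, zopen_in Y' U -> regular_on U h ->
        regular_on (fun x => Y x /\ U (f x)) (fun x => h (f x))].

Definition isomorphic_varieties X X' (Y : X -> Prop) (Y' : X' -> Prop) : Prop :=
  exists (f : X -> X') (g : X' -> X),
    [/\ morphism_on Y Y' f, morphism_on Y' Y g,
        forall x, Y x -> g (f x) = x & forall x, Y' x -> f (g x) = x].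

Definition irreducible_in X (Y Z : X -> Prop) : Prop :=
  (exists x, Z x) /\
  forall A B, zclosed_in Y A -> zclosed_in Y B ->
    (forall x, Z x -> A x \/ B x) ->
    (forall x, Z x -> A x) \/ (forall x, Z x -> B x).

Definition irreducible_chain X (Y : X -> Prop) (n : nat) : Prop :=
  exists Z : nat -> X -> Prop,
    (forall i, (i <= n)%N -> zclosed_in Y (Z i) /\ irreducible_in Y (Z i)) /\
    (forall i, (i < n)%N -> (forall x, Z i x -> Z i.+1 x) /\
                            (exists2 x, Z i.+1 x & ~ Z i x)).

(* Krull dimension of Y with the Zariski topology. *)
Definition has_dim X (Y : X -> Prop) (n : nat) : Prop :=
  irreducible_chain Y n /\ forall m, irreducible_chain Y m -> (m <= n)%N.

End Zariski.

(* The affine space of r-tuples of d x d matrices. *)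
Definition matrix_tuples (K : fieldType) (r d : nat) : coord_space K :=
  @CoordSpace K ('I_r -> 'M[K]_d) ('I_r * 'I_d * 'I_d)%type
    (fun x v => forall i j k, v (i, j, k) = x i j k).

(* The Grassmannian Gr(d', K^N) with its Pluecker coordinates.  The minors are
   indexed by all maps from 'I_d' to 'I_N, not only by the increasing ones;
   the additional coordinates are 0, or equal to others up to sign. *)
Definition Gr (K : fieldType) (d' N : nat) : coord_space K :=
  @CoordSpace K {U : {vspace 'cV[K]_N} | \dim U == d'} {ffun 'I_d' -> 'I_N}
    (fun U v => exists b : d'.-tuple 'cV[K]_N,
       basis_of (val U) b /\
       forall h : {ffun 'I_d' -> 'I_N},
         v h = \det (\matrix_(i < d', j < d') (tnth b j) (h i) 0)).

Definition Proj_points (K : fieldType) (n : nat) : Type :=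
  {U : {vspace 'rV[K]_n.+1} | \dim U == 1%N}.

(* The product of the projective spaces P^(n i), with multihomogeneous
   coordinates. *)
Definition ProdProj (K : fieldType) (s : nat) (n : 'I_s -> nat) : coord_space K :=
  @CoordSpace K (forall i : 'I_s, Proj_points K (n i))
    {i : 'I_s & 'I_(n i).+1}
    (fun x v => forall i : 'I_s,
       val (x i) = <[\row_(j < (n i).+1) v (Tagged (fun i => 'I_(n i).+1) j)]>%VS).

(** * Degenerations *)

Section Degenerations.
Context (K : fieldType) (L : falgType K).
Local Notation module := (module L).

Section Order.
Context (r : nat) (a : 'I_r -> L) (d : nat).
Implicit Types M N : module d.

Definition mod_point M : matrix_tuples K r d := fun i => M (a i).

Definition gl_orbit (x : matrix_tuples K r d) : matrix_tuples K r d -> Prop :=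
  fun y => exists2 g : 'M[K]_d, g \in unitmx &
             forall i, y i = g *m x i *m invmx g.

Definition deg_le M N : Prop := zclosure (gl_orbit (mod_point M)) (mod_point N).

Definition deg_lt M N : Prop := deg_le M N /\ ~ modiso M N.

Definition topdeg M N : Prop := deg_le M N /\ same_top M N.

Definition saturated_chain M (k : nat) (X : nat -> module d) : Prop :=
  [/\ modiso M (X 0%N),
      forall i, (i <= k)%N -> topdeg M (X i),
      forall i, (i < k)%N -> deg_lt (X i) (X i.+1) /\
        ~ (exists N, [/\ topdeg M N, deg_lt (X i) N & deg_lt N (X i.+1)])
    & ~ (exists N, topdeg M N /\ deg_lt (X k) N)].

Definition saturated_chain_length M (k : nat) : Prop :=
  exists X : nat -> module d, saturated_chain M k X.

End Order.

Section Grass.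
Context (N d' : nat) (P : module N).
Implicit Types C D : Gr K d' N.

(* The points of the closed subvariety of Gr(d', JP), which is itself closed
   in Gr(d', P), consisting of the submodules of JP. *)
Definition in_Grass C : Prop :=
  submodule P (val C) /\ forall v, v \in val C -> rad P v.

Definition aut_orbit C : Gr K d' N -> Prop :=
  fun D => exists g : 'M[K]_N,
    [/\ g \in unitmx, modhom P P g
      & val D = (linfun (mulmx g : 'cV[K]_N -> 'cV[K]_N) @: val C)%VS].

Definition max_topdeg C : Gr K d' N -> Prop :=
  fun D => [/\ in_Grass D, zclosure (aut_orbit C) D
             & forall D', aut_orbit D D' -> D' = D].

End Grass.

(* M = P/C. *)
Definition presents p d (P : module p) (M : module d) (C : {vspace 'cV[K]_p}) :
    Prop :=
  exists f : 'M[K]_(d, p),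
    projective_cover P M f /\ forall v, v \in C <-> f *m v = 0.

End Degenerations.

(* Main.v *)
From mathcomp Require Import all_boot all_order all_algebra all_field.
From HB Require Import structures.
From mathcomp Require Import perm ring.
From mathcomp Require finmap monalg.
From Stdlib Require Import Classical_Prop FunctionalExtensionality.
Require Import Defs.

Set Implicit Arguments.
Unset Strict Implicit.
Unset Printing Implicit Defensive.

Import GRing.Theory.
Local Open Scope ring_scope.

(** Let J be a finite set partitioned into blocks, indexed by A, and let B be a
    subset of J that contains no block.  The quiver has a vertex 1 with a loop w_j
    for each j in J, and an arrow g_k from 1 to a sink k for each block and for
    each element of B.  Products of two loops vanish, and g_k w_j vanishes unless j
    lies in the block k, respectively j = k if k is in B.  The module M is the
    quotient of P = L e_1 by the span C of the arrows g_k.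

    The automorphisms of P are the right multiplications by c e_1 + sum s_j w_j
    with c nonzero.  They move C to the sums of lines
    K (g_k + sum s_j g_k w_j), one for each sink k, so the orbit of C is an affine
    space with coordinates s_j ([orbit_affine]); its dimension is |J|.  When the
    coordinates of a block go to infinity in the direction t, the line at its sink
    tends to K (sum t_j g_k w_j), which no automorphism moves.  The line at b in B
    has the parameter s_b alone, and its only fixed limit is K g_b w_b.  Hence the
    variety of maximal degenerations is the product of the projective spaces of
    the blocks ([max_topdegP], [max_topdeg_ProdProj]).

    A top-stable degeneration of M is described by the set of blocks that have
    gone to infinity, with their directions t, and by the set of those b in B whose
    line has become K g_b w_b.  The latter is forced when the block of b has gone to
    infinity with t_b nonzero, is impossible when this block has not moved, and is
    a free choice when the block has moved with t_b = 0 ([classification]).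
    Therefore a saturated chain has one step for each block, and one more step for
    each b in B at which the final direction t vanishes.  As no block is contained
    in B, the number of these b takes all values from 0 to |B|, and the lengths of
    the chains are the integers from |A| to |A| + |B| ([chain_lengths]).

    With one block of n_i + 1 elements for each i and l - s blocks of one element,
    there are l blocks, J has l + sum n_i elements, and the maximal degenerations
    form the product of the P^(n_i).  Version (ii) is the case where B is empty.  For
    version (i), B consists of n_i - 1 elements of each of the first s blocks.

    Degenerations are constructed from curves of submodules (1 + tau Z) W with
    Z^2 = 0 ([curve_degeneration]).  They are excluded by semicontinuity: the
    dimension of the space of vectors killed by given elements of the algebra
    cannot decrease ([deg_le_rank]), which yields enough relations for a generator
    of a degeneration of M to identify it.  Morphisms of varieties are
    all given by fractions of coordinates ([lift_morphism]), and the dimension of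
    affine space is found by counting linearly independent monomials
    ([has_dim_affine]). *)

(** * The algebra *)

Section AlgebraDef.
Context (K : fieldType) (J T : finType) (R : T -> pred J).

(** The nonzero paths that start at the vertex 1: the pairs (None, None),
    (None, Some j), (Some k, None), (Some k, Some j) encode the trivial path, the
    loop w_j, the arrow g_k and the path g_k w_j. *)
Definition nonzero_path (y : option T * option J) : bool :=
  if y is (Some k, Some j) then R k j else true.

Definition ppath : Type := {y : option T * option J | nonzero_path y}.
HB.instance Definition _ := Finite.on ppath.

Definition ptriv : ppath := exist _ (None, None) isT.
Definition ploop j : ppath := exist _ (None, Some j) isT.
Definition parr k : ppath := exist _ (Some k, None) isT.

(** The summand T stands for the trivial paths at the sinks. *)
Definition alg : Type := {ffun ppath + T -> K^o}.
HB.instance Definition _ := Vector.on alg.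

End AlgebraDef.

(** Coefficients are elements of the field K rather than of the K-space K^o.  This
    and the following definitions are locked because comparing two finite
    functions by unfolding them is intractable. *)
HB.lock Definition cf (K : fieldType) (J T : finType) (R : T -> pred J)
  (x : alg K R) (i : ppath R + T) : K := x i.

HB.lock Definition alg_of (K : fieldType) (J T : finType) (R : T -> pred J)
  (f : ppath R + T -> K) : alg K R := [ffun i => f i].

HB.lock Definition path_basis (K : fieldType) (J T : finType) (R : T -> pred J)
  (i : ppath R + T) : alg K R := alg_of (fun i' => (i' == i)%:R).

Section Coefficients.
Context (K : fieldType) (J T : finType) (R : T -> pred J).
Local Notation alg := (alg K R).
Implicit Types (x y z : alg).

Lemma cf_alg_of (f : ppath R + T -> K) i : cf (alg_of f) i = f i.
Proof. by rewrite cf.unlock alg_of.unlock ffunE. Qed.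

Lemma cf_inj x y : (forall i, cf x i = cf y i) -> x = y.
Proof. by rewrite cf.unlock => xy; apply/ffunP => i; apply: xy. Qed.

Lemma cfD x y i : cf (x + y) i = cf x i + cf y i.
Proof. by rewrite cf.unlock ffunE. Qed.

Lemma cf0 i : cf (0 : alg) i = 0.
Proof. by rewrite cf.unlock ffunE. Qed.

Lemma cfZ c x i : cf (c *: x) i = c * cf x i.
Proof. by rewrite cf.unlock ffunE. Qed.

Lemma cf_sum (I : Type) (r : seq I) (P : pred I) (f : I -> alg) i :
  cf (\sum_(a <- r | P a) f a) i = \sum_(a <- r | P a) cf (f a) i.
Proof. by rewrite cf.unlock sum_ffunE. Qed.

Lemma cf_basis (i i' : ppath R + T) : cf (path_basis K i) i' = (i' == i)%:R.
Proof. by rewrite path_basis.unlock cf_alg_of. Qed.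

Definition e1 : alg := path_basis K (inl (ptriv R) : ppath R + T).
Definition ev k : alg := path_basis K (inr k : ppath R + T).
Definition lo j : alg := path_basis K (inl (ploop R j) : ppath R + T).
Definition ar k : alg := path_basis K (inl (parr R k) : ppath R + T).

Lemma cf_e1 i : cf e1 i = (i == inl (ptriv R))%:R. Proof. exact: cf_basis. Qed.
Lemma cf_ev k i : cf (ev k) i = (i == inr k)%:R. Proof. exact: cf_basis. Qed.
Lemma cf_lo j i : cf (lo j) i = (i == inl (ploop R j))%:R. Proof. exact: cf_basis. Qed.
Lemma cf_ar k i : cf (ar k) i = (i == inl (parr R k))%:R. Proof. exact: cf_basis. Qed.

End Coefficients.

Definition mul_cf (K : fieldType) (J T : finType) (R : T -> pred J)
  (x y : alg K R) (i : ppath R + T) : K := match i with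
  | inr k => cf x (inr k) * cf y (inr k)
  | inl p => match val p with
    | (None, None) => cf x (inl (ptriv R)) * cf y (inl (ptriv R))
    | (None, Some j) => cf x (inl (ptriv R)) * cf y (inl (ploop R j))
                        + cf x (inl (ploop R j)) * cf y (inl (ptriv R))
    | (Some k, None) => cf x (inl (parr R k)) * cf y (inl (ptriv R))
                        + cf x (inr k) * cf y (inl (parr R k))
    | (Some k, Some j) => cf x (inl (parr R k)) * cf y (inl (ploop R j))
                          + cf x (inl p) * cf y (inl (ptriv R))
                          + cf x (inr k) * cf y (inl p)
    end end.

HB.lock Definition alg_mul (K : fieldType) (J T : finType) (R : T -> pred J)
  (x y : alg K R) : alg K R := alg_of (mul_cf x y).

Definition one_cf (K : fieldType) (J T : finType) (R : T -> pred J)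
  (i : ppath R + T) : K := if i is inl y then (val y == (None, None))%:R else 1.

HB.lock Definition alg_one (K : fieldType) (J T : finType) (R : T -> pred J) :
    alg K R := alg_of (@one_cf K J T R).

Section RingStructure.
Context (K : fieldType) (J T : finType) (R : T -> pred J).
Local Notation alg := (alg K R).
Implicit Types (x y z : alg).

Let mulE x y i : cf (alg_mul x y) i = mul_cf x y i.
Proof. by rewrite alg_mul.unlock; exact: cf_alg_of. Qed.

Let oneE i : cf (alg_one K R) i = one_cf K i.
Proof. by rewrite alg_one.unlock; exact: cf_alg_of. Qed.

Lemma alg_mulA : associative (@alg_mul K J T R).
Proof.
by move=> x y z; apply: cf_inj => -[[[[k|] [j|]] v]|k]; rewrite !mulE /= ?mulE /=; ring.
Qed.

Lemma alg_mul1l : left_id (alg_one K R) (@alg_mul K J T R).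
Proof.
by move=> x; apply: cf_inj => -[[[[k|] [j|]] v]|k]; rewrite !mulE /= !oneE /=
  ?mul1r ?mul0r ?add0r ?addr0 //; congr (cf x (inl _)); apply: val_inj.
Qed.

Lemma alg_mul1r : right_id (alg_one K R) (@alg_mul K J T R).
Proof.
by move=> x; apply: cf_inj => -[[[[k|] [j|]] v]|k]; rewrite !mulE /= !oneE /=
  ?mulr1 ?mulr0 ?add0r ?addr0 //; congr (cf x (inl _)); apply: val_inj.
Qed.

Lemma alg_mulDl : left_distributive (@alg_mul K J T R) +%R.
Proof.
by move=> x y z; apply: cf_inj => -[[[[k|] [j|]] v]|k]; rewrite cfD !mulE /= !cfD; ring.
Qed.

Lemma alg_mulDr : right_distributive (@alg_mul K J T R) +%R.
Proof.
by move=> x y z; apply: cf_inj => -[[[[k|] [j|]] v]|k]; rewrite cfD !mulE /= !cfD; ring.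
Qed.

Lemma alg_one_neq0 : alg_one K R != 0.
Proof.
apply/eqP => /(congr1 (fun x => cf x (inl (ptriv R)))); rewrite oneE cf0 /= => /eqP.
by rewrite oner_eq0.
Qed.

HB.instance Definition _ := GRing.Zmodule_isNzRing.Build alg
  alg_mulA alg_mul1l alg_mul1r alg_mulDl alg_mulDr alg_one_neq0.

Lemma cfM x y i : cf (x * y) i = mul_cf x y i.
Proof. exact: mulE. Qed.

Lemma cf1 i : cf (1 : alg) i = one_cf K i.
Proof. exact: oneE. Qed.

Lemma alg_scaleAl (c : K) x y : c *: (x * y) = (c *: x) * y.
Proof.
by apply: cf_inj => -[[[[k|] [j|]] v]|k]; rewrite cfZ !cfM /= !cfZ; ring.
Qed.

HB.instance Definition _ := GRing.Lmodule_isLalgebra.Build K alg alg_scaleAl.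

Lemma alg_scaleAr (c : K) x y : c *: (x * y) = x * (c *: y).
Proof.
by apply: cf_inj => -[[[[k|] [j|]] v]|k]; rewrite cfZ !cfM /= !cfZ; ring.
Qed.

HB.instance Definition _ := GRing.Lalgebra_isAlgebra.Build K alg alg_scaleAr.
HB.instance Definition _ := Algebra_isFalgebra.Build K alg.

End RingStructure.

Lemma module_of_morphism (K : fieldType) (L : falgType K) d (F : L -> 'M[K]_d) :
  linear F -> F 1 = 1 -> (forall x y, F (x * y) = F x *m F y) ->
  {N : module L d | forall x, N x = F x}.
Proof.
move=> Flin F1 FM.
pose lF := GRing.isLinear.Build K L 'M[K]_d _ F Flin.
pose mF := GRing.isMonoidMorphism.Build L 'M[K]_d F (conj F1 FM).
pose N : {lrmorphism L -> 'M[K]_d} := HB.pack F lF mF.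
by exists N.
Qed.

Section ModuleFacts.
Context (K : fieldType) (L : falgType K).

Lemma moduleM d (N : module L d) x y : N (x * y) = N x *m N y.
Proof. exact: rmorphM. Qed.

Lemma module1 d (N : module L d) : N 1 = 1%:M.
Proof. exact: rmorph1. Qed.

End ModuleFacts.

Section AlgebraTheory.
Context (K : fieldType) (J T : finType) (R : T -> pred J).
Local Notation L := (alg K R).
Local Notation e1 := (e1 K R).
Local Notation ev := (ev K R).
Local Notation lo := (lo K R).
Local Notation ar := (ar K R).
Implicit Types (x y z : L) (j : J) (k : T).

Ltac alg_ext := apply/cf_inj => -[[[[?|] [?|]] ?]|?];
  rewrite ?cfZ ?cf0 ?cfM /= /mul_cf /= ?(cf_e1, cf_ev, cf_lo, cf_ar, cf_basis) /=;
  rewrite ?(mulr0, mul0r, mulr1, mul1r, addr0, add0r).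

Lemma lo_e1 j : lo j * e1 = lo j. Proof. by alg_ext. Qed.
Lemma e1_lo j : e1 * lo j = lo j. Proof. by alg_ext. Qed.
Lemma e1_e1 : e1 * e1 = e1.
Proof. by alg_ext. Qed.
Lemma ar_e1 k : ar k * e1 = ar k. Proof. by alg_ext. Qed.
Lemma lo_lo i j : lo i * lo j = 0. Proof. by alg_ext. Qed.
Lemma e1_ar k : e1 * ar k = 0. Proof. by alg_ext. Qed.
Lemma lo_ar j k : lo j * ar k = 0. Proof. by alg_ext. Qed.
Lemma ar_ar k k' : ar k * ar k' = 0. Proof. by alg_ext. Qed.
Lemma ev_e1 k : ev k * e1 = 0. Proof. by alg_ext. Qed.
Lemma ev_lo k j : ev k * lo j = 0. Proof. by alg_ext. Qed.

Lemma eq_parr k k' : (inl (parr R k) == inl (parr R k') :> ppath R + T) = (k == k').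
Proof. by apply/eqP/eqP => [[->]|->]. Qed.

Lemma eq_ploop j j' : (inl (ploop R j) == inl (ploop R j') :> ppath R + T) = (j == j').
Proof. by apply/eqP/eqP => [[->]|->]. Qed.

Lemma eq_sink k k' : (inr k == inr k' :> ppath R + T) = (k == k').
Proof. by apply/eqP/eqP => [[->]|->]. Qed.

Lemma ev_ar k k' : ev k * ar k' = (k == k')%:R *: ar k'.
Proof.
apply/cf_inj => -[[[[k1|] [j1|]] v]|k1];
  rewrite cfZ cfM /mul_cf /= ?cf_ev ?cf_ar /= ?mul0r ?mulr0 ?add0r //.
  have F : (inl (exist _ (Some k1, Some j1) v) == inl (parr R k') :> ppath R + T) = false.
    by apply/negbTE/eqP => -[].
  by rewrite F !mulr0.
have -> : exist _ (Some k1, None) v = parr R k1 by apply: val_inj.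
rewrite eq_sink eq_parr -!natrM !mulnb; congr ((nat_of_bool _)%:R).
by do !case: eqP => //= *; congruence.
Qed.

Lemma ar_lo_eq0 k j : ~~ R k j -> ar k * lo j = 0.
Proof.
move=> nR; alg_ext => //; rewrite eq_parr eq_ploop -natrM mulnb.
by case: andP => // -[/eqP ek /eqP ej]; case/negP: nR; rewrite -ek -ej.
Qed.

Lemma ar_loE k j (v : R k j) :
  ar k * lo j = path_basis K (inl (exist _ (Some k, Some j) v : ppath R)).
Proof.
alg_ext => //; try by case: eqP => // -[].
by rewrite eq_parr eq_ploop -natrM mulnb.
Qed.

Lemma mul_ev x k : x * ev k = cf x (inr k) *: ev k.
Proof.
apply: cf_inj => -[[[[k'|] [j|]] v]|k'];
  rewrite cfZ cfM /mul_cf /= !cf_ev /= ?mulr0 ?addr0 //.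
by rewrite eq_sink; case: eqP => [->|]; rewrite ?mulr0.
Qed.

Lemma path_basis_sum x : x = \sum_i cf x i *: path_basis K i.
Proof.
apply/cf_inj => i; rewrite cf_sum (bigD1 i) //= big1 => [|i' ne]; rewrite cfZ cf_basis.
  by rewrite eqxx addr0 mulr1.
by rewrite eq_sym (negPf ne) mulr0.
Qed.

Lemma alg_ind (S : L -> Prop) :
  (forall c x y, S x -> S y -> S (c *: x + y)) ->
  S e1 -> (forall j, S (lo j)) -> (forall k, S (ar k)) ->
  (forall k j, R k j -> S (ar k * lo j)) -> (forall k, S (ev k)) -> forall x, S x.
Proof.
move=> SD S1 Sl Sa Sal Se x.
have S0 : S 0 by have := SD (-1) _ _ S1 S1; rewrite scaleN1r addNr.
rewrite [x]path_basis_sum; elim: (index_enum _) => [|i r IH]; first by rewrite big_nil.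
rewrite big_cons; apply: SD => //.
case: i => [[[[k|] [j|]] v]|k]; last exact: Se.
- by rewrite -ar_loE; exact: Sal.
- rewrite (_ : path_basis K _ = ar k); first exact: Sa.
  by congr (path_basis K (inl _)); apply: val_inj.
- rewrite (_ : path_basis K _ = lo j); first exact: Sl.
  by congr (path_basis K (inl _)); apply: val_inj.
- rewrite (_ : path_basis K _ = e1); first exact: S1.
  by congr (path_basis K (inl _)); apply: val_inj.
Qed.

Lemma one_sum : 1 = e1 + \sum_k ev k.
Proof.
apply/cf_inj => i; rewrite cfD cf_sum cf1 cf_e1; case: i => [y|k] /=.
  rewrite big1 ?addr0 => [|k _]; first by [].
  by rewrite cf_ev.
rewrite add0r (bigD1 k) //= big1 ?addr0 => [|k' ne]; rewrite cf_ev eq_sink ?eqxx //.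
by rewrite eq_sym (negPf ne).
Qed.

Lemma e1_corner x : exists c t, e1 * x * e1 = c *: e1 + \sum_j t j *: lo j.
Proof.
have base c t y : e1 * y * e1 = c *: e1 + \sum_j t j *: lo j ->
  exists c t, e1 * y * e1 = c *: e1 + \sum_j t j *: lo j by exists c, t.
have z : 0 = 0 *: e1 + \sum_j (fun=> 0) j *: lo j.
  by rewrite scale0r add0r big1 // => j _; rewrite scale0r.
elim/alg_ind: x => [c x y [c1 [t1 E1]] [c2 [t2 E2]]||i|k|k i _|k].
- apply: (base (c * c1 + c2) (fun j => c * t1 j + t2 j)).
  rewrite mulrDr mulrDl -scalerAr -scalerAl E1 E2 scalerDr scalerA scalerDl.
  rewrite addrACA scaler_sumr -big_split /=; congr (_ + _).
  by apply: eq_bigr => j _; rewrite scalerDl scalerA.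
- apply: (base 1 (fun=> 0)); rewrite !e1_e1 scale1r big1 ?addr0 // => j _.
  by rewrite scale0r.
- apply: (base 0 (fun j => (j == i)%:R)); rewrite e1_lo lo_e1 scale0r add0r.
  rewrite (bigD1 i) //= eqxx scale1r big1 ?addr0 // => j /negPf ->.
  by rewrite scale0r.
- by apply: (base 0 (fun=> 0)); rewrite e1_ar mul0r.
- by apply: (base 0 (fun=> 0)); rewrite mulrA e1_ar !mul0r.
- by apply: (base 0 (fun=> 0)); rewrite -mulrA ev_e1 mulr0.
Qed.

Lemma ev_corner k x :
  exists c t, ev k * x * e1 = c *: ar k + \sum_(j | R k j) t j *: (ar k * lo j).
Proof.
have base c t y : ev k * y * e1 = c *: ar k + \sum_(j | R k j) t j *: (ar k * lo j) ->
  exists c t, ev k * y * e1 = c *: ar k + \sum_(j | R k j) t j *: (ar k * lo j)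
  by exists c, t.
have z : 0 = 0 *: ar k + \sum_(j | R k j) (fun=> 0) j *: (ar k * lo j).
  by rewrite scale0r add0r big1 // => j _; rewrite scale0r.
elim/alg_ind: x => [c x y [c1 [t1 E1]] [c2 [t2 E2]]||i|k'|k' i Rki|k'].
- apply: (base (c * c1 + c2) (fun j => c * t1 j + t2 j)).
  rewrite mulrDr mulrDl -scalerAr -scalerAl E1 E2 scalerDr scalerA scalerDl.
  rewrite addrACA scaler_sumr -big_split /=; congr (_ + _).
  by apply: eq_bigr => j _; rewrite scalerDl scalerA.
- by apply: (base 0 (fun=> 0)); rewrite ev_e1 mul0r.
- by apply: (base 0 (fun=> 0)); rewrite ev_lo mul0r.
- apply: (base (k == k')%:R (fun=> 0)); rewrite ev_ar -scalerAl ar_e1.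
  rewrite [X in _ + X]big1 ?addr0 => [|j _]; last by rewrite scale0r.
  by case: eqP => [->//|_]; rewrite !scale0r.
- apply: (base 0 (fun j => ((k == k') && (j == i))%:R)).
  rewrite mulrA ev_ar -!scalerAl -mulrA lo_e1 scale0r add0r.
  have [ek|_] := eqVneq k k'; last first.
    by rewrite scale0r big1 // => j _; rewrite scale0r.
  rewrite -ek in Rki *; rewrite scale1r (bigD1 i) //= eqxx scale1r.
  by rewrite big1 ?addr0 // => j /andP[_ /negPf ->]; rewrite scale0r.
- by apply: (base 0 (fun=> 0)); rewrite -mulrA ev_e1 mulr0.
Qed.

End AlgebraTheory.

(** * The quiver of the algebra *)

Lemma sum_option (I : finType) (V : nmodType) (F : option I -> V) :
  \sum_o F o = F None + \sum_i F (Some i).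
Proof.
rewrite (bigD1 None) //=; congr (_ + _).
rewrite (reindex_omap Some id) /=; last by case.
by apply: eq_bigl => i; rewrite eqxx.
Qed.

Section PathMorphism.
Import finmap monalg.
Context (K : fieldType) (Q : quiver) (L : falgType K) (h : qpath Q -> L).

Definition path_extension (f : pathalg K Q) : L := \sum_(p <- msupp f) f@_p *: h p.

Lemma path_extensionEw (f : pathalg K Q) (D : {fset qpath Q}) :
  (msupp f `<=` D)%fset -> path_extension f = \sum_(p <- D) f@_p *: h p.
Proof.
move=> le; rewrite /path_extension (big_fset_incl _ le) // => p _ /mcoeff_outdom ->.
by rewrite scale0r.
Qed.

Lemma path_extension_linear : linear path_extension.
Proof.
move=> c f g; pose D := (msupp f `|` msupp g `|` msupp (c *: f + g))%fset.
have sf : (msupp f `<=` D)%fset by rewrite /D -fsetUA fsubsetUl.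
have sg : (msupp g `<=` D)%fset by rewrite /D fsetUAC fsubsetUr.
rewrite (path_extensionEw sf) (path_extensionEw sg) (@path_extensionEw _ D) ?fsubsetUr //.
rewrite scaler_sumr -big_split /=; apply: eq_bigr => p _.
by rewrite mcoeffD mcoeffZ scalerDl scalerA.
Qed.

Lemma path_extensionU p : path_extension (path_elt K p) = h p.
Proof. by rewrite /path_extension msuppU oner_eq0 big_seq_fset1 mcoeffUU scale1r. Qed.

Lemma path_algebra_morphism :
  (forall p q, h q * h p = oapp h 0 (path_comp q p)) ->
  \sum_x h (trivial_path x) = 1 ->
  {phi : {lrmorphism pathalg K Q -> L} | forall f, phi f = path_extension f}.
Proof.
move=> hM h1; have lin := path_extension_linear.
have ext0 : path_extension 0 = 0.
  have := lin 1 0 0; rewrite !scale1r addr0 => /eqP.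
  by rewrite -subr_eq subrr eq_sym => /eqP.
have e1 : path_extension 1 = 1.
  rewrite -h1 -[1]/(pathalg_one K Q) /pathalg_one.
  elim: (index_enum _) => [|x s IH]; first by rewrite !big_nil.
  by rewrite !big_cons -[path_elt _ _]scale1r lin scale1r path_extensionU IH.
have eM f g : path_extension (pathalg_mul f g) = path_extension f * path_extension g.
  elim/pathalg_ind: f => [|c f f' IH IH'|q].
  - by rewrite pmul0l ext0 mul0r.
  - rewrite pmulDl; move: (pathalg_mul f g) (pathalg_mul f' g) IH IH' => u u' IH IH'.
    by rewrite !lin IH IH' mulrDl scalerAl.
  elim/pathalg_ind: g => [|c g g' IH IH'|p].
  - by rewrite pmul0r ext0 mulr0.
  - rewrite pmulDr; move: (pathalg_mul _ g) (pathalg_mul _ g') IH IH' => u u' IH IH'.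
    by rewrite !lin IH IH' mulrDr scalerAr.
  rewrite pmulUU [X in _ = X * _]path_extensionU [X in _ = _ * X]path_extensionU hM.
  by case: path_comp => [r|] //=; rewrite path_extensionU.
pose lF := GRing.isLinear.Build K (pathalg K Q) L _ path_extension lin.
pose mF := GRing.isMonoidMorphism.Build (pathalg K Q) L path_extension (conj e1 eM).
pose phi : {lrmorphism pathalg K Q -> L} := HB.pack path_extension lF mF.
by exists phi.
Qed.

End PathMorphism.

Section BoundQuiver.
Import finmap monalg.
Context (K : fieldType) (J T : finType) (R : T -> pred J).
Local Notation L := (alg K R).
Local Notation e1 := (e1 K R).
Local Notation ev := (ev K R).
Local Notation lo := (lo K R).
Local Notation ar := (ar K R).

(** None is the vertex 1, which carries the loops. *)
Definition loop_quiver : quiver := @Quiver (option T) (J + T)%type (fun=> None)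
  (fun a => match a with inl _ => None | inr k => Some k end)
  (introT card_gt0P (ex_intro _ None isT)).

Definition vertex_image (x : option T) : L := if x is Some k then ev k else e1.
Definition arrow_image (a : J + T) : L :=
  match a with inl j => lo j | inr k => ar k end.

Fixpoint walk_image (x : option T) (s : seq (J + T)) : L :=
  if s is a :: s' then walk_image (@arr_tgt loop_quiver a) s' * arrow_image a
  else vertex_image x.

Definition path_image (p : qpath loop_quiver) : L := walk_image (path_start p) (path_arrows p).

Lemma vertex_image_mul x y :
  vertex_image x * vertex_image y = if x == y then vertex_image x else 0.
Proof.
case: x y => [k|] [k'|] /=.
- rewrite mul_ev cf_ev eq_sink eq_sym -[Some k == _]/(k == k').
  by case: eqP => [->|_]; rewrite ?scale1r ?scale0r.
- by rewrite ev_e1.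
- by rewrite mul_ev cf_e1 scale0r.
- by rewrite e1_e1.
Qed.

Lemma arrow_image_src a : arrow_image a * e1 = arrow_image a.
Proof. by case: a => [j|k] /=; rewrite ?lo_e1 ?ar_e1. Qed.

Lemma arrow_image_tgt a : vertex_image (@arr_tgt loop_quiver a) * arrow_image a = arrow_image a.
Proof. by case: a => [j|k] /=; rewrite ?e1_lo ?ev_ar ?eqxx ?scale1r. Qed.

Lemma walk_image_start x s : @walk loop_quiver x s ->
  walk_image x s * vertex_image x = walk_image x s.
Proof.
case: s => [_|a s /= /andP[/eqP <- _]]; first by rewrite /= vertex_image_mul eqxx.
by rewrite /= -mulrA arrow_image_src.
Qed.

Lemma path_image_mul p q :
  path_image q * path_image p = oapp path_image 0 (path_comp q p).
Proof.
rewrite /path_image; case: path_compP => [r e rs ra _|ne] /=.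
  rewrite rs ra -e /path_end; have := valP q; rewrite -/(path_start q) -/(path_arrows q) -e.
  rewrite /path_end; elim: (path_arrows p) (path_start p) => [|a s IH] x /= wq.
    exact: walk_image_start.
  by rewrite mulrA IH.
have : vertex_image (path_start q) * walk_image (path_start p) (path_arrows p) = 0.
  have := ne; rewrite /path_end; elim: (path_arrows p) (path_start p) => [|a s IH] x /= ne'.
    by rewrite vertex_image_mul eq_sym (negPf ne').
  by rewrite mulrA IH // mul0r.
have := valP q; rewrite -/(path_start q) -/(path_arrows q) => /walk_image_start <- E.
by rewrite -mulrA E mulr0.
Qed.

Definition short_index (p : qpath loop_quiver) : ppath R + T :=
  match path_arrows p with
  | [::] => if path_start p is Some k then inr k else inl (ptriv R)
  | inl j :: _ => inl (ploop R j)
  | inr k :: _ => inl (parr R k)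
  end.

Lemma path_image_short p : (path_length p <= 1)%N ->
  path_image p = path_basis K (short_index p).
Proof.
rewrite /path_length /path_image /short_index.
case: (path_arrows p) => [|a [|//]] _ /=; first by case: (path_start p).
by rewrite arrow_image_tgt; case: a.
Qed.

Lemma short_index_inj p q : (path_length p <= 1)%N -> (path_length q <= 1)%N ->
  short_index p = short_index q -> p = q.
Proof.
move=> lp lq E; apply: path_eq.
all: move: lp lq E (valP p) (valP q); rewrite -!/(path_start _) -!/(path_arrows _).
all: rewrite /path_length /short_index.
all: case: (path_arrows p) (path_arrows q) => [|[j|k] [|//]] [|[j'|k'] [|//]] //= _ _.
all: by case: (path_start p) (path_start q) => [k1|] [k2|] // [] // ->.
Qed.

(** The image of a path of length two or more is a multiple of some g_k w_j, which
    has no coefficient at the vertices and arrows. *)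
Lemma walk_image_long x s i : (1 < size s)%N ->
  (forall k j (v : R k j), i != inl (exist _ (Some k, Some j) v)) -> cf (walk_image x s) i = 0.
Proof.
case: s => [|a [|b s]] //= _ ni; rewrite -mulrA.
have [[k [j ->]]|->] : (exists k j, arrow_image b * arrow_image a = ar k * lo j)
    \/ arrow_image b * arrow_image a = 0.
  by case: a b => [j|k] [j'|k'] /=; rewrite ?lo_lo ?lo_ar ?ar_ar; auto; left; exists k', j.
  have [v|/ar_lo_eq0->] := boolP (R k j); last by rewrite mulr0 cf0.
  rewrite -[ar k]scale1r -[1]/(true%:R) -(eqxx k) -ev_ar -mulrA mulrA mul_ev -scalerAl.
  rewrite mulrA ev_ar eqxx scale1r cfZ ar_loE cf_basis.
  by rewrite (negPf (ni _ _ _)) mulr0.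
by rewrite mulr0 cf0.
Qed.

Lemma walk_image_cube x s : (2 < size s)%N -> walk_image x s = 0.
Proof.
case: s => [|a [|b [|c s]]] //= _; rewrite -!mulrA.
case: b => [j|k] /=; first by case: a => [j'|k'] /=; rewrite ?lo_lo ?lo_ar !mulr0.
by rewrite (mulrA (arrow_image c)); case: c => [j'|k'] /=; rewrite ?lo_ar ?ar_ar mul0r mulr0.
Qed.

(** The kernel of the morphism from the path algebra is admissible: paths of length
    at most one go to distinct basis elements, other paths have no component there,
    and paths of length three go to zero. *)
Lemma alg_bound_quiver : is_bound_quiver_algebra L.
Proof.
have one : \sum_x path_image (trivial_path (Q := loop_quiver) x) = 1.
  rewrite one_sum sum_option; congr (_ + _).
have [phi phiE] := path_algebra_morphism path_image_mul one.
have phiU p : phi (path_elt K p) = path_image p by rewrite phiE path_extensionU.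
exists loop_quiver, (fun f => phi f = 0); split; last first.
  exists phi; split=> // x; elim/alg_ind: x => [c x y [f <-] [g <-]||j|k|k j _|k].
  - by exists (c *: f + g); rewrite linearP.
  - by exists (path_elt K (trivial_path (Q := loop_quiver) None)); rewrite phiU.
  - exists (path_elt K (exist _ (None, [:: inl j]) isT : qpath loop_quiver)).
    by rewrite phiU /path_image /= e1_lo.
  - exists (path_elt K (exist _ (None, [:: inr k]) isT : qpath loop_quiver)).
    by rewrite phiU /path_image /= ev_ar eqxx scale1r.
  - exists (path_elt K (exist _ (None, [:: inl j; inr k]) isT : qpath loop_quiver)).
    by rewrite phiU /path_image /= ev_ar eqxx scale1r.
  - by exists (path_elt K (trivial_path (Q := loop_quiver) (Some k))); rewrite phiU.
split.
- split=> [|f g f0 g0|f g f0]; first exact: raddf0.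
    by apply: etrans (linearD phi f g) _; rewrite [X in X + _]f0 [X in _ + X]g0 addr0.
  split; apply: (etrans (rmorphM phi _ _)); first by rewrite [X in _ * X]f0 mulr0.
  by rewrite [X in X * _]f0 mul0r.
- move=> f f0 p fp; rewrite ltnNge; apply: contra fp => lp.
  have : cf (phi f) (short_index p) = 0 by rewrite f0 cf0.
  rewrite phiE /path_extension cf_sum.
  have E q : cf (f@_q *: path_image q) (short_index p) = f@_q * (q == p)%:R.
    rewrite cfZ; congr (_ * _); have [lq|lq] := leqP (path_length q) 1.
      rewrite path_image_short // cf_basis; congr ((nat_of_bool _)%:R).
      apply/eqP/eqP => [|-> //]; by move/short_index_inj => ->.
    rewrite walk_image_long //.
      by case: eqP => // qp; rewrite qp ltnNge lp in lq.
    move=> k j v; apply/eqP; rewrite /short_index.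
    by case: (path_arrows p) => [|[?|?] ?]; [case: (path_start p)| |].
  under eq_bigr => q _ do rewrite E.
  have [pf|] := boolP (p \in msupp f); last by move/mcoeff_outdom => ->.
  rewrite (big_fsetD1 p) //= eqxx mulr1 big1_seq ?addr0; first by move=> ->.
  by move=> q; rewrite !inE => /and3P[_ /negPf -> _]; rewrite mulr0.
- exists 3 => // f f3; rewrite phiE /path_extension big1_seq // => q /andP[_ qf].
  rewrite [path_image q]walk_image_cube ?scaler0 //; apply: f3.
  by rewrite mcoeff_neq0.
Qed.

End BoundQuiver.

From mathcomp Require Import mpoly.

(** * Algebras of functions *)

(** Every polynomiality argument below is of the form: a set of K-valued
    functions containing the constants and closed under sums and products is
    closed under substitution into a polynomial.  Stating this once serves
    polynomial functions of coordinates, polynomial curves, fractions with a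
    given denominator, and matrix coefficients of modules. *)
Record function_algebra (K : fieldType) (T : Type) (S : (T -> K) -> Prop) : Prop :=
  FunctionAlgebra {
    fa_ext : forall f g, f =1 g -> S f -> S g;
    fa_const : forall c, S (fun=> c);
    fa_add : forall f g, S f -> S g -> S (fun t => f t + g t);
    fa_mul : forall f g, S f -> S g -> S (fun t => f t * g t)
  }.

Section FunctionAlgebra.
Context (K : fieldType) (T : Type) (S : (T -> K) -> Prop).
Hypothesis alg : function_algebra S.

Lemma fa_sum (I : Type) (r : seq I) (P : pred I) (f : I -> T -> K) :
  (forall i, S (f i)) -> S (fun t => \sum_(i <- r | P i) f i t).
Proof.
move=> Sf; elim: r => [|i r IH].
  by apply: (fa_ext alg) (fa_const alg 0) => t; rewrite big_nil.
have [Pi|nPi] := boolP (P i).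
  apply: (fa_ext alg) (fa_add alg (Sf i) IH) => t.
  by rewrite big_cons Pi.
by apply: (fa_ext alg) IH => t; rewrite big_cons (negPf nPi).
Qed.

Lemma fa_prod (I : Type) (r : seq I) (P : pred I) (f : I -> T -> K) :
  (forall i, S (f i)) -> S (fun t => \prod_(i <- r | P i) f i t).
Proof.
move=> Sf; elim: r => [|i r IH].
  by apply: (fa_ext alg) (fa_const alg 1) => t; rewrite big_nil.
have [Pi|nPi] := boolP (P i).
  apply: (fa_ext alg) (fa_mul alg (Sf i) IH) => t.
  by rewrite big_cons Pi.
by apply: (fa_ext alg) IH => t; rewrite big_cons (negPf nPi).
Qed.

Lemma fa_exp f n : S f -> S (fun t => f t ^+ n).
Proof.
move=> Sf; elim: n => [|n IH]; first exact: (fa_ext alg) (fa_const alg 1).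
by apply: (fa_ext alg) (fa_mul alg Sf IH) => t; rewrite exprS.
Qed.

Lemma fa_det n (A : 'I_n -> 'I_n -> T -> K) :
  (forall i j, S (A i j)) -> S (fun t => \det (\matrix_(i, j) A i j t)).
Proof.
move=> SA; have H s : S (fun t => (-1) ^+ odd_perm s * \prod_i A i (s i) t).
  by apply: (fa_mul alg); [apply: fa_const | apply: fa_prod].
apply: (fa_ext alg) (@fa_sum _ (index_enum _) xpredT
  (fun s t => (-1) ^+ odd_perm s * \prod_i A i (s i) t) H) => t.
apply: eq_bigr => s _; congr (_ * _); apply: eq_bigr => i _.
by rewrite mxE.
Qed.

Lemma fa_meval n (F : {mpoly K[n]}) (f : 'I_n -> T -> K) :
  (forall i, S (f i)) -> S (fun t => F.@[fun i => f i t]).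
Proof.
move=> Sf.
have H m : S (fun t => F@_m * \prod_i f i t ^+ m i).
  apply: (fa_mul alg); first exact: fa_const.
  by apply: fa_prod => i; apply: fa_exp.
apply: (fa_ext alg) (fa_sum (msupp F) xpredT H) => t.
by rewrite mevalE.
Qed.

End FunctionAlgebra.

Definition poly_function (K : fieldType) (I : finType) (f : (I -> K) -> K) : Prop :=
  exists F : {mpoly K[#|I|]}, forall v, f v = F.@[fun k => v (enum_val k)].

Lemma poly_function_algebra (K : fieldType) (I : finType) :
  function_algebra (@poly_function K I).
Proof.
split=> [f g fg [F HF]|c|f g [F HF] [G HG]|f g [F HF] [G HG]].
- by exists F => v; rewrite -fg.
- by exists c%:MP => v; rewrite mevalC.
- by exists (F + G) => v; rewrite HF HG mevalD.
- by exists (F * G) => v; rewrite HF HG mevalM.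
Qed.

Lemma poly_function_coord (K : fieldType) (I : finType) (i : I) :
  poly_function (fun v : I -> K => v i).
Proof. by exists 'X_(enum_rank i) => v; rewrite mevalXU enum_rankK. Qed.

Lemma poly_function_peval (K : fieldType) (X : coord_space K) (F : poly_in X) :
  poly_function (peval F).
Proof. by exists F. Qed.

Lemma peval_ext (K : fieldType) (X : coord_space K) (F : poly_in X) v w :
  v =1 w -> peval F v = peval F w.
Proof. by move=> vw; apply: meval_eq => k. Qed.

Definition curve_function (K : fieldType) (f : K -> K) : Prop :=
  exists p : {poly K}, forall t, f t = p.[t].

Lemma curve_function_algebra (K : fieldType) :
  function_algebra (@curve_function K).
Proof.
split=> [f g fg [F HF]|c|f g [F HF] [G HG]|f g [F HF] [G HG]].
- by exists F => v; rewrite -fg.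
- by exists c%:P => v; rewrite hornerC.
- by exists (F + G) => v; rewrite HF HG hornerD.
- by exists (F * G) => v; rewrite HF HG hornerM.
Qed.

Lemma curve_function_id (K : fieldType) : curve_function (fun t : K => t).
Proof. by exists 'X => t; rewrite hornerX. Qed.

(** A root of X p + 1 is nonzero and is not a root of p. *)
Lemma nonroot_exists (K : closedFieldType) (p : {poly K}) : p != 0 ->
  exists2 u, u != 0 & p.[u] != 0.
Proof.
move=> p0; have sz : size ('X * p + 1%:P) != 1%N.
  rewrite size_polyDl mulrC size_mulX //; first by rewrite eqSS size_poly_eq0.
  by rewrite size_polyC oner_eq0 ltnS size_poly_gt0.
have [u] := closed_rootP _ sz.
rewrite rootE hornerD hornerM hornerX hornerC => /eqP ru; exists u.
  by apply: contra_eq_neq ru => ->; rewrite mul0r add0r oner_eq0.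
by apply: contra_eq_neq ru => ->; rewrite mulr0 add0r oner_eq0.
Qed.

Lemma curve_function_eq0 (K : closedFieldType) (f : K -> K) :
  curve_function f -> (forall t, t != 0 -> f t = 0) -> forall t, f t = 0.
Proof.
case=> p fE f0 t; rewrite fE; have [->|/nonroot_exists[u u0]] := eqVneq p 0.
  by rewrite horner0.
by case/eqP; rewrite -fE f0.
Qed.

Lemma curve_function_mul_eq0 (K : closedFieldType) (f g : K -> K) :
  curve_function f -> curve_function g -> (forall t, f t * g t = 0) ->
  (forall t, f t = 0) \/ (forall t, g t = 0).
Proof.
move=> [p fE] [q gE] fg0; have [/eqP|/nonroot_exists[u _]] := eqVneq (p * q) 0.
  by rewrite mulf_eq0 => /orP[]/eqP e; [left|right] => t; rewrite ?fE ?gE e horner0.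
by case/eqP; rewrite hornerM -fE -gE fg0.
Qed.

(** * Morphisms and dimension *)

Section Lifts.
Context (K : fieldType).
Implicit Types X : coord_space K.

(** Coordinates are unique up to a torus that acts on the whole space.  This is what
    lets an equation known for one choice of coordinates be used for another. *)
Definition homogeneous X : Prop :=
  forall (x : X) v w, represents x v -> represents x w ->
  exists2 c : coord X -> K, (forall i, w i = c i * v i) &
    forall (y : X) u, represents y u -> represents y (fun i => c i * u i).

(** Locally, coordinates of f y are fractions of coordinates of y with a common
    denominator. *)
Definition rational_lift X X' (Y : X -> Prop) (f : X -> X') : Prop :=
  forall x, Y x -> exists (D : poly_in X) (G : coord X' -> poly_in X) v0,
    [/\ represents x v0, peval D v0 != 0
      & forall y v, Y y -> represents y v -> peval D v != 0 ->
          represents (f y) (fun c => peval (G c) v / peval D v)].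

Lemma poly_in_function X (f : (coord X -> K) -> K) : poly_function f ->
  exists F : poly_in X, forall v, peval F v = f v.
Proof. by move=> [F FE]; exists F => v; rewrite FE. Qed.

Lemma polynomial_lift X X' (Y : X -> Prop) (f : X -> X') (G : coord X' -> (coord X -> K) -> K) :
  (forall x, Y x -> exists v, represents x v) -> (forall c, poly_function (G c)) ->
  (forall y v, Y y -> represents y v -> represents (f y) (fun c => G c v)) ->
  rational_lift Y f.
Proof.
move=> Yrep pG fG x /Yrep[v0 rv0].
have /fin_all_exists[H HE] c := poly_in_function (pG c).
have [D DE] : exists D : poly_in X, forall v, peval D v = 1.
  by exists 1 => v; rewrite /peval meval1.
exists D, H, v0; split=> // [|y v Yy rv _]; first by rewrite DE oner_neq0.
have -> : (fun c => peval (H c) v / peval D v) = (fun c => G c v).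
  by apply: functional_extensionality => c; rewrite HE DE divr1.
exact: fG.
Qed.

(** The functions that become polynomial after multiplication by a power of D form
    an algebra, and this algebra contains the fractions G i / D. *)
Lemma clear_denominators (I I' : finType) (D : (I -> K) -> K)
    (G : I' -> (I -> K) -> K) (F : (I' -> K) -> K) :
  poly_function D -> (forall i, poly_function (G i)) -> poly_function F ->
  exists (F' : (I -> K) -> K) k, poly_function F' /\
    forall v, D v != 0 -> F' v = D v ^+ k * F (fun i => G i v / D v).
Proof.
move=> pD pG [F0 FE].
pose S (f : (I -> K) -> K) := exists (F' : (I -> K) -> K) k, poly_function F' /\
  forall v, D v != 0 -> F' v = D v ^+ k * f v.
have pa := @poly_function_algebra K I.
have algS : function_algebra S.
  split=> [f g fg [F' [k [pF' H]]]|c|f g [F1 [k1 [p1 H1]]] [F2 [k2 [p2 H2]]]|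
           f g [F1 [k1 [p1 H1]]] [F2 [k2 [p2 H2]]]].
  - by exists F', k; split=> // v /H; rewrite fg.
  - exists (fun=> c), 0%N; split; first exact: (fa_const pa).
    by move=> v _; rewrite mul1r.
  - exists (fun v => D v ^+ k2 * F1 v + D v ^+ k1 * F2 v), (k1 + k2)%N; split.
      by apply: (fa_add pa); apply: (fa_mul pa) => //; apply: (fa_exp pa).
    move=> v Dv; rewrite H1 // H2 // exprD mulrDr !mulrA.
    by congr (_ * _ + _); rewrite mulrC.
  - exists (fun v => F1 v * F2 v), (k1 + k2)%N; split; first exact: (fa_mul pa).
    by move=> v Dv; rewrite H1 // H2 // exprD mulrACA.
suff [F' [k [pF' H]]] : S (fun v => F (fun i => G i v / D v)) by exists F', k.
apply: (@fa_ext _ _ _ algS (fun v => F0.@[fun k => G (enum_val k) v / D v])) => [v|].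
  by rewrite FE.
apply: (fa_meval algS _ (f := fun k v => G (enum_val k) v / D v)) => k.
exists (G (enum_val k)), 1%N; split=> // v Dv.
by rewrite expr1 mulrC divfK.
Qed.

(** An equation F of Z is pulled back to D times the numerator of F (G / D); the factor
    D takes care of the points where the fractions G / D have no meaning. *)
Lemma lift_zclosure X X' (Y : X -> Prop) (f : X -> X') (Z : X' -> Prop) x :
  rational_lift Y f -> homogeneous X' -> Y x ->
  zclosure (fun y => Y y /\ Z (f y)) x -> zclosure Z (f x).
Proof.
move=> lift hX' Yx cl F FZ w rw.
have [D [G [v0 [rv0 Dv0 H]]]] := lift x Yx.
have [c wc cS] := hX' _ _ _ (H _ _ Yx rv0 Dv0) rw.
have pD := poly_function_peval D; have pG i := poly_function_peval (G i).
have pF : poly_function (fun u : coord X' -> K => peval F (fun i => c i * u i)).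
  have pa := @poly_function_algebra K (coord X').
  rewrite /peval; apply: (fa_meval pa _ (f := fun k u => c (enum_val k) * u (enum_val k))).
  by move=> k; apply: (fa_mul pa); [apply: fa_const | apply: poly_function_coord].
have [F' [k [[F0 F0E] HF']]] := clear_denominators pD pG pF.
have pa := @poly_function_algebra K (coord X).
have [E EE] : poly_function (fun v => peval D v * F' v).
  by apply: (fa_mul pa) => //; exists F0.
have E0 : peval (X := X) E v0 = 0.
  apply: cl rv0 => y [Yy Zy] v rv; rewrite /peval -EE.
  have [->|Dv] := eqVneq (peval D v) 0; first by rewrite mul0r.
  rewrite HF' // (FZ _ Zy) ?mulr0 //; apply: cS; exact: H.
move: E0; rewrite /peval -EE => /eqP; rewrite mulf_eq0 (negPf Dv0) /=.
rewrite HF' // mulf_eq0 expf_eq0 (negPf Dv0) andbF /= => /eqP <-.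
exact: peval_ext.
Qed.

(** Closed sets are treated by [lift_zclosure].  A fraction F1 / F2 that represents a
    regular function is pulled back by clearing denominators in F1 and F2; the powers
    of D in numerator and denominator compensate for the two exponents, and the last
    factor D excludes the zeros of D. *)
Lemma lift_morphism X X' (Y : X -> Prop) (Y' : X' -> Prop) (f : X -> X') :
  rational_lift Y f -> homogeneous X' -> (forall x, Y x -> Y' (f x)) ->
  morphism_on Y Y' f.
Proof.
move=> lift hX' YY'; split=> // [Z [ZY' Zcl]|U h [UY' _] hreg x [Yx Ux]].
  split=> [x []//|x Yx cl]; split=> //; apply: Zcl; first exact: YY'.
  exact: (lift_zclosure lift).
have [D [G [v0 [rv0 Dv0 H]]]] := lift x Yx.
have [F1 [F2 [[w rw F2w] hE]]] := hreg _ Ux.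
have [c wc cS] := hX' _ _ _ (H _ _ Yx rv0 Dv0) rw.
have pD := poly_function_peval D; have pG i := poly_function_peval (G i).
have pF F : poly_function (fun u : coord X' -> K => peval F (fun i => c i * u i)).
  have pa := @poly_function_algebra K (coord X').
  rewrite /peval; apply: (fa_meval pa _ (f := fun k u => c (enum_val k) * u (enum_val k))).
  by move=> k; apply: (fa_mul pa); [apply: fa_const | apply: poly_function_coord].
have [P1 [k1 [p1 H1]]] := clear_denominators pD pG (pF F1).
have [P2 [k2 [p2 H2]]] := clear_denominators pD pG (pF F2).
have pa := @poly_function_algebra K (coord X).
have [N NE] : poly_function (fun v => P1 v * peval D v ^+ k2 * peval D v).
  by do !apply: (fa_mul pa) => //; apply: (fa_exp pa).
have [M ME] : poly_function (fun v => P2 v * peval D v ^+ k1 * peval D v).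
  by do !apply: (fa_mul pa) => //; apply: (fa_exp pa).
exists N, M; split.
  exists v0 => //; rewrite /peval -ME !mulf_neq0 ?expf_neq0 //.
  by rewrite H2 // mulf_neq0 ?expf_neq0 // -(peval_ext _ wc).
move=> y v [Yy Uy] rv; rewrite /peval -NE -ME => M0.
have Dv : peval D v != 0 by apply: contraNneq M0 => ->; rewrite mulr0.
have P2v : P2 v != 0 by apply: contraNneq M0 => ->; rewrite !mul0r.
rewrite (hE _ _ Uy (cS _ _ (H _ _ Yy rv Dv))); last first.
  by apply: contraNneq P2v => e; rewrite H2 // e mulr0.
move: P2v; rewrite H1 // H2 // mulf_eq0 => /norP[d2 f2].
have d1 : peval D v ^+ k1 != 0 by rewrite expf_neq0.
by field; rewrite d1 d2 f2 Dv.
Qed.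

Lemma irreducible_chain_transport X X' (Y : X -> Prop) (Y' : X' -> Prop) n :
  isomorphic_varieties Y Y' -> irreducible_chain Y' n -> irreducible_chain Y n.
Proof.
move=> [f [g [[fY fcl _] [gY gcl _] gf fg]]] [Z [Zi Zs]].
exists (fun i x => Y x /\ Z i (f x)); split=> [i lin|i ltn].
  have [Zc [[y Zy] Zirr]] := Zi _ lin; have [ZY _] := Zc.
  split; first exact: fcl.
  split; first by exists (g y); split; [exact: gY (ZY _ Zy) | rewrite fg //; exact: ZY].
  move=> A B Ac Bc AB.
  case: (Zirr _ _ (gcl _ Ac) (gcl _ Bc)) => [u Zu|H|H].
  - have Yu := ZY _ Zu; case: (AB (g u)); first by split; [exact: gY | rewrite fg].
      by left.
    by right.
  - by left=> x [Yx /H[_]]; rewrite gf.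
  - by right=> x [Yx /H[_]]; rewrite gf.
have [Zle [y Zy nZy]] := Zs _ ltn; have [[ZY _] _] := Zi i.+1 ltn.
split=> [x [Yx Zx]|]; first by split=> //; exact: Zle.
exists (g y); first by split; [exact: gY (ZY _ Zy) | rewrite fg //; exact: ZY].
by case=> _; rewrite fg //; exact: ZY.
Qed.

Lemma isomorphic_varieties_sym X X' (Y : X -> Prop) (Y' : X' -> Prop) :
  isomorphic_varieties Y Y' -> isomorphic_varieties Y' Y.
Proof. by move=> [f [g [mf mg gf fg]]]; exists g, f. Qed.

Lemma has_dim_iso X X' (Y : X -> Prop) (Y' : X' -> Prop) n :
  isomorphic_varieties Y Y' -> has_dim Y' n -> has_dim Y n.
Proof.
move=> iso [ch ub]; split; first exact: irreducible_chain_transport iso ch.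
by move=> m /(irreducible_chain_transport (isomorphic_varieties_sym iso)) /ub.
Qed.

End Lifts.

Section AffineSpace.
Context (K : closedFieldType) (I : finType).

Definition affine_space : coord_space K :=
  @CoordSpace K (I -> K) I (fun x v => forall i, v i = x i).

Lemma affine_homogeneous : homogeneous affine_space.
Proof.
move=> x v w rv rw; exists (fun=> 1) => [i|y u ru i]; rewrite mul1r ?rv ?rw //.
Qed.

Local Notation whole := (fun _ : affine_space => True).

Lemma affine_vanishes (F : poly_in affine_space) (x : affine_space) :
  vanishes F x <-> peval F x = 0.
Proof.
by split=> [/(_ x (fun=> erefl))//|Fx v rv]; rewrite (peval_ext F rv).
Qed.

(** If polynomials F and G do not vanish at points a and b of Z then their product
    does not vanish on the line through a and b, as polynomials in one variable form
    an integral domain. *)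
Lemma line_irreducible (Z : affine_space -> Prop) :
  (exists x, Z x) ->
  (forall a b t, Z a -> Z b -> Z (fun i => a i + t * (b i - a i))) ->
  irreducible_in whole Z.
Proof.
move=> Zne Zl; split=> // A B [_ Ac] [_ Bc] AB.
have [HA|nA] := classic (forall x, Z x -> A x); first by left.
right=> b Zb; apply: NNPP => nBb; apply: nA => a Za; apply: NNPP => nAa.
have sep C (x : affine_space) : (forall x, True -> zclosure C x -> C x) -> ~ C x ->
    exists2 F : poly_in affine_space, (forall y, C y -> peval F y = 0) & peval F x <> 0.
  move=> Cc nC; apply: NNPP => nF; apply: nC; apply: Cc => // F FC.
  apply/affine_vanishes; apply: NNPP => Fx; apply: nF; exists F => // y /FC.
  by move/affine_vanishes.
have [F FA Fa] := sep _ _ Ac nAa; have [G GB Gb] := sep _ _ Bc nBb.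
pose line t i := a i + t * (b i - a i).
have lc i : curve_function (fun t => line t i).
  have ca := curve_function_algebra K; apply: (fa_add ca); first exact: (fa_const ca).
  by apply: (fa_mul ca); [exact: curve_function_id | exact: (fa_const ca)].
have cP (H : poly_in affine_space) : curve_function (fun t => peval H (line t)).
  exact: (fa_meval (curve_function_algebra K) _ (f := fun k t => line t (enum_val k))).
case: (curve_function_mul_eq0 (cP F) (cP G)) => [t|F0|G0].
- case: (AB (line t)); first exact: Zl.
    by move/FA->; rewrite mul0r.
  by move/GB->; rewrite mulr0.
- by apply: Fa; rewrite -(F0 0); apply: peval_ext => i; rewrite /line mul0r addr0.
- by apply: Gb; rewrite -(G0 1); apply: peval_ext => i; rewrite /line mul1r addrC subrK.
Qed.

Lemma affine_chain : irreducible_chain whole #|I|.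
Proof.
exists (fun k x => forall i, (k <= enum_rank i)%N -> x i = 0); split=> [k _|k ltk].
  split.
    split=> // x _ cl i ki; have [F FE] := @poly_function_coord K I i.
    have F0 : vanishes (X := affine_space) F x.
      by apply: cl => y Zy; apply/affine_vanishes; rewrite /peval -FE Zy.
    by move/affine_vanishes: F0; rewrite /peval -FE.
  apply: line_irreducible; first by exists (fun=> 0).
  by move=> a b t Za Zb i ki; rewrite Za // Zb // subrr mulr0 addr0.
split=> [x Zx i ki|]; first by apply: Zx; exact: ltnW.
exists (fun i => (enum_rank i == k :> nat)%:R : K) => [i ki|].
  by rewrite gtn_eqF.
move/(_ (enum_val (Ordinal ltk))); rewrite enum_valK /= eqxx => /(_ (leqnn _))/eqP.
by rewrite oner_eq0.
Qed.

End AffineSpace.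

Lemma msize_mul_leS (K : fieldType) n (p q : {mpoly K[n]}) d e :
  (msize p <= d.+1)%N -> (msize q <= e.+1)%N -> (msize (p * q) <= (d + e).+1)%N.
Proof.
have [->|p0] := eqVneq p 0; first by rewrite mul0r msize0.
have [->|q0] := eqVneq q 0; first by rewrite mulr0 msize0.
move=> pd qe; rewrite msizeM //.
have /= := leq_add pd qe; rewrite addSn addnS.
by case: (_ + _)%N => // k; rewrite ltnS.
Qed.

Lemma msize_prod_leS (K : fieldType) n I (r : seq I) (p : I -> {mpoly K[n]}) d :
  (forall i, msize (p i) <= d.+1)%N -> (msize (\prod_(i <- r) p i) <= (size r * d).+1)%N.
Proof.
move=> pd; elim: r => [|i r IH]; first by rewrite big_nil msize1.
by rewrite big_cons mulSn msize_mul_leS.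
Qed.

(** Polynomials of bounded degree form a space of finite dimension. *)
Lemma mpoly_dependent (K : fieldType) m (T : finType) (p : T -> {mpoly K[m]}) d :
  (forall a, msize (p a) <= d.+1)%N -> (d.+1 ^ m < #|T|)%N ->
  exists2 c : T -> K, (exists a, c a != 0) & \sum_a c a *: p a = 0.
Proof.
move=> pd dT.
pose mo (g : {ffun 'I_m -> 'I_d.+1}) : 'X_{1..m} := [multinom (g i : nat) | i < m].
pose A := \matrix_(a < #|T|, e < #|{ffun 'I_m -> 'I_d.+1}|)
            (p (enum_val a))@_(mo (enum_val e)).
have /rowV0Pn[v vk v0] : kermx A != 0.
  apply: contraTneq dT => k0; rewrite -leqNgt.
  have := mxrank_ker A; rewrite k0 mxrank0 => /esym/eqP; rewrite subn_eq0 => rA.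
  apply: leq_trans rA (leq_trans (rank_leq_col A) _).
  by rewrite card_ffun !card_ord.
exists (fun a => v 0 (enum_rank a)).
  have [j vj] : exists j, v 0 j != 0.
    apply: NNPP => H; case/eqP: v0; apply/rowP => j; rewrite mxE.
    by apply/eqP; apply: contra_notT H => ?; exists j.
  by exists (enum_val j); rewrite enum_valK.
apply/mpolyP => mm; rewrite mcoeff0 raddf_sum /=.
have [big|small] := boolP [exists i, (d < mm i)%N].
  apply: big1 => a _; rewrite mcoeffZ; apply/eqP; rewrite mulf_eq0 mcoeff_eq0.
  apply/orP; right; apply: msize_mdeg_ge.
  case/existsP: big => i di; apply: leq_trans (pd a) (leq_trans di _).
  by rewrite mdegE (bigD1 i) //= leq_addr.
rewrite negb_exists in small.
have le_d i : (mm i < d.+1)%N by have := forallP small i; rewrite -leqNgt.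
pose g : {ffun 'I_m -> 'I_d.+1} := [ffun i => Ordinal (le_d i)].
have mog : mo g = mm by apply/mnmP => i; rewrite mnmE ffunE.
have /sub_kermxP/rowP/(_ (enum_rank g)) := vk; rewrite !mxE => E; apply: etrans E.
rewrite (reindex (@enum_val T xpredT)) /=; last first.
  by exists enum_rank => ? _; rewrite ?enum_valK ?enum_rankK.
by apply: eq_bigr => a _; rewrite !mxE mcoeffZ enum_valK enum_rankK mog.
Qed.

Section AffineDimension.
Context (K : closedFieldType) (I : finType).
Local Notation A := (affine_space K I).
Local Notation whole := (fun _ : A => True).

Lemma irreducible_mul (Z : A -> Prop) (f g : (I -> K) -> K) :
  irreducible_in whole Z -> poly_function f -> poly_function g ->
  (forall x, Z x -> f x * g x = 0) ->
  (forall x, Z x -> f x = 0) \/ (forall x, Z x -> g x = 0).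
Proof.
move=> [_ irr] pf pg fg0.
have cl h : poly_function h -> zclosed_in whole (fun x : A => h x = 0).
  move=> [F FE]; split=> // x _ cl.
  have : vanishes (X := A) F x.
    by apply: cl => y hy; apply/affine_vanishes; rewrite /peval -FE.
  by move/affine_vanishes; rewrite /peval -FE.
apply: (irr _ _ (cl _ pf) (cl _ pg)) => x /fg0 /eqP.
by rewrite mulf_eq0 => /orP[]/eqP; [left|right].
Qed.

Section Monomials.
Context (k : nat) (f : nat -> {mpoly K[#|I|]}).

(** The exponents, all smaller than k, of the monomials in f 0, ..., f (n - 1). *)
Fixpoint exponents (n : nat) : finType :=
  if n is n'.+1 then (exponents n' * 'I_k)%type else unit.

Fixpoint monomial (n : nat) : exponents n -> {mpoly K[#|I|]} :=
  if n is n'.+1 then fun a => monomial a.1 * f n' ^+ a.2 else fun=> 1.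

Lemma card_exponents n : #|exponents n| = (k ^ n)%N.
Proof. by elim: n => [|n IH]; rewrite ?card_unit // card_prod IH card_ord expnSr. Qed.

Lemma msize_monomial n e (a : exponents n) :
  (forall i, i < n -> msize (f i) <= e.+1)%N -> (msize (monomial a) <= (n * (k * e)).+1)%N.
Proof.
elim: n a => [|n IH] a fe; first by rewrite msize1.
rewrite mulSn addnC; apply: msize_mul_leS; first by apply: IH => i /leqW /fe.
rewrite -[in X in f n ^+ X](card_ord a.2) -prodr_const -big_enum /=.
apply: leq_trans (msize_prod_leS _ (d := e) _) _ => [_|]; first exact: fe.
by rewrite ltnS leq_mul2r -cardE card_ord (ltnW (ltn_ord _)) orbT.
Qed.

(** If f i vanishes on Z i but not on Z (i + 1), then the monomials in
    f 0, ..., f (n - 1) are linearly independent on Z n: cancel the lowest power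
    of f (n - 1), which is legitimate on an irreducible set, and restrict to
    Z (n - 1). *)
Lemma monomial_free (Z : nat -> A -> Prop) n :
  (forall i, (i <= n)%N -> irreducible_in whole (Z i)) ->
  (forall i, (i < n)%N -> (forall x, Z i x -> Z i.+1 x) /\
     (forall x, Z i x -> peval (X := A) (f i) x = 0) /\
     (exists2 x, Z i.+1 x & peval (X := A) (f i) x != 0)) ->
  forall c : exponents n -> K,
  (forall x, Z n x -> peval (X := A) (\sum_a c a *: monomial a) x = 0) ->
  forall a, c a = 0.
Proof.
elim: n => [|n IH] irr chain c c0 a.
  have [[x Zx] _] := irr 0%N isT; case: a; have := c0 x Zx.
  rewrite (bigD1 tt) //= big1 ?addr0; last by case.
  by rewrite /peval mevalZ meval1 mulr1.
have [Zle [fZ [y Zy fy]]] := chain n (ltnSn n).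
pose g (j : 'I_k) := \sum_(b : exponents n) c (b, j) *: monomial b.
have sumE : \sum_a c a *: monomial (n := n.+1) a = \sum_j g j * f n ^+ j.
  rewrite [LHS](eq_bigr (fun a : exponents n * 'I_k =>
    c (a.1, a.2) *: monomial a.1 * f n ^+ a.2)); last first.
    by case=> b j _ /=; rewrite scalerAl.
  rewrite -(pair_bigA _ (fun b j => c (b, j) *: monomial b * f n ^+ j)) /=.
  by rewrite exchange_big /=; apply: eq_bigr => j _; rewrite mulr_suml.
suff H j : forall b, c (b, j) = 0 by case: a => b j; exact: H.
have [N] := ubnP j; elim: N j => // N IHj j; rewrite ltnS => jN.
apply: IH => [i /leqW/irr //|i /leqW/chain //|x Zx].
pose h := \sum_(i : 'I_k | (j < i)%N) g i * f n ^+ (i - j.+1).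
have gj0 (i : 'I_k) : (i < j)%N -> g i = 0.
  move=> ij; rewrite /g big1 // => b _; rewrite IHj ?scale0r //.
  exact: leq_trans ij jN.
have split_j : \sum_j g j * f n ^+ j = f n ^+ j * (g j + f n * h).
  rewrite (bigD1 j) //= mulrDr [g j * _]mulrC; congr (_ + _).
  rewrite (bigID (fun i : 'I_k => i < j)%N) /= big1 ?add0r => [|i /andP[_ /gj0 ->]];
    last by rewrite mul0r.
  rewrite mulrA -exprSr mulr_sumr; apply: eq_big => [i|i].
    by rewrite -leqNgt -val_eqE /= ltn_neqAle eq_sym.
  rewrite -leqNgt => /andP[ne ji]; rewrite mulrCA -exprD subnKC //.
  by rewrite ltn_neqAle eq_sym ne.
have pe (F : {mpoly K[#|I|]}) : poly_function (fun x : I -> K => peval (X := A) F x).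
  by exists F.
case: (irreducible_mul (irr n.+1 (leqnn _)) (pe (f n ^+ j)) (pe (g j + f n * h))).
- by move=> z Zz; rewrite /peval -mevalM -split_j -sumE; exact: c0.
- move/(_ y Zy)/eqP; rewrite /peval rmorphXn /= expf_eq0 => /andP[_].
  by rewrite (negPf fy).
move/(_ x (Zle _ Zx)); rewrite /peval mevalD mevalM.
by have := fZ x Zx; rewrite /peval => ->; rewrite mul0r addr0.
Qed.

End Monomials.

(** Along a chain of length n one finds n polynomials whose monomials are
    linearly independent; there are k^n of them with exponents below k, in a
    space of polynomials of dimension O(k^#|I|). *)
Lemma has_dim_affine : has_dim whole #|I|.
Proof.
split; first exact: affine_chain.
move=> n0 [Z [Zirr Zch]]; rewrite leqNgt; apply/negP => ltn.
pose n := #|I|.+1.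
have sep (i : 'I_n) : exists F : {mpoly K[#|I|]},
    (forall x, Z i x -> peval (X := A) F x = 0) /\
    (exists2 x, Z i.+1 x & peval (X := A) F x != 0).
  have ltin : (i < n0)%N by exact: leq_trans (ltn_ord i) ltn.
  have [_ [x Zx nZx]] := Zch _ ltin; have [[_ Zcl] _] := Zirr _ (ltnW ltin).
  apply: NNPP => nF; apply: nZx; apply: Zcl => // F FZ.
  apply/affine_vanishes; apply/eqP; apply: contra_notT nF => Fx.
  by exists F; split; [move=> y /FZ/affine_vanishes | exists x].
have [F0 HF] := fin_all_exists sep.
pose f i : {mpoly K[#|I|]} := if insub i is Some j then F0 j else 0.
have fE (i : 'I_n) : f i = F0 i by rewrite /f valK.
pose e := (\max_(i : 'I_n) msize (f i))%N.
have fe i : (i < n)%N -> (msize (f i) <= e.+1)%N.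
  by move=> lti; apply: leqW; exact: (leq_bigmax (Ordinal lti)).
(* With m = #|I|, the choice of C and k gives (n k e + 1)^m <= k^m C^m < k^(m + 1). *)
pose C := (n * e + 1)%N; pose k := (C ^ #|I|).+1.
have cnt : ((n * (k * e)).+1 ^ #|I| < #|exponents k n|)%N.
  rewrite card_exponents /n expnS.
  apply: (@leq_ltn_trans ((k * C) ^ #|I|)).
    have /orP[/eqP->//|I0] : (#|I| == 0) || (0 < #|I|)%N by case: (#|I|).
    by rewrite leq_exp2r // /C mulnDr muln1 mulnCA -addn1 leq_add2l.
  by rewrite expnMn mulnC ltn_pmul2r ?expn_gt0.
have [c [a ca] c0] := mpoly_dependent (fun a => msize_monomial a fe) cnt.
case/eqP: ca; apply: (@monomial_free k f Z n) => [i lei|i lti|x _].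
- by case: (Zirr i (leq_trans lei ltn)).
- have [Zle _] := Zch i (leq_trans lti ltn); split=> //.
  by rewrite (fE (Ordinal lti)); exact: HF (Ordinal lti).
- by rewrite c0 /peval meval0.
Qed.

End AffineDimension.

(** * Quotients of modules *)

Lemma mem_span_cols (K : fieldType) p q (b : q.-tuple 'cV[K]_p) v :
  (v \in <<b>>%VS) = (v^T <= \matrix_(i < q, j < p) tnth b i j 0)%MS.
Proof.
have rowE (k : 'rV[K]_q) : (k *m \matrix_(i < q, j < p) tnth b i j 0)^T
    = \sum_i k 0 i *: tnth b i.
  apply/colP => j; rewrite !mxE summxE; apply: eq_bigr => i _; by rewrite !mxE.
apply/idP/submxP => [/coord_span E|[k E]].
  exists (\row_i vector.coord b i v); apply: trmx_inj; rewrite trmxK rowE [LHS]E.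
  by apply: eq_bigr => i _; rewrite mxE (tnth_nth 0).
rewrite -[v]trmxK E rowE; apply: memv_suml => i _; apply: memvZ.
by apply: memv_span; exact: mem_tnth.
Qed.

Definition rows (K : fieldType) p q (u : 'I_q -> 'cV[K]_p) : 'M[K]_(q, p) :=
  \matrix_(i, j) u i j 0.

Lemma basis_rows_free (K : fieldType) p q (D : {vspace 'cV[K]_p}) (b : q.-tuple 'cV[K]_p) :
  basis_of D b -> row_free (rows (tnth b)).
Proof.
move=> bD; apply: inj_row_free => k kA; apply/rowP => i; rewrite mxE.
have /freeP := basis_free bD; apply => //.
apply: trmx_inj; rewrite trmx0 -{}kA; apply/rowP => j.
by rewrite !mxE summxE; apply: eq_bigr => i' _; rewrite !mxE (tnth_nth 0).
Qed.

Lemma quotient_matrix (K : fieldType) p d (W : {vspace 'cV[K]_p}) :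
  (\dim W + d = p)%N -> exists (f : 'M[K]_(d, p)) (g : 'M[K]_(p, d)),
    f *m g = 1%:M /\ forall v, v \in W <-> f *m v = 0.
Proof.
move=> dimW; pose b := vbasis W.
pose A := \matrix_(i < \dim W, j < p) tnth b i j 0.
have WA v : (v \in W) = (v^T *m cokermx A == 0).
  by rewrite -submxE -mem_span_cols (span_basis (vbasisP W)).
have rfA : row_free A := basis_rows_free (vbasisP W).
have rc : \rank (cokermx A) = d.
  rewrite mxrank_coker (eqP rfA); apply/eqP; rewrite -(eqn_add2l (\dim W)) dimW subnKC //.
  exact: (leq_trans (leq_addr d _) (eq_leq dimW)).
move: d rc {dimW} => d <-; pose C := col_base (cokermx A).
have rfC : row_free C^T.
  by rewrite /row_free mxrank_tr; exact: col_base_full.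
exists C^T, (pinvmx C^T); split; first exact: mulmxVp.
move=> v; rewrite WA -{1}(mulmx_base (cokermx A)) mulmxA -/C.
split=> [/eqP H|H].
  apply: trmx_inj; rewrite trmx_mul trmxK trmx0.
  by apply: (row_free_inj (row_base_free _)); rewrite H mul0mx.
by rewrite (_ : v^T *m C = 0) ?mul0mx // -[C]trmxK -trmx_mul H trmx0.
Qed.

Section Quotients.
Context (K : fieldType) (L : falgType K).
Local Notation module := (module L).

Lemma surj_section m n (f : 'M[K]_(n, m)) : surj f -> exists s, f *m s = 1%:M.
Proof.
move=> sf; have /fin_all_exists[s Hs] (i : 'I_n) := sf (delta_mx i 0).
exists (\matrix_(i, j) s j i 0); apply/matrixP => i j.
have := Hs j => /matrixP/(_ i 0); rewrite !mxE andbT => <-.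
by apply: eq_bigr => k _; rewrite !mxE.
Qed.

Lemma section_surj m n (f : 'M[K]_(n, m)) s : f *m s = 1%:M -> surj f.
Proof. by move=> fs w; exists (s *m w); rewrite mulmxA fs mul1mx. Qed.

Lemma mulmx_colP m n (f g : 'M[K]_(n, m)) :
  (forall v : 'cV_m, f *m v = g *m v) -> f = g.
Proof.
move=> fg; apply/matrixP => i j; have /matrixP/(_ i 0) := fg (delta_mx j 0).
by rewrite -!colE !mxE.
Qed.

Lemma quotient_factor p n n' (P : module p) (N : module n) (N' : module n')
    (W : 'cV[K]_p -> Prop) (f : 'M_(n, p)) (h : 'M_(n', p)) :
  modhom P N f -> surj f -> (forall v, W v <-> f *m v = 0) ->
  modhom P N' h -> (forall v, W v -> h *m v = 0) ->
  exists2 u, modhom N N' u & u *m f = h.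
Proof.
move=> hf sf kf hh kh; have [s fs] := surj_section sf.
have uf : h *m s *m f = h.
  apply: mulmx_colP => v; apply/eqP; rewrite -subr_eq0 -mulmxA -mulmxA -mulmxBr.
  apply/eqP; apply: kh; apply/kf.
  by rewrite mulmxBr !mulmxA fs mul1mx subrr.
exists (h *m s) => // x; rewrite -[LHS]mulmx1 -fs !mulmxA.
by rewrite -[h *m s *m N x *m f]mulmxA -hf mulmxA uf hh.
Qed.

Lemma modhom_mul m n q (M : module m) (N : module n) (Q : module q) f g :
  modhom M N f -> modhom N Q g -> modhom M Q (g *m f).
Proof. by move=> hf hg x; rewrite -mulmxA hf mulmxA hg mulmxA. Qed.

Lemma modiso_of_quotients p n (P : module p) (N N' : module n)
    (W W' : 'cV[K]_p -> Prop) (g : 'M_p) :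
  is_quotient P W N -> is_quotient P W' N' -> modhom P P g -> g \in unitmx ->
  (forall v, W v <-> W' (g *m v)) -> modiso N N'.
Proof.
move=> [f [hf sf kf]] [f' [hf' sf' kf']] hg ug WW'.
have [|u hu uf] := quotient_factor hf sf kf (modhom_mul hg hf').
  by move=> v /WW'/kf'; rewrite mulmxA.
exists u => //; rewrite -unitmx_tr -row_free_unit; apply: inj_row_free => w w0.
have [v fv] := sf w^T; apply: trmx_inj; rewrite trmx0 -fv.
apply/kf/WW'/kf'; rewrite mulmxA -uf -mulmxA fv.
by apply: trmx_inj; rewrite trmx_mul trmxK w0 trmx0.
Qed.

Lemma modiso_refl n (N : module n) : modiso N N.
Proof. by exists 1%:M; [exact: unitmx1 | move=> x; rewrite mul1mx mulmx1]. Qed.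

Lemma modiso_sym n (N N' : module n) : modiso N N' -> modiso N' N.
Proof.
move=> [g ug hg]; exists (invmx g); first by rewrite unitmx_inv.
by move=> x; rewrite -[RHS](mulKmx ug) [g *m (_ *m _)]mulmxA hg -mulmxA mulmxV // mulmx1.
Qed.

Lemma modiso_trans n (N N' N'' : module n) : modiso N N' -> modiso N' N'' -> modiso N N''.
Proof.
move=> [g ug hg] [h uh hh]; exists (h *m g); first by rewrite unitmx_mul uh.
exact: modhom_mul hg hh.
Qed.

Lemma quotient_unique p n (P : module p) (N N' : module n) (W : 'cV[K]_p -> Prop) :
  is_quotient P W N -> is_quotient P W N' -> modiso N N'.
Proof.
move=> qN qN'; apply: (modiso_of_quotients qN qN' (g := 1%:M)).
- by move=> x; rewrite mul1mx mulmx1.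
- exact: unitmx1.
- by move=> v; rewrite mul1mx.
Qed.

Lemma is_quotient_iso p n (P : module p) (N N' : module n) (W : 'cV[K]_p -> Prop) :
  modiso N N' -> is_quotient P W N -> is_quotient P W N'.
Proof.
move=> [g ug hg] [f [hf sf kf]]; exists (g *m f); split; first exact: modhom_mul hf hg.
  by move=> w; have [v fv] := sf (invmx g *m w); exists v; rewrite -mulmxA fv mulKVmx.
move=> v; rewrite kf -mulmxA; split=> [->|H]; first by rewrite mulmx0.
by rewrite -[f *m v](mulKmx ug) H mulmx0.
Qed.

(** The quotient of P by the kernel of f, on the space that f maps onto; the formula
    for the action is polynomial in f and g, which is what degenerations need. *)
Lemma quotient_by_section p d (P : module p) (f : 'M[K]_(d, p)) (g : 'M[K]_(p, d)) :
  f *m g = 1%:M -> (forall x (v : 'cV_p), f *m v = 0 -> f *m (P x *m v) = 0) ->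
  exists2 N : module d, forall x, N x = f *m P x *m g & modhom P N f.
Proof.
move=> fg kf.
have fgf x : f *m P x *m g *m f = f *m P x.
  apply: mulmx_colP => v; apply/eqP; rewrite -subr_eq0; apply/eqP.
  rewrite -!mulmxA -!mulmxBr; apply: kf.
  by rewrite mulmxBr !mulmxA fg mul1mx subrr.
have [||x y|N NE] := @module_of_morphism _ L d (fun x => f *m P x *m g).
- by move=> c x y; rewrite linearP /= mulmxDr mulmxDl -scalemxAr -scalemxAl.
- by rewrite module1 mulmx1.
- by rewrite moduleM !mulmxA fgf.
by exists N => // x; rewrite NE fgf.
Qed.

Lemma quotient_exists p d (P : module p) (W : {vspace 'cV[K]_p}) :
  submodule P W -> (\dim W + d = p)%N ->
  exists N : module d, is_quotient P (fun v => v \in W) N.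
Proof.
move=> sW dW; have [f [g [fg kf]]] := quotient_matrix dW.
have [x v /kf vW|N NE hN] := quotient_by_section fg (P := P).
  by apply/kf; exact: sW.
by exists N, f; split=> //; exact: section_surj fg.
Qed.

End Quotients.

(** * The projective module and the radical *)

Section Projective.
Context (K : fieldType) (J T : finType) (R : T -> pred J).
Local Notation L := (alg K R).
Local Notation e1 := (e1 K R).
Local Notation ev := (ev K R).
Local Notation lo := (lo K R).
Local Notation ar := (ar K R).
Local Notation p := #|{: ppath R}|.
Implicit Types (x y z : L) (j : J) (k : T).

(** The projection of x to L e1. *)
Definition pvec x : 'cV[K]_p := \col_i cf x (inl (enum_val i)).

Definition of_pvec (v : 'cV[K]_p) : L :=
  alg_of (fun i => if i is inl y then v (enum_rank y) 0 else 0).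

Lemma pvec_linear : linear pvec.
Proof. by move=> c x y; apply/colP => i; rewrite !mxE cfD cfZ. Qed.

HB.instance Definition _ := GRing.isLinear.Build K L 'cV[K]_p _ pvec pvec_linear.

Lemma of_pvecK v : pvec (of_pvec v) = v.
Proof. by apply/colP => i; rewrite !mxE cf_alg_of enum_valK. Qed.

Lemma pvecE x (y : ppath R) : (pvec x) (enum_rank y) 0 = cf x (inl y).
Proof. by rewrite mxE enum_rankK. Qed.

Lemma pvec_eq x y : (forall i, cf x (inl i) = cf y (inl i)) -> pvec x = pvec y.
Proof. by move=> xy; apply/colP => i; rewrite !mxE. Qed.

Lemma pvec_e1 x : pvec (x * e1) = pvec x.
Proof.
apply: pvec_eq => -[[[k|] [j|]] v]; rewrite cfM /mul_cf /= !cf_e1 /=;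
  rewrite ?mulr0 ?mulr1 ?eqxx ?mulr1 ?addr0 ?add0r //;
  by congr (cf x (inl _)); apply: val_inj.
Qed.

Lemma pvec_mul x y z : pvec y = pvec z -> pvec (x * y) = pvec (x * z).
Proof.
move=> yz; have E i : cf y (inl i) = cf z (inl i) by rewrite -!pvecE yz.
by apply: pvec_eq => -[[[k|] [j|]] v]; rewrite !cfM /mul_cf /= !E.
Qed.

Lemma pvec_ev k : pvec (ev k) = 0.
Proof. by apply/colP => i; rewrite !mxE cf_ev. Qed.

Definition pmod_mx x : 'M[K]_p :=
  \matrix_(i, j) cf (x * path_basis K (inl (enum_val j))) (inl (enum_val i)).

Lemma pmod_mxE x y : pmod_mx x *m pvec y = pvec (x * y).
Proof.
pose y' := \sum_i cf y (inl i) *: path_basis K (inl i).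
have -> : pvec (x * y) = pvec (x * y').
  apply: pvec_mul; apply: pvec_eq => i; rewrite cf_sum (bigD1 i) //= big1.
    by rewrite addr0 cfZ cf_basis eqxx mulr1.
  move=> i' ne; rewrite cfZ cf_basis (inj_eq (@inl_inj _ _)) eq_sym (negPf ne).
  by rewrite mulr0.
apply/colP => i; rewrite !mxE mulr_sumr cf_sum.
rewrite (reindex (@enum_val (ppath R) xpredT)) /=; last first.
  by exists enum_rank => ? _; rewrite ?enum_valK ?enum_rankK.
by apply: eq_bigr => j _; rewrite !mxE -scalerAr cfZ mulrC.
Qed.

Lemma pmod_spec : {P : module L p | forall x, P x = pmod_mx x}.
Proof.
have ext m (A B : 'M[K]_(m, p)) : (forall y, A *m pvec y = B *m pvec y) -> A = B.
  by move=> AB; apply: mulmx_colP => v; rewrite -[v]of_pvecK AB.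
apply: module_of_morphism => [c x y||x y].
- by apply/matrixP => i j; rewrite !mxE mulrDl -scalerAl cfD cfZ.
- by apply: ext => y; rewrite pmod_mxE !mul1r mul1mx.
- by apply: ext => z; rewrite pmod_mxE -mulmxA !pmod_mxE mulrA.
Qed.

Definition pmod : module L p := sval pmod_spec.

Lemma pmodE x y : pmod x *m pvec y = pvec (x * y).
Proof. by rewrite (svalP pmod_spec) pmod_mxE. Qed.

Lemma pvecW (v : 'cV[K]_p) : exists x, v = pvec x.
Proof. by exists (of_pvec v); rewrite of_pvecK. Qed.

Lemma pvec_gen x : pvec x = pmod x *m pvec e1.
Proof. by rewrite pmodE pvec_e1. Qed.

(** The universal property of L e1. *)
Lemma pmod_hom d (N : module L d) (n : 'cV_d) : N e1 *m n = n ->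
  exists2 f : 'M_(d, p), modhom pmod N f & forall x, f *m pvec x = N x *m n.
Proof.
move=> e1n; pose f : 'M[K]_(d, p) := \matrix_(i, j) (N (path_basis K (inl (enum_val j : ppath R))) *m n) i 0.
have fE x : f *m pvec x = N x *m n.
  transitivity (N (x * e1) *m n); last by rewrite moduleM -mulmxA e1n.
  rewrite [x * e1]path_basis_sum.
  rewrite big_sumType /= [X in _ + X]big1 ?addr0 => [|k _]; last first.
    by rewrite cfM /mul_cf /= cf_e1 mulr0 scale0r.
  rewrite raddf_sum mulmx_suml.
  apply/colP => i; rewrite !mxE summxE.
  rewrite [RHS](reindex (@enum_val (ppath R) xpredT)) /=; last first.
    by exists enum_rank => ? _; rewrite ?enum_valK ?enum_rankK.
  apply: eq_bigr => j _.
  have -> : cf (x * e1) (inl (enum_val j)) = (pvec x) j 0.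
    by rewrite -pvec_e1 mxE.
  by rewrite linearZ -scalemxAl !mxE mulrC.
exists f => // x; apply: mulmx_colP => v; have [y ->] := pvecW v.
by rewrite -!mulmxA pmodE !fE moduleM mulmxA.
Qed.

Lemma projective_pmod : projective pmod.
Proof.
move=> m n X Y f g hf sf hg; have [u fu] := sf (g *m pvec e1).
have e1u : X e1 *m (X e1 *m u) = X e1 *m u by rewrite mulmxA -moduleM e1_e1.
have [h hh hE] := pmod_hom e1u; exists h => //.
apply: mulmx_colP => v; have [x ->] := pvecW v.
rewrite -mulmxA hE mulmxA hf -mulmxA [f *m _]mulmxA hf -mulmxA fu.
rewrite !mulmxA -moduleM -[Y _ *m g]hg -mulmxA pmodE.
by rewrite -mulrA e1_e1 pvec_e1.
Qed.

(** ** The Jacobson radical *)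

Lemma functional_kernel (V : vectType K) (F : V -> K) :
  (forall c u v, F (c *: u + v) = c * F u + F v) ->
  exists U : {vspace V}, forall v, (v \in U) = (F v == 0).
Proof.
move=> Flin.
pose lF := GRing.isLinear.Build K V K^o _ F Flin.
pose F' : {linear V -> K^o} := HB.pack F lF.
by exists (lker (linfun F')) => v; rewrite memv_ker lfunE.
Qed.

(** The coefficient at a trivial path is a character of the algebra. *)
Lemma character_maximal i : i = inl (ptriv R) \/ (exists k, i = inr k) ->
  exists2 U : {vspace L}, maximal_left_ideal U & forall x, (x \in U) = (cf x i == 0).
Proof.
move=> Hi; have cM x y : cf (x * y) i = cf x i * cf y i.
  by case: Hi => [->|[k ->]]; rewrite cfM.
have c1 : cf (1 : L) i = 1 by case: Hi => [->|[k ->]]; rewrite cf1 //= eqxx.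
have [U UE] := @functional_kernel L (fun x => cf x i) (fun c x y => etrans (cfD _ _ _)
  (congr1 (fun a => a + _) (cfZ _ _ _))).
exists U => //; split=> [x y|Ufull|V lV UV].
- by rewrite !UE cM => /eqP->; rewrite mulr0.
- by have := memvf (1 : L); rewrite -Ufull UE c1 oner_eq0.
have [VU|] := boolP (V <= U)%VS; first by left; apply/eqP; rewrite eqEsubv VU.
case/subvPn => y yV; rewrite UE => cy; right.
apply/eqP; rewrite eqEsubv subvf /=; apply/subvP => x _.
have -> : x = (x - (cf x i / cf y i)%:A * y) + (cf x i / cf y i)%:A * y by rewrite subrK.
apply: memvD; last exact: lV.
apply: (subvP UV); rewrite UE cfD -mulN1r -scaleN1r -!scalerAl !mul1r scalerA cfZ.
by rewrite mulN1r mulNr divfK // subrr.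
Qed.

Definition in_arrow_ideal x := cf x (inl (ptriv R)) = 0 /\ forall k, cf x (inr k) = 0.

Lemma arrow_ideal_cube x y z :
  in_arrow_ideal x -> in_arrow_ideal y -> in_arrow_ideal z -> x * y * z = 0.
Proof.
move=> [x0 xk] [y0 yk] [z0 zk]; apply: cf_inj => -[[[[k|] [j|]] v]|k];
  rewrite cf0 cfM /mul_cf /= ?cfM /mul_cf /= ?x0 ?xk ?y0 ?yk ?z0 ?zk;
  rewrite ?(mulr0, mul0r, addr0, add0r) //.
Qed.

(** The kernels of the characters at the vertices are maximal left ideals with
    intersection the arrow ideal.  Conversely, if x in the arrow ideal were outside of
    a maximal left ideal I, then 1 - b x would lie in I for some b; but b x is
    nilpotent. *)
Lemma jacobsonP x :
  jacobson x <-> in_arrow_ideal x.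
Proof.
split=> [jx|[x0 xk] I [lI nI mI]].
  have H i : i = inl (ptriv R) \/ (exists k, i = inr k) -> cf x i = 0.
    by move=> /character_maximal[U mU UE]; apply/eqP; rewrite -UE; exact: jx.
  by split=> [|k]; apply: H; [left | right; exists k].
apply: contraT => xI; case: nI.
pose I' := (I + limg (amulr x))%VS.
have lI' : left_ideal I'.
  move=> y _ /memv_addP[a aI [_ /memv_imgP[b _ ->] ->]].
  rewrite mulrDr lfunE /= mulrA; apply: memv_add; first exact: lI.
  by rewrite (_ : y * b * x = amulr x (y * b)) ?memv_img ?memvf // lfunE.
have xI' : x \in I'.
  rewrite -[x]add0r; apply: memv_add; first exact: mem0v.
  by have := memv_img (amulr x) (memvf 1); rewrite lfunE /= mul1r.
case: (mI I' lI' (addvSl _ _)) => [e|e]; first by move: xI; rewrite -e xI'.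
have : 1 \in I' by rewrite e memvf.
case/memv_addP => a aI [_ /memv_imgP[b _ ->]]; rewrite lfunE /= => e1'.
pose z := b * x; have z3 : z * z * z = 0.
  have zJ : in_arrow_ideal z.
    by split=> [|k]; rewrite /z cfM /mul_cf /= ?x0 ?xk mulr0.
  exact: arrow_ideal_cube.
have aE : a = 1 - z by rewrite e1' addrK.
apply/eqP; rewrite eqEsubv subvf /=; apply/subvP => y _.
rewrite -[y]mulr1 (_ : 1 = (1 + z + z * z) * a); first by do 2!apply: (lI).
by rewrite aE mulrBr mulr1 !mulrDl mul1r z3 addr0 -[1 + z + _]addrA addrK.
Qed.

End Projective.

Section LocalModules.
Context (K : fieldType) (J T : finType) (R : T -> pred J).
Local Notation L := (alg K R).
Local Notation e1 := (e1 K R).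
Local Notation ev := (ev K R).
Local Notation lo := (lo K R).
Local Notation ar := (ar K R).
Local Notation p := #|{: ppath R}|.
Local Notation P := (pmod K R).
Implicit Types (x y z : L) (j : J) (k : T).

Lemma cf_triv_ev k x : cf (ev k * x) (inl (ptriv R)) = 0.
Proof. by rewrite cfM /mul_cf /= cf_ev mul0r. Qed.

(** ** Submodules spanned by lines at the sinks *)

(** Nonzero vectors u k of P, one at each sink k.  The algebra acts on a vector at a
    sink by scalars, so these vectors span a submodule. *)
Definition lines (u : T -> L) : Prop :=
  (forall k, ev k * u k = u k) /\ (forall k, pvec (u k) != 0).

Definition line_span (u : T -> L) : {vspace 'cV[K]_p} :=
  <<[seq pvec (u k) | k <- enum T]>>%VS.

Lemma line_spanP (u : T -> L) v :
  v \in line_span u <-> exists c : T -> K, v = \sum_k c k *: pvec (u k).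
Proof.
split=> [|[c ->]]; last first.
  by apply: memv_suml => k _; apply: memvZ; apply: memv_span; apply: map_f;
     rewrite mem_enum.
rewrite /line_span span_def big_map big_enum /= => /memv_sumP[w Hw ->].
have /fin_all_exists[c Hc] k : exists c, w k = c *: pvec (u k).
  by apply/vlineP; apply: Hw.
by exists c; apply: eq_big => // k _.
Qed.

Lemma line_span_scale (u u' : T -> L) (c : T -> K) : (forall k, c k != 0) ->
  (forall k, u k = c k *: u' k) -> line_span u = line_span u'.
Proof.
move=> c0 uu'; apply/vspaceP => v; apply/idP/idP => /line_spanP[b ->]; apply/line_spanP.
  exists (fun k => b k * c k); apply: eq_bigr => k _.
  by rewrite uu' linearZ /= scalerA.
exists (fun k => b k / c k); apply: eq_bigr => k _.
by rewrite uu' linearZ /= scalerA divfK.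
Qed.

Lemma mem_line_span u k : pvec (u k) \in line_span u.
Proof. by apply: memv_span; apply: map_f; rewrite mem_enum. Qed.

Lemma act_lines u x k : lines u -> x * u k = cf x (inr k) *: u k.
Proof. by move=> [uk _]; rewrite -{1}uk mulrA mul_ev -scalerAl uk. Qed.

Lemma ev_lines u k k' : lines u -> ev k * u k' = (k == k')%:R *: u k'.
Proof. by move=> hu; rewrite act_lines // cf_ev eq_sink eq_sym. Qed.

Lemma line_span_submodule u : lines u -> submodule P (line_span u).
Proof.
move=> hu x v /line_spanP[c ->]; apply/line_spanP.
exists (fun k => c k * cf x (inr k)); rewrite mulmx_sumr.
apply: eq_bigr => k _; rewrite -scalemxAr pmodE (act_lines _ _ hu).
by rewrite linearZ scalerA.
Qed.

Lemma ev_sum_lines u k (c : T -> K) : lines u ->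
  P (ev k) *m (\sum_k' c k' *: pvec (u k')) = c k *: pvec (u k).
Proof.
move=> hu; rewrite mulmx_sumr (bigD1 k) //= -scalemxAr pmodE (ev_lines _ _ hu).
rewrite eqxx scale1r big1 ?addr0 // => k' /negPf ne.
by rewrite -scalemxAr pmodE (ev_lines _ _ hu) eq_sym ne scale0r linear0 scaler0.
Qed.

Lemma lines_free u : lines u -> free [seq pvec (u k) | k <- enum T].
Proof.
move=> hu; rewrite -[X in free X]/(tval [tuple of [seq pvec (u k) | k <- enum T]]).
apply/freeP => c c0 i; pose c' k := c (enum_rank k).
have s0 : \sum_k c' k *: pvec (u k) = 0.
  rewrite -[RHS]c0 (reindex (@enum_val T xpredT)) /=; last first.
    by exists enum_rank => ? _; rewrite ?enum_valK ?enum_rankK.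
  apply: eq_bigr => a _; rewrite /c' enum_valK (nth_map (enum_val i)) -?cardE //.
  by rewrite (enum_val_nth (enum_val i)).
have := ev_sum_lines (enum_val i) c' hu.
rewrite s0 mulmx0 => /esym/eqP; rewrite scaler_eq0 (negPf (hu.2 _)) orbF => /eqP.
by rewrite /c' enum_valK.
Qed.

Lemma dim_line_span u : lines u -> \dim (line_span u) = #|T|.
Proof.
by move=> /lines_free; rewrite /free size_map -cardE => /eqP.
Qed.

(** ** Tops *)

Lemma top_module_spec : {S : module L 1 | forall x, S x = (cf x (inl (ptriv R)))%:M}.
Proof.
apply: module_of_morphism => [c x y||x y].
- by rewrite cfD cfZ scale_scalar_mx raddfD.
- by rewrite cf1.
- by rewrite cfM /mul_cf /= scalar_mxM.
Qed.

(** The simple module at the vertex 1. *)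
Definition top_module : module L 1 := sval top_module_spec.

Lemma top_moduleE x : top_module x = (cf x (inl (ptriv R)))%:M.
Proof. exact: (svalP top_module_spec). Qed.

Lemma simple_top_module : simple top_module.
Proof.
split=> // W _; have : (\dim W <= 1)%N.
  by apply: leq_trans (dimvS (subvf W)) _; rewrite dimvf /dim /= mul1n.
rewrite leq_eqVlt ltnS leqn0 => /orP[/eqP d1|].
  by right; apply/eqP; rewrite eqEdim subvf /= d1 dimvf /dim /= mul1n.
by rewrite dimv_eq0 => /eqP; left.
Qed.

Lemma rad_act d (N : module L d) x v : in_arrow_ideal x -> rad N (N x *m v).
Proof.
move=> /jacobsonP jx; exists 1%N, (fun=> x), (fun=> v); split=> //.
by rewrite big_ord1.
Qed.

Lemma arrow_ideal_part x :
  in_arrow_ideal (x - cf x (inl (ptriv R)) *: e1 - \sum_k cf x (inr k) *: ev k).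
Proof.
split=> [|k]; rewrite -!scaleN1r !cfD !cfZ !cf_sum.
  rewrite big1 ?mulr0 ?addr0 => [|k _]; last by rewrite cfZ cf_ev mulr0.
  by rewrite cf_e1 eqxx mulr1 mulN1r subrr.
rewrite (bigD1 k) //= big1 ?addr0 => [|k' ne]; last first.
  by rewrite cfZ cf_ev eq_sink eq_sym (negPf ne) mulr0.
by rewrite cfZ cf_ev cf_e1 eqxx /= !mulr0 addr0 mulr1 mulN1r subrr.
Qed.

Lemma rad_pvec x : cf x (inl (ptriv R)) = 0 -> rad P (pvec x).
Proof.
move=> x0; have := arrow_ideal_part x; rewrite x0 scale0r subr0.
move/(rad_act P (pvec e1)); rewrite pmodE pvec_e1 linearB /= linear_sum.
by rewrite big1 ?subr0 // => k _; rewrite linearZ /= pvec_ev scaler0.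
Qed.

Lemma rad_line_span u v : lines u -> v \in line_span u -> rad P v.
Proof.
move=> hu /line_spanP[c ->].
have -> : \sum_k c k *: pvec (u k) = pvec (\sum_k c k *: u k).
  by rewrite linear_sum; apply: eq_bigr => k _; rewrite linearZ.
apply: rad_pvec; rewrite cf_sum big1 // => k _.
by rewrite cfZ -(hu.1 k) cf_triv_ev mulr0.
Qed.

(** The kernel of the map from N onto the simple module at 1 consists of the images of
    the elements of P without coefficient at e1, and these lie in the radical of P. *)
Lemma quotient_is_top d (N : module L d) u : lines u ->
  is_quotient P (fun v => v \in line_span u) N -> is_top N top_module.
Proof.
move=> hu [f [hf sf kf]].
have e1S : top_module e1 *m (1%:M : 'cV_1) = 1%:M.
  by rewrite top_moduleE cf_e1 eqxx mulmx1.
have [h0 hh0 h0E] := pmod_hom e1S.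
have h0E' x : h0 *m pvec x = (cf x (inl (ptriv R)))%:M.
  by rewrite h0E top_moduleE mulmx1.
have [v /line_spanP[c ->]|h hh hE] := quotient_factor hf sf kf hh0.
  rewrite mulmx_sumr big1 // => k _; rewrite -scalemxAr h0E' -(hu.1 k) cf_triv_ev.
  by rewrite raddf0 scaler0.
exists h; split=> // [w|v].
  exists (f *m pvec (w 0 0 *: e1)); rewrite mulmxA hE h0E' cfZ cf_e1 eqxx mulr1.
  by rewrite [RHS]mx11_scalar.
split=> [[n [x [w [jx ->]]]]|hv0].
  rewrite mulmx_sumr big1 // => i _; rewrite mulmxA hh top_moduleE.
  by have [-> _] := (jacobsonP _).1 (jx i); rewrite mul_scalar_mx scale0r mul0mx.
have [v' fv'] := sf v; have [x xE] := pvecW v'; rewrite -fv' xE in hv0 *.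
have x0 : cf x (inl (ptriv R)) = 0.
  by move: hv0; rewrite mulmxA hE h0E' => /matrixP/(_ 0 0); rewrite !mxE.
have [n [y [w [jy ->]]]] := rad_pvec x0.
exists n, y, (fun i => f *m w i); split=> //; rewrite mulmx_sumr.
by apply: eq_bigr => i _; rewrite !mulmxA hf.
Qed.

Lemma quotient_local d (N : module L d) u : lines u ->
  is_quotient P (fun v => v \in line_span u) N -> local_module N.
Proof.
move=> hu qN; exists 1%N, top_module; split; first exact: quotient_is_top qN.
exact: simple_top_module.
Qed.

Lemma quotient_same_top d (N N' : module L d) u u' : lines u -> lines u' ->
  is_quotient P (fun v => v \in line_span u) N ->
  is_quotient P (fun v => v \in line_span u') N' -> same_top N N'.
Proof.
move=> hu hu' qN qN'; exists 1%N, top_module.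
by split; [exact: quotient_is_top hu qN | exact: quotient_is_top hu' qN'].
Qed.

(** A submodule W with W + C = P contains e1 modulo C, hence e1 itself, because e1
    annihilates C. *)
Lemma quotient_presents d (N : module L d) u : lines u ->
  is_quotient P (fun v => v \in line_span u) N -> presents P N (line_span u).
Proof.
move=> hu [f [hf sf kf]]; exists f; split=> //; split=> //; first exact: projective_pmod.
move=> W sW WC; have [w wW] := WC (pvec e1).
move/kf/line_spanP => [c E].
have e1w : P e1 *m w = pvec e1.
  rewrite -[w](subKr (pvec e1)) E mulmxBr pmodE e1_e1 mulmx_sumr big1 ?subr0 // => k _.
  by rewrite -scalemxAr pmodE (act_lines _ _ hu) cf_e1 scale0r linear0 scaler0.
apply/eqP; rewrite eqEsubv subvf /=; apply/subvP => v _; have [x ->] := pvecW v.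
by rewrite pvec_gen -e1w; apply/sW/sW.
Qed.

(** ** Nakayama's lemma *)

(** A generator of the top is lifted to N; that the lift generates N follows from the
    nilpotence of the arrow ideal. *)
Lemma same_top_generator d (M N : module L d) u : lines u ->
  is_quotient P (fun v => v \in line_span u) M -> same_top M N ->
  exists2 m : 'cV_d, N e1 *m m = m & forall v : 'cV_d, exists x, v = N x *m m.
Proof.
move=> hu [f [hf sf kf]] [t [S [[f1 [h1 s1 k1]] [f2 [h2 s2 k2]]]]].
pose s := f1 *m (f *m pvec e1).
have Sjac x (w : 'cV_t) : in_arrow_ideal x -> S x *m w = 0.
  by move=> jx; have [v <-] := s1 w; rewrite mulmxA -h1 -mulmxA; apply/k1/rad_act.
have se1 : S e1 *m s = s by rewrite /s !mulmxA -h1 -[f1 *m _ *m f]mulmxA -hf -!mulmxA pmodE e1_e1.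
have Sline (w : 'cV_t) : exists c, w = c *: s.
  have [v1 <-] := s1 w; have [v2 <-] := sf v1; have [x ->] := pvecW v2.
  exists (cf x (inl (ptriv R))).
  rewrite pvec_gen mulmxA mulmxA -[f1 *m f *m _]mulmxA hf [f1 *m _]mulmxA h1 -!mulmxA -/s.
  have := Sjac _ s (arrow_ideal_part x); rewrite !linearB /= linear_sum linearZ /=.
  rewrite !mulmxBl -scalemxAl se1 mulmx_suml [X in _ - X]big1 => [|k _]; last first.
    by rewrite linearZ -scalemxAl -se1 mulmxA -moduleM ev_e1 linear0 mul0mx scaler0.
  by rewrite subr0 => /eqP; rewrite subr_eq0 => /eqP.
have [n nE] := s2 s; pose m := N e1 *m n.
have f2m : f2 *m m = s by rewrite /m mulmxA h2 -mulmxA nE.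
have dec (v : 'cV_d) : exists c (q : nat) (y : 'I_q -> L) (w : 'I_q -> 'cV_d),
    (forall i, in_arrow_ideal (y i)) /\ v = c *: m + \sum_i N (y i) *m w i.
  have [c cE] := Sline (f2 *m v).
  have : f2 *m (v - c *: m) = 0 by rewrite mulmxBr -scalemxAr f2m cE subrr.
  move/k2 => [q [y [w [jy E]]]]; exists c, q, y, w; split=> [i|].
    exact/jacobsonP/jy.
  by rewrite -E addrC subrK.
pose gen v := exists x, v = N x *m m.
have genD a b : gen a -> gen b -> gen (a + b).
  by move=> [x ->] [y ->]; exists (x + y); rewrite linearD mulmxDl.
have genS q (w : 'I_q -> 'cV_d) : (forall i, gen (w i)) -> gen (\sum_i w i).
  move=> H; apply: (big_ind gen) => //; first by exists 0; rewrite linear0 mul0mx.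
have genm c x : gen (N x *m (c *: m)) by exists (c *: x); rewrite -scalemxAr [in RHS]linearZ /= -scalemxAl.
have g2 x y (v : 'cV_d) : in_arrow_ideal x -> in_arrow_ideal y -> gen (N (x * y) *m v).
  move=> jx jy; have [c [q [z [w [jz ->]]]]] := dec v.
  rewrite mulmxDr; apply: genD => //; rewrite mulmx_sumr; apply: genS => i.
  by rewrite mulmxA -moduleM (arrow_ideal_cube jx jy) //; exists 0; rewrite linear0 !mul0mx.
have g1 x (v : 'cV_d) : in_arrow_ideal x -> gen (N x *m v).
  move=> jx; have [c [q [z [w [jz ->]]]]] := dec v.
  rewrite mulmxDr; apply: genD => //; rewrite mulmx_sumr; apply: genS => i.
  by rewrite mulmxA -moduleM; apply: g2.
exists m => [|v]; first by rewrite /m mulmxA -moduleM e1_e1.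
have [c [q [z [w [jz ->]]]]] := dec v; apply: genD.
  by exists c%:A; rewrite linearZ /= module1 -scalemxAl mul1mx.
by apply: genS => i; apply: g1.
Qed.

End LocalModules.

(** * Degenerations *)

Lemma agenv_ind (K : fieldType) (L : falgType K) (s : seq L) (S : L -> Prop) :
  (forall c x y, S x -> S y -> S (c *: x + y)) -> S 1 -> {in s, forall x, S x} ->
  (forall x y, S x -> S y -> S (x * y)) ->
  forall x, x \in (agenv <<s>>)%VS -> S x.
Proof.
move=> SD S1 Ss SM.
have S0 : S 0 by have := SD (-1) _ _ S1 S1; rewrite scaleN1r addNr.
have Ssum (I : finType) (P : pred I) (f : I -> L) :
    (forall i, P i -> S (f i)) -> S (\sum_(i | P i) f i).
  move=> Sf; apply: (big_ind S) => // x y Sx Sy.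
  by rewrite -[x]scale1r; apply: SD.
have Sspan (t : seq L) : {in t, forall x, S x} -> forall x, x \in <<t>>%VS -> S x.
  move=> St x; rewrite span_def big_tnth => /memv_sumP[w Hw ->].
  apply: Ssum => i _; have /vlineP[c ->] := Hw i isT.
  by rewrite -[c *: _]addr0; apply: SD => //; apply/St/mem_tnth.
have Spow n x : x \in (<<s>> ^+ n)%VS -> S x.
  elim: n x => [|n IH] x.
    by rewrite expv0 => /vlineP[c ->]; rewrite -[c *: _]addr0; apply: SD.
  rewrite expvSl /prodv locked_withE; apply: (Sspan _) => _ /allpairsP[[u v] /= [us vs ->]].
  by apply: SM; [apply: (Sspan s) => //; apply: vbasis_mem | apply/IH/vbasis_mem].
move=> x /memv_sumP[w Hw ->]; apply: Ssum => i _; exact: Spow (Hw i isT).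
Qed.

Section Degeneration.
Context (K : closedFieldType) (L : falgType K) (r : nat) (a : 'I_r -> L).
Hypothesis gen_a : algebra_generators a.
Context (d : nat).
Local Notation module := (module L d).
Implicit Types M N : module.

Definition mcoord N (c : 'I_r * 'I_d * 'I_d) : K := N (a c.1.1) c.1.2 c.2.

Definition mpeval (F : poly_in (matrix_tuples K r d)) N : K :=
  peval (X := matrix_tuples K r d) F (mcoord N).

(** The polynomial functions of the entries of the generators; as the a i generate
    the algebra, the entries of all elements of the algebra are among them. *)
Definition module_function (f : module -> K) : Prop :=
  exists F, forall N, f N = mpeval F N.

Lemma module_function_algebra : function_algebra module_function.
Proof.
split=> [f g fg [F HF]|c|f g [F HF] [G HG]|f g [F HF] [G HG]].
- by exists F => N; rewrite -fg.
- by exists c%:MP => N; rewrite /mpeval /peval mevalC.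
- by exists (F + G) => N; rewrite HF HG /mpeval /peval mevalD.
- by exists (F * G) => N; rewrite HF HG /mpeval /peval mevalM.
Qed.

Lemma module_function_entry x i j : module_function (fun N => N x i j).
Proof.
have alg := module_function_algebra.
have xg : x \in (agenv <<[seq a k | k <- enum 'I_r]>>)%VS by rewrite gen_a memvf.
move: i j; apply: (agenv_ind (S := fun x => forall i j,
  module_function (fun N => N x i j)) _ _ _ _ xg) => [c y z Sy Sz i j|i j|_ /mapP[k _ ->] i j|
  y z Sy Sz i j].
- apply: (fa_ext alg) (fa_add alg (fa_mul alg (fa_const alg c) (Sy i j)) (Sz i j)) => N.
  by rewrite linearP !mxE.
- apply: (fa_ext alg) (fa_const alg ((i == j)%:R)) => N.
  by rewrite module1 mxE.
- have [F FE] := @poly_function_coord K ('I_r * 'I_d * 'I_d)%type (k, i, j).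
  by exists F => N; rewrite /mpeval /peval -FE.
- apply: (fa_ext alg) (fa_sum alg (index_enum _) xpredT
    (fun k => fa_mul alg (Sy i k) (Sz k j))) => N.
  by rewrite moduleM mxE.
Qed.

Lemma conj_module (g : 'M[K]_d) N : g \in unitmx ->
  exists2 N' : module, modiso N N' & forall x, N' x = g *m N x *m invmx g.
Proof.
move=> ug; have [c x y||x y|N' NE] :=
  @module_of_morphism _ L d (fun x => g *m N x *m invmx g).
- by rewrite linearP /= mulmxDr mulmxDl -scalemxAr -scalemxAl.
- by rewrite module1 mulmx1 mulmxV.
- by rewrite moduleM !mulmxA mulmxKV.
exists N' => //; exists g => // x.
by rewrite NE mulmxKV.
Qed.

(** The orbit of a point consists of the points of the isomorphic modules. *)
Lemma deg_leP M N : deg_le a M N <->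
  forall F, (forall M', modiso M M' -> mpeval F M' = 0) -> mpeval F N = 0.
Proof.
split=> [MN F FM|H F FM v rv].
  apply: MN => // y [g ug gy] v rv.
  have [M' isoM' M'E] := conj_module M ug.
  rewrite -[RHS](FM _ isoM'); apply: peval_ext => -[[i j] k].
  by rewrite rv gy /mcoord M'E.
rewrite -[RHS](H F) => [|M' [g ug hg]]; first by apply: peval_ext => -[[i j] k]; rewrite rv.
apply: (FM (mod_point a M')) => [|i j k]; last by [].
exists g => // i; rewrite /mod_point -[LHS](mulmxK ug).
by rewrite hg.
Qed.

Lemma deg_le_function M N f : deg_le a M N -> module_function f ->
  (forall M', modiso M M' -> f M' = 0) -> f N = 0.
Proof.
move=> /deg_leP MN [F FE] fM; rewrite FE; apply: MN => M' /fM.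
by rewrite FE.
Qed.

Lemma deg_le_isor M N N' : modiso N N' -> deg_le a M N -> deg_le a M N'.
Proof.
move=> [g ug hg] MN; apply/deg_leP => F FM.
have NE x : N' x = g *m N x *m invmx g by rewrite hg mulmxK.
have alg := module_function_algebra.
pose f (Q : module) : K := F.@[fun k => let c := enum_val k in
  \sum_j (\sum_i g c.1.2 i * Q (a c.1.1) i j) * invmx g j c.2].
have -> : mpeval F N' = f N.
  apply: meval_eq => k; rewrite /mcoord NE mxE; apply: eq_bigr => j _.
  by rewrite mxE.
apply: (deg_le_function MN) => [|M' isoM'].
  apply: (fa_meval alg F (f := fun k Q => let c := enum_val k in
    \sum_j (\sum_i g c.1.2 i * Q (a c.1.1) i j) * invmx g j c.2)) => k /=.
  apply: (fa_sum alg (index_enum _) xpredT) => j.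
  apply: (fa_mul alg); last exact: (fa_const alg).
  apply: (fa_sum alg (index_enum _) xpredT) => i.
  by apply: (fa_mul alg); [apply: (fa_const alg) | apply: module_function_entry].
have [M'' iso'' E] := conj_module M' ug.
rewrite -[RHS](FM M''); last exact: modiso_trans iso''.
apply: meval_eq => k; rewrite /mcoord E mxE; apply: eq_bigr => j _.
by rewrite mxE.
Qed.

Lemma deg_le_isol M M' N : modiso M M' -> deg_le a M N -> deg_le a M' N.
Proof.
move=> iso /deg_leP MN; apply/deg_leP => F FM'; apply: MN => Q isoQ.
by apply: FM'; apply: modiso_trans isoQ; apply: modiso_sym.
Qed.

Lemma deg_le_refl M : deg_le a M M.
Proof. by apply/deg_leP => F; apply; apply: modiso_refl. Qed.

Lemma deg_le_trans M N Q : deg_le a M N -> deg_le a N Q -> deg_le a M Q.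
Proof.
move=> MN /deg_leP NQ; apply/deg_leP => F FM; apply: NQ => N' isoN.
by have /deg_leP := deg_le_isor isoN MN; apply.
Qed.

(** ** Annihilators are upper semicontinuous *)

(** The matrix whose kernel consists of the vectors of N that are killed by all x i. *)
Definition stack q (x : 'I_q -> L) N : 'M[K]_(#|{: 'I_q * 'I_d}|, d) :=
  \matrix_(k, j) N (x (enum_val k).1) (enum_val k).2 j.

Lemma stackP q (x : 'I_q -> L) N (v : 'cV_d) :
  stack x N *m v = 0 <-> forall i, N (x i) *m v = 0.
Proof.
split=> [H i|H]; apply/colP => k.
  have /colP/(_ (enum_rank (i, k))) := H; rewrite !mxE => E; rewrite -[RHS]E.
  by apply: eq_bigr => j _; rewrite !mxE enum_rankK.
have /colP/(_ (enum_val k).2) := H (enum_val k).1; rewrite !mxE => E; rewrite -[RHS]E.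
by apply: eq_bigr => j _; rewrite !mxE.
Qed.

Lemma rank_le_ker m1 m2 n (A : 'M[K]_(m1, n)) (B : 'M[K]_(m2, n)) :
  (forall v : 'cV_n, B *m v = 0 -> A *m v = 0) -> (\rank A <= \rank B)%N.
Proof.
move=> H; apply: mxrankS; rewrite submxE; apply/eqP.
apply: mulmx_colP => v; rewrite mul0mx -mulmxA; apply: H.
by rewrite mulmxA mulmx_coker mul0mx.
Qed.

Lemma rank_stack_iso q (x : 'I_q -> L) M M' : modiso M M' ->
  (\rank (stack x M') <= \rank (stack x M))%N.
Proof.
move=> [g ug hg].
rewrite -(mxrankMfree (stack x M') (B := g)) ?row_free_unit //.
apply: rank_le_ker => v /stackP Mv; rewrite -mulmxA; apply/stackP => i.
by rewrite mulmxA -hg -mulmxA Mv mulmx0.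
Qed.

(** A nonzero minor of [stack x N] of maximal size is a polynomial function that
    vanishes on the orbit of M if the rank for M is smaller. *)
Lemma deg_le_rank q (x : 'I_q -> L) M N : deg_le a M N ->
  (\rank (stack x N) <= \rank (stack x M))%N.
Proof.
move=> MN; rewrite leqNgt; apply/negP => lt.
set A := stack x N in lt; set s := \rank A in lt.
pose U := pinvmx (col_base A); pose V := pinvmx (row_base A).
have UAV : U *m A *m V = 1%:M.
  transitivity (U *m (col_base A *m row_base A) *m V); first by rewrite mulmx_base.
  have UC : U *m col_base A = 1%:M by exact: mulVpmx (col_base_full A).
  have BV : row_base A *m V = 1%:M by exact: mulmxVp (row_base_free A).
  by rewrite [U *m _]mulmxA UC mul1mx BV.
(* A combination of minors of size s that has the value 1 at N. *)
pose f (Q : module) := \det (U *m stack x Q *m V).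
have alg := module_function_algebra.
have : f N = 0.
  apply: (deg_le_function MN) => [|M' isoM].
    apply: (fa_ext alg) (fa_det alg (A := fun i j Q => \sum_l
      (\sum_k U i k * Q (x (enum_val k).1) (enum_val k).2 l) * V l j) _) => [Q|i j].
      congr (\det _); apply/matrixP => i j; rewrite !mxE; apply: eq_bigr => l _.
      by rewrite !mxE; congr (_ * _); apply: eq_bigr => k _; rewrite !mxE.
    apply: (fa_sum alg (index_enum _) xpredT) => l.
    apply: (fa_mul alg); last exact: (fa_const alg).
    apply: (fa_sum alg (index_enum _) xpredT) => k.
    by apply: (fa_mul alg); [apply: (fa_const alg) | apply: module_function_entry].
  apply/eqP; apply: contraTT lt => fM'; rewrite -leqNgt.
  have <- : \rank (U *m stack x M' *m V) = s.
    by apply: mxrank_unit; rewrite unitmxE unitfE.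
  apply: leq_trans (mxrankM_maxl _ _) (leq_trans (mxrankM_maxr _ _) _).
  exact: rank_stack_iso.
by rewrite /f UAV det1 => /eqP; rewrite oner_eq0.
Qed.

Lemma deg_le_annihilates M N x : deg_le a M N -> M x = 0 -> N x = 0.
Proof.
move=> MN Mx; have := deg_le_rank (fun=> x : L) (q := 1) MN.
have -> : stack (fun=> x) (q := 1) M = 0 by apply/matrixP => i j; rewrite !mxE Mx mxE.
rewrite mxrank0 leqn0 mxrank_eq0 => /eqP N0; apply: mulmx_colP => v.
rewrite mul0mx; have /stackP/(_ ord0) : stack (fun=> x) (q := 1) N *m v = 0.
  by rewrite N0 mul0mx.
by [].
Qed.

(** ** Curves of submodules *)

(** The quotients by the translates (1 + tau Z) W of W are given by matrices
    that are polynomial in tau, because (1 + tau Z) (1 - tau Z) = 1. *)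
Lemma curve_degeneration p (P : Defs.module L p) (W : K -> {vspace 'cV[K]_p}) (Z : 'M[K]_p)
    M N :
  Z *m Z = 0 -> (forall t v, (v \in W t) = ((1%:M - t *: Z) *m v \in W 0)) ->
  (forall t, submodule P (W t)) -> (\dim (W 0%R) + d = p)%N ->
  is_quotient P (fun v => v \in W 0) N ->
  (forall t, t != 0 -> is_quotient P (fun v => v \in W t) M) -> deg_le a M N.
Proof.
move=> ZZ WE sW dW qN qM; have [f [g [fg kf]]] := quotient_matrix dW.
pose ft t := f *m (1%:M - t *: Z); pose gt t := (1%:M + t *: Z) *m g.
have fgt t : ft t *m gt t = 1%:M.
  rewrite /ft /gt mulmxA -[f *m _ *m _]mulmxA mulmxDr mulmx1 mulmxBl mul1mx.
  by rewrite -scalemxAl -scalemxAr ZZ !scaler0 subr0 subrK mulmx1.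
have kft t v : v \in W t <-> ft t *m v = 0 by rewrite /ft -mulmxA WE; apply: kf.
have Nt t : exists2 Q : module, (forall x, Q x = ft t *m P x *m gt t) &
    is_quotient P (fun v => v \in W t) Q.
  have [x v /kft vW|Q QE hQ] := quotient_by_section (fgt t) (P := P).
    by apply/kft; exact: sW.
  by exists Q => //; exists (ft t); split=> //; exact: section_surj (fgt t).
pose val (F : poly_in (matrix_tuples K r d)) t := peval (X := matrix_tuples K r d) F
  (fun c : 'I_r * 'I_d * 'I_d => (ft t *m P (a c.1.1) *m gt t) c.1.2 c.2).
have valE F t (Q : module) : (forall x, Q x = ft t *m P x *m gt t) -> mpeval F Q = val F t.
  by move=> QE; apply: peval_ext => c; rewrite /mcoord QE.
have [N0 N0E qN0] := Nt 0.
apply: (deg_le_isor (quotient_unique qN0 qN)); apply/deg_leP => F FM.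
rewrite (valE _ _ _ N0E); apply: (curve_function_eq0 (f := val F)) => [|t t0]; last first.
  have [Q QE qQ] := Nt t; rewrite -(valE _ _ _ QE); apply: FM.
  exact: quotient_unique (qM t t0) qQ.
have alg := curve_function_algebra K.
have lin (A B : 'M[K]_p) i j : curve_function (fun t => (A + t *: B) i j).
  apply: (fa_ext alg) (fa_add alg (fa_const alg (A i j)) (fa_mul alg
    (curve_function_id K) (fa_const alg (B i j)))) => t.
  by rewrite !mxE.
have ftc i j : curve_function (fun t => ft t i j).
  apply: (fa_ext alg) (fa_sum alg (index_enum _) xpredT (fun k => fa_mul alg
    (fa_const alg (f i k)) (lin 1%:M (- Z) k j))) => t.
  by rewrite !mxE; apply: eq_bigr => k _; rewrite -scaleNr scalerN -scaleNr.
have gtc i j : curve_function (fun t => gt t i j).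
  apply: (fa_ext alg) (fa_sum alg (index_enum _) xpredT (fun k => fa_mul alg
    (lin 1%:M Z i k) (fa_const alg (g k j)))) => t.
  by rewrite !mxE.
apply: (fa_meval alg F (f := fun k t =>
  (ft t *m P (a (enum_val k).1.1) *m gt t) (enum_val k).1.2 (enum_val k).2)) => k.
apply: (fa_ext alg) (fa_sum alg (index_enum _) xpredT (fun l => fa_mul alg
  (fa_sum alg (index_enum _) xpredT (fun m => fa_mul alg (ftc (enum_val k).1.2 m)
    (fa_const alg (P (a (enum_val k).1.1) m l)))) (gtc l (enum_val k).2))) => t.
by rewrite !mxE; apply: eq_bigr => l _; rewrite !mxE.
Qed.

End Degeneration.

(** * Lines and automorphisms *)

Section Lines.
Context (K : fieldType) (J T : finType) (R : T -> pred J).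
Local Notation L := (alg K R).
Local Notation e1 := (e1 K R).
Local Notation ev := (ev K R).
Local Notation lo := (lo K R).
Local Notation ar := (ar K R).
Local Notation p := #|{: ppath R}|.
Local Notation P := (pmod K R).
Implicit Types (x y z : L) (j : J) (k : T).

(** The general element of ev k * L * e1. *)
Definition line k (c : K) (t : J -> K) : L :=
  c *: ar k + \sum_(j | R k j) t j *: (ar k * lo j).

Definition plen k j (v : R k j) : ppath R := exist _ (Some k, Some j) v.

Lemma cf_line_arr k k' c t : cf (line k c t) (inl (parr R k')) = (k == k')%:R * c.
Proof.
rewrite cfD cfZ cf_ar eq_parr eq_sym mulrC cf_sum big1 ?addr0 // => j v.
rewrite cfZ ar_loE cf_basis (_ : _ == _ = false) ?mulr0 //.
by apply/negbTE/eqP => -[].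
Qed.

Lemma cf_line_len k k' c t j (v : R k' j) :
  cf (line k c t) (inl (plen v)) = (k == k')%:R * t j.
Proof.
rewrite cfD cfZ cf_ar (_ : _ == _ = false) ?mulr0 ?add0r; last first.
  by apply/negbTE/eqP => -[].
rewrite cf_sum; have [ek|ne] := eqVneq k k'.
  move: v; rewrite -ek => v; rewrite (bigD1 j) //= cfZ ar_loE cf_basis.
  rewrite big1 ?addr0 => [|i /andP[Ri ne]].
    by rewrite (_ : plen v = exist _ (Some k, Some j) v) // eqxx mulr1 mul1r.
  rewrite cfZ ar_loE cf_basis (_ : _ == _ = false) ?mulr0 //.
  by apply/negbTE/eqP => -[e]; case/eqP: ne.
rewrite mul0r big1 // => i Ri; rewrite cfZ ar_loE cf_basis.
rewrite (_ : _ == _ = false) ?mulr0 //.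
by apply/negbTE/eqP => -[e _]; case/eqP: ne.
Qed.

Lemma ev_line k k' c t : ev k' * line k c t = (k' == k)%:R *: line k c t.
Proof.
rewrite mulrDr -scalerAr ev_ar scalerDr !scalerA mulrC; congr (_ + _).
rewrite mulr_sumr scaler_sumr; apply: eq_bigr => j _.
by rewrite -scalerAr mulrA ev_ar -scalerAl !scalerA mulrC.
Qed.

Lemma cf_line_out k c t (y : ppath R) : (val y).1 != Some k -> cf (line k c t) (inl y) = 0.
Proof.
move=> ne; have E := ev_line k k c t; rewrite eqxx scale1r in E.
rewrite -E cfM /mul_cf.
case: y ne => -[[k'|] [j|]] v /= ne; rewrite !cf_ev /= ?mul0r ?add0r // eq_sink;
  by have -> : (k' == k) = false; [apply: contraNF ne => /eqP -> | rewrite mul0r].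
Qed.

Lemma line_neq0 k c t : (c != 0) \/ (exists2 j, R k j & t j != 0) ->
  pvec (line k c t) != 0.
Proof.
move=> H; apply/eqP => /colP e.
have z i : cf (line k c t) (inl i) = 0 by have := e (enum_rank i); rewrite pvecE mxE.
case: H => [/eqP c0|[j v /eqP t0]].
  by apply: c0; have := z (parr R k); rewrite cf_line_arr eqxx mul1r.
by apply: t0; have := z (plen v); rewrite cf_line_len eqxx mul1r.
Qed.

Lemma lines_family (c : T -> K) (t : T -> J -> K) :
  (forall k, (c k != 0) \/ (exists2 j, R k j & t k j != 0)) ->
  lines (fun k => line k (c k) (t k)).
Proof.
move=> H; split=> k; first by rewrite ev_line eqxx scale1r.
exact: line_neq0.
Qed.

Lemma line_scale k c t d : d *: line k c t = line k (d * c) (fun j => d * t j).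
Proof.
rewrite /line scalerDr scalerA scaler_sumr; congr (_ + _).
by apply: eq_bigr => j _; rewrite scalerA.
Qed.

Lemma line_add k c t c' t' :
  line k c t + line k c' t' = line k (c + c') (fun j => t j + t' j).
Proof.
rewrite /line addrACA -scalerDl -big_split; congr (_ + _).
by apply: eq_bigr => j _; rewrite scalerDl.
Qed.

Lemma eq_line k c c' t t' : c = c' -> (forall j, R k j -> t j = t' j) ->
  line k c t = line k c' t'.
Proof. by move=> -> tt'; congr (_ + _); apply: eq_bigr => j /tt' ->. Qed.

Lemma line_ar k : line k 1 (fun=> 0) = ar k.
Proof. by rewrite /line scale1r big1 ?addr0 // => j _; rewrite scale0r. Qed.

Lemma line0 k : line k 0 (fun=> 0) = 0.
Proof. by rewrite /line scale0r add0r big1 // => j _; rewrite scale0r. Qed.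

Lemma pvec_line_inj k c c' t t' : pvec (line k c t) = pvec (line k c' t') ->
  c = c' /\ forall j, R k j -> t j = t' j.
Proof.
move=> E; have z i : cf (line k c t) (inl i) = cf (line k c' t') (inl i).
  by rewrite -!pvecE E.
split=> [|j v].
  by have := z (parr R k); rewrite !cf_line_arr eqxx !mul1r.
by have := z (plen v); rewrite !cf_line_len eqxx !mul1r.
Qed.

Lemma lines_memE u k x : lines u -> ev k * x = x -> pvec x \in line_span u ->
  exists c, pvec x = c *: pvec (u k).
Proof.
move=> hu ex /line_spanP[c E]; exists (c k).
by rewrite -(ev_sum_lines k c hu) -E pmodE ex.
Qed.

(** Every endomorphism of P is the right multiplication by an element of the
    local algebra e1 L e1. *)
Definition loop_part (c : K) (s : J -> K) : L := c *: e1 + \sum_j s j *: lo j.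

Lemma e1_loop_part c s : e1 * loop_part c s = loop_part c s.
Proof.
rewrite mulrDr -scalerAr e1_e1 mulr_sumr; congr (_ + _).
by apply: eq_bigr => j _; rewrite -scalerAr e1_lo.
Qed.

Lemma line_e1 k c t : line k c t * e1 = line k c t.
Proof.
rewrite mulrDl -scalerAl ar_e1 mulr_suml; congr (_ + _).
by apply: eq_bigr => j _; rewrite -scalerAl -mulrA lo_e1.
Qed.

Lemma line_loop_part k c t d s :
  line k c t * loop_part d s = line k (c * d) (fun j => t j * d + c * s j).
Proof.
rewrite /loop_part mulrDr -scalerAr.
rewrite line_e1.
have -> : line k c t * \sum_j s j *: lo j = line k 0 (fun j => c * s j).
  rewrite /line mulrDl scale0r add0r [X in _ + X]mulr_suml [X in _ + X]big1 => [|j _].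
    rewrite addr0 mulr_sumr [LHS](bigID (R k)) /= [X in _ + X]big1 ?addr0.
      by apply: eq_bigr => j _; rewrite -scalerAr -scalerAl !scalerA mulrC.
    by move=> j nR; rewrite -scalerAr -scalerAl ar_lo_eq0 // !scaler0.
  rewrite mulr_sumr big1 // => i _.
  by rewrite -scalerAr -scalerAl -mulrA lo_lo mulr0 !scaler0.
rewrite line_scale line_add; apply: eq_line => [|j _]; first by rewrite addr0 mulrC.
by rewrite mulrC.
Qed.

Lemma pmod_end f : modhom P P f ->
  exists c s, forall x, f *m pvec x = pvec (x * loop_part c s).
Proof.
move=> hf; have [z zE] := pvecW (f *m pvec e1).
have [c [s E]] := e1_corner z; exists c, s => x.
rewrite pvec_gen mulmxA hf -mulmxA -{1}e1_e1 -pmodE [f *m _]mulmxA hf -mulmxA zE.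
by rewrite !pmodE /loop_part -E !mulrA pvec_e1.
Qed.

Lemma loop_part_mul c s c' s' :
  loop_part c s * loop_part c' s' = loop_part (c * c') (fun j => s j * c' + c * s' j).
Proof.
rewrite /loop_part mulrDl -scalerAl -/(loop_part c' s') e1_loop_part.
have -> : (\sum_j s j *: lo j) * loop_part c' s' = \sum_j (s j * c') *: lo j.
  rewrite mulr_suml; apply: eq_bigr => j _; rewrite -scalerAl mulrDr -scalerAr lo_e1.
  rewrite mulr_sumr big1 ?addr0 ?scalerA // => i _.
  by rewrite -scalerAr lo_lo scaler0.
rewrite scalerDr scalerA -addrA; congr (_ + _).
rewrite scaler_sumr -big_split; apply: eq_bigr => j _ /=.
by rewrite scalerA -scalerDl addrC.
Qed.

Lemma loop_aut (s : J -> K) : exists2 g : 'M[K]_p, modhom P P g &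
  g \in unitmx /\ forall x, g *m pvec x = pvec (x * loop_part 1 s).
Proof.
have H s' : exists2 f : 'M[K]_p, modhom P P f &
    forall x, f *m pvec x = pvec (x * loop_part 1 s').
  have [|f hf fE] := @pmod_hom K J T R _ P (pvec (loop_part 1 s')).
    by rewrite pmodE e1_loop_part.
  by exists f => // x; rewrite fE pmodE.
have [g hg gE] := H s; have [g' _ g'E] := H (fun j => - s j).
exists g => //; split=> //; have g'g : g' *m g = 1%:M.
  apply: mulmx_colP => v; have [x ->] := pvecW v; rewrite -mulmxA gE g'E mul1mx.
  rewrite -mulrA loop_part_mul mulr1 (_ : loop_part _ _ = e1) ?pvec_e1 //.
  rewrite /loop_part scale1r big1 ?addr0 // => j _.
  by rewrite mulr1 mul1r subrr scale0r.
by have [] := mulmx1_unit g'g.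
Qed.

Lemma aut_loop_part f : modhom P P f -> f \in unitmx ->
  exists c s, c != 0 /\ forall x, f *m pvec x = pvec (x * loop_part c s).
Proof.
move=> hf uf; have [c [s E]] := pmod_end hf; exists c, s; split=> //.
apply/eqP => c0; have : pvec e1 = 0.
  rewrite -[pvec e1](mulKmx uf) -[f *m _](mulKmx uf) !E -!mulrA loop_part_mul c0.
  rewrite (_ : loop_part _ _ = 0) ?mulr0 ?linear0 ?mulmx0 //.
  rewrite /loop_part ?mul0r scale0r add0r big1 // => j _.
  by rewrite mulr0 mul0r addr0 scale0r.
move/colP/(_ (enum_rank (ptriv R))); rewrite pvecE mxE cf_e1 eqxx => /eqP.
by rewrite oner_eq0.
Qed.

End Lines.

(** ** Curves of lines *)

Section LineCurves.
Context (K : closedFieldType) (J T : finType) (R : T -> pred J).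
Local Notation L := (alg K R).
Local Notation p := #|{: ppath R}|.
Local Notation P := (pmod K R).
Context (r : nat) (a : 'I_r -> L) (gen_a : algebra_generators a).

(** The lines of u k + tau w k are the translates of the lines of u k by 1 + tau Z,
    where Z maps u k to w k and is defined by means of a coordinate y k of u k.  As the
    vectors w k do not have these coordinates, Z^2 = 0. *)
Lemma line_curve d (M N : module L d) (u w : T -> L) (y : T -> ppath R) (q : T -> K) :
  (d + #|T| = p)%N ->
  (forall t : K, lines (fun k => u k + t *: w k)) ->
  (forall k k', cf (u k') (inl (y k)) *: pvec (w k) = ((k == k')%:R * q k) *: pvec (w k)) ->
  (forall k, q k != 0) ->
  (forall k k', cf (w k') (inl (y k)) *: pvec (w k) = 0) ->
  is_quotient P (fun v => v \in line_span u) N ->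
  (forall t, t != 0 ->
    is_quotient P (fun v => v \in line_span (fun k => u k + t *: w k)) M) ->
  deg_le a M N.
Proof.
move=> dp hl uy q0 wy qN qM.
pose Z : 'M[K]_p := \sum_k (q k)^-1 *: (pvec (w k) *m delta_mx 0 (enum_rank (y k))).
have ZE x : Z *m pvec x = \sum_k ((q k)^-1 * cf x (inl (y k))) *: pvec (w k).
  rewrite mulmx_suml; apply: eq_bigr => k _; rewrite -scalemxAl -mulmxA -rowE.
  rewrite [row _ _]mx11_scalar mxE pvecE mul_mx_scalar.
  by rewrite scalerA.
have Zu k : Z *m pvec (u k) = pvec (w k).
  rewrite ZE (bigD1 k) //= -scalerA uy eqxx mul1r scalerA mulVf // scale1r.
  rewrite big1 ?addr0 // => k' /negPf ne.
  by rewrite -scalerA uy ne mul0r scale0r scaler0.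
have Zw k : Z *m pvec (w k) = 0.
  by rewrite ZE big1 // => k' _; rewrite -scalerA wy scaler0.
have ZZ : Z *m Z = 0.
  apply: mulmx_colP => v; have [x ->] := pvecW v; rewrite -mulmxA ZE mul0mx.
  by rewrite mulmx_sumr big1 // => k _; rewrite -scalemxAr Zw scaler0.
pose W t := line_span (fun k => u k + t *: w k).
have W0 : W 0 = line_span u.
  rewrite /W /line_span; congr (<<_>>%VS); apply: eq_map => k.
  by rewrite scale0r addr0.
have Zut t k : (1%:M - t *: Z) *m pvec (u k + t *: w k) = pvec (u k).
  rewrite mulmxBl mul1mx -scalemxAl linearD linearZ /= mulmxDr Zu -scalemxAr Zw.
  by rewrite scaler0 addr0 addrK.
have Zut' t k : (1%:M + t *: Z) *m pvec (u k) = pvec (u k + t *: w k).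
  by rewrite mulmxDl mul1mx -scalemxAl Zu linearD linearZ.
apply: (curve_degeneration gen_a (P := P) (W := W) (Z := Z) ZZ) => [t v|t|||//].
- rewrite W0; apply/idP/idP => [/line_spanP[c ->]|/line_spanP[c E]]; apply/line_spanP.
    by exists c; rewrite mulmx_sumr; apply: eq_bigr => k _; rewrite -scalemxAr Zut.
  exists c; rewrite -[v]mul1mx (_ : 1%:M = (1%:M + t *: Z) *m (1%:M - t *: Z)).
    rewrite -mulmxA E mulmx_sumr; apply: eq_bigr => k _.
    by rewrite -scalemxAr Zut'.
  rewrite mulmxDl mul1mx mulmxBr mulmx1 -scalemxAl -scalemxAr ZZ !scaler0 subr0.
  by rewrite subrK.
- exact: line_span_submodule.
- by rewrite dim_line_span // addnC.
- by rewrite W0.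
Qed.

Lemma quotient_aut d (M : module L d) (u v : T -> L) (c : T -> K) (s : J -> K) :
  (forall k, c k != 0) ->
  (forall k, pvec (u k * loop_part R 1 s) = c k *: pvec (v k)) ->
  is_quotient P (fun x => x \in line_span u) M ->
  is_quotient P (fun x => x \in line_span v) M.
Proof.
move=> c0 uv [f [hf sf kf]]; have [g hg [ug gE]] := loop_aut R s.
have gi x y : g *m x = g *m y -> x = y.
  by move=> E; rewrite -[x](mulKmx ug) E mulKmx.
have memg x : x \in line_span u <-> g *m x \in line_span v.
  split=> /line_spanP[b E]; apply/line_spanP.
    exists (fun k => b k * c k); rewrite E mulmx_sumr; apply: eq_bigr => k _.
    by rewrite -scalemxAr gE uv scalerA.
  exists (fun k => b k / c k); apply: gi; rewrite E mulmx_sumr; apply: eq_bigr => k _.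
  by rewrite -scalemxAr gE uv scalerA divfK.
exists (f *m invmx g); split.
- move=> x; rewrite -mulmxA (_ : invmx g *m P x = P x *m invmx g) ?mulmxA ?hf //.
  by rewrite -[RHS](mulKmx ug) [g *m (_ *m _)]mulmxA hg -mulmxA mulmxV // mulmx1.
- by move=> w; have [x fx] := sf w; exists (g *m x); rewrite -mulmxA mulKmx.
- move=> x; rewrite -mulmxA -kf memg mulKVmx //.
Qed.

End LineCurves.

Lemma ker_exists (K : fieldType) m n (A : 'M[K]_(m, n)) : (\rank A < n)%N ->
  exists2 v : 'cV_n, v != 0 & A *m v = 0.
Proof.
move=> lt; have /rowV0Pn[v vk v0] : kermx A^T != 0.
  by rewrite kermx_eq0 /row_free mxrank_tr; apply: contraTneq lt => ->; rewrite ltnn.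
exists v^T; first by rewrite -(inj_eq trmx_inj) trmxK trmx0.
by apply: trmx_inj; rewrite trmx_mul trmxK trmx0; apply/sub_kermxP.
Qed.

Lemma rank1_dependent (K : fieldType) m n (A : 'M[K]_(m, n)) (v w : 'cV_n) :
  (\rank A <= 1)%N -> exists y z : K, (y != 0 \/ z != 0) /\
    y *: (A *m v) + z *: (A *m w) = 0.
Proof.
move=> rA; have lt : (\rank (A *m row_mx v w) < 1 + 1)%N.
  exact: leq_trans (mxrankM_maxl _ _) rA.
have [c c0 cA] := ker_exists lt; exists (c (lshift 1 0) 0), (c (rshift 1 0) 0); split.
  apply: NNPP => /not_or_and[/negP/negPn/eqP y0 /negP/negPn/eqP z0].
  case/eqP: c0; apply/colP => i; rewrite mxE; case: (splitP i) => j ij.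
    by rewrite -[RHS]y0; congr (c _ _); apply: val_inj; rewrite /= ij ord1.
  by rewrite -[RHS]z0; congr (c _ _); apply: val_inj; rewrite /= ij ord1.
rewrite -[RHS]cA -[c in RHS]vsubmxK -mulmxA mul_row_col mulmxDr !mulmxA.
congr (_ + _); apply/colP => i; rewrite !mxE big_ord1 !mxE mulrC //.
Qed.

Lemma sum_sig (I : finType) (Q : pred I) (V : nmodType) (F : I -> V) :
  \sum_(i : {i | Q i}) F (val i) = \sum_(i | Q i) F i.
Proof.
rewrite [RHS](reindex_omap (val : {i | Q i} -> I) insub) /=.
  by apply: eq_bigl => i; rewrite valK eqxx (valP i).
by move=> i Qi; rewrite insubT.
Qed.

Section KernelTransfer.
Context (K : closedFieldType) (L : falgType K) (r : nat) (a : 'I_r -> L).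
Hypothesis gen_a : algebra_generators a.
Context (d : nat) (M N : module L d).

(** The space of vectors of N that are killed by s is at least as large as that of M,
    so it does not fit into the span of a family smaller than an independent family
    in M. *)
Lemma kernel_transfer (s : seq L) (O O' : finType) (vM : O' -> 'cV[K]_d)
    (vN : O -> 'cV[K]_d) : deg_le a M N -> (#|O| < #|O'|)%N ->
  (forall i x, x \in s -> M x *m vM i = 0) ->
  (forall c : O' -> K, \sum_i c i *: vM i = 0 -> forall i, c i = 0) ->
  exists2 v : 'cV_d, (forall x, x \in s -> N x *m v = 0) &
    ~ exists c : O -> K, v = \sum_i c i *: vN i.
Proof.
move=> MN lt Ms Mfree; pose x := tnth (in_tuple s).
pose VM := \matrix_(i < d, j < #|O'|) vM (enum_val j) i 0.
pose VN := \matrix_(i < d, j < #|O|) vN (enum_val j) i 0.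
have colE (Q : finType) (w : Q -> 'cV[K]_d) (c : 'cV_#|Q|) :
    (\matrix_(i < d, j < #|Q|) w (enum_val j) i 0) *m c
    = \sum_q c (enum_rank q) 0 *: w q.
  apply/colP => i; rewrite mxE summxE (reindex (@enum_rank Q)) /=; last first.
    by exists enum_val => ? _; rewrite ?enum_valK ?enum_rankK.
  by apply: eq_bigr => q _; rewrite !mxE enum_rankK mulrC.
have rM : (\rank (stack x M) + #|O'| <= d)%N.
  have <- : \rank VM = #|O'|.
    apply/eqP; rewrite eqn_leq rank_leq_col leqNgt; apply/negP => /ker_exists[c c0].
    rewrite colE => /Mfree H; case/eqP: c0; apply/colP => i.
    by rewrite mxE -(H (enum_val i)) enum_valK.
  apply: mulmx0_rank_max; apply: mulmx_colP => c; rewrite mul0mx -mulmxA.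
  apply/stackP => i; rewrite colE mulmx_sumr big1 // => q _.
  by rewrite -scalemxAr Ms ?scaler0 ?mem_tnth.
have rN := deg_le_rank gen_a x MN.
apply: NNPP => H.
have : (kermx (stack x N)^T <= VN^T)%MS.
  apply/rV_subP => w /sub_kermxP wk; apply: NNPP => nw; apply: H; exists w^T.
    move=> y; move/(nthP 0) => [i lti <-].
    have /stackP/(_ (Ordinal (lti : (i < size s)%N))) : stack x N *m w^T = 0.
      by apply: trmx_inj; rewrite trmx_mul trmxK wk trmx0.
    by rewrite /x (tnth_nth 0).
  move=> [c cE]; apply: nw; apply/submxP; exists (\row_i c (enum_val i)).
  apply: trmx_inj; rewrite cE trmx_mul trmxK colE; apply: eq_bigr => q _.
  by rewrite !mxE enum_rankK.
move/mxrankS; rewrite mxrank_ker !mxrank_tr => le1.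
have := leq_trans le1 (rank_leq_col _); rewrite leq_subLR leqNgt.
move/negP; apply; apply: leq_trans rM.
by apply: leq_ltn_trans (leq_add rN (leqnn _)) _; rewrite ltn_add2l.
Qed.

End KernelTransfer.

Section States.
Context (K : closedFieldType) (J A : finType) (bl : J -> A) (B : pred J).

(** Each block has a sink, reached by the loops of the block, and each b in B has a
    sink, reached by the loop w_b only. *)
Definition sink : finType := (A + {j | B j})%type.

Definition incidence (k : sink) : pred J :=
  match k with inl a => fun j => bl j == a | inr b => fun j => val b == j end.

Local Notation T := sink.
Local Notation R := incidence.
Local Notation L := (alg K R).
Local Notation e1 := (e1 K R).
Local Notation ev := (ev K R).
Local Notation lo := (lo K R).
Local Notation ar := (ar K R).
Local Notation line := (@line K J T R).
Local Notation p := #|{: ppath R}|.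
Local Notation P := (pmod K R).

(** In the degeneration for a state, the block i has gone to infinity along its part of
    the direction if [moved s i], and the line at b in B has become that of g_b w_b
    if [moved_aux s b]. *)
Record state := State {
  moved : A -> bool;
  direction : J -> K;
  moved_aux : {j | B j} -> bool
}.
Implicit Types (s : state).

(** The line at b can only move together with its block, and must move if the block
    moves in a direction with nonzero component at b. *)
Definition valid s : Prop :=
  [/\ forall a, moved s a -> exists2 j, bl j = a & direction s j != 0,
      forall b, moved_aux s b -> moved s (bl (val b))
    & forall b, moved s (bl (val b)) -> direction s (val b) != 0 -> moved_aux s b].

(** The coefficients of g_k and of the paths g_k w_j in the vector at the sink k. *)
Definition sc s (k : T) : K := match k with
  | inl a => (~~ moved s a)%:R | inr b => (~~ moved_aux s b)%:R end.

Definition st s (k : T) : J -> K := match k with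
  | inl a => if moved s a then direction s else fun=> 0
  | inr b => fun=> (moved_aux s b)%:R end.

Definition slines s (k : T) : L := line k (sc s k) (st s k).

Lemma slinesE s k : slines s k = line k (sc s k) (st s k).
Proof. by []. Qed.

Lemma slines_neq0 s k : valid s -> (sc s k != 0) \/ (exists2 j, R k j & st s k j != 0).
Proof.
move=> [sm _ _]; case: k => [a|b] /=.
  case: ifP => [/sm[j ja tj]|_]; last by left; rewrite oner_eq0.
  by right; exists j => //; rewrite ja eqxx.
case: (moved_aux s b) => /=; last by left; rewrite oner_eq0.
by right; exists (val b); rewrite ?eqxx ?oner_eq0.
Qed.

Lemma slines_lines s : valid s -> lines (slines s).
Proof. by move=> vs; apply: lines_family => k; exact: slines_neq0. Qed.

Definition state_module s d (N : module L d) : Prop :=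
  is_quotient P (fun v => v \in line_span (slines s)) N.

Definition start : state := State (fun=> false) (fun=> 0) (fun=> false).

Lemma valid_start : valid start. Proof. by split. Qed.

Lemma slines_start k : slines start k = ar k.
Proof. by case: k => k; exact: line_ar. Qed.

Section Classification.
Context (r : nat) (a : 'I_r -> L) (gen_a : algebra_generators a) (d : nat).
Hypothesis dp : (d + #|T| = p)%N.

Lemma state_module_exists s : valid s -> exists N : module L d, state_module s N.
Proof.
move=> vs; have ls := slines_lines vs; apply: quotient_exists.
  exact: line_span_submodule.
by rewrite dim_line_span // addnC.
Qed.

Lemma quotient_of_generator (N : module L d) u (m : 'cV_d) : lines u ->
  N e1 *m m = m -> (forall v : 'cV_d, exists x, v = N x *m m) ->
  (forall k, N (u k) *m m = 0) -> is_quotient P (fun v => v \in line_span u) N.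
Proof.
move=> hu e1m gen um; have [f hf fE] := pmod_hom e1m.
have sf : surj f by move=> w; have [x ->] := gen w; exists (pvec x); rewrite fE.
exists f; split=> // v.
have sub : (line_span u <= lker (linfun (mulmx f : 'cV[K]_p -> 'cV[K]_d)))%VS.
  apply/subvP => w /line_spanP[c ->]; rewrite memv_ker lfunE /= mulmx_sumr.
  by apply/eqP/big1 => k _; rewrite -scalemxAr fE um scaler0.
have -> : line_span u = lker (linfun (mulmx f : 'cV[K]_p -> 'cV[K]_d)).
  apply/eqP; rewrite eqEdim sub /= dim_line_span //.
  have := limg_ker_dim (linfun (mulmx f : 'cV[K]_p -> 'cV[K]_d)) fullv.
  rewrite capfv (_ : (linfun _ @: fullv)%VS = fullv).
    rewrite !dimvf /dim /= !muln1 => E.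
    rewrite -(leq_add2l d); apply: (leq_trans (eq_leq _) (eq_leq (esym dp))).
    by rewrite addnC; exact: E.
  apply/eqP; rewrite eqEsubv subvf; apply/subvP => w _; have [w' <-] := sf w.
  by rewrite -[f *m w']/(mulmx f w') -(lfunE (mulmx f)) memv_img ?memvf.
by rewrite memv_ker lfunE; split=> /eqP.
Qed.

Definition span_e1 (N : module L d) (m : 'cV[K]_d) c (t : J -> K) :=
  c *: m + \sum_j t j *: (N (lo j) *m m).

Lemma line_act (N : module L d) (m : 'cV_d) k c t : N (line k c t) *m m =
  c *: (N (ar k) *m m) + \sum_(j | R k j) t j *: (N (ar k * lo j) *m m).
Proof.
rewrite /line linearD linearZ /= mulmxDl -scalemxAl; congr (_ + _).
rewrite linear_sum mulmx_suml; apply: eq_bigr => j _.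
by rewrite linearZ /= -scalemxAl.
Qed.

Lemma loop_part_act (N : module L d) (m : 'cV_d) c t : N e1 *m m = m ->
  N (loop_part R c t) *m m = span_e1 N m c t.
Proof.
move=> e1m; rewrite /loop_part linearD linearZ /= mulmxDl -scalemxAl e1m.
congr (_ + _); rewrite linear_sum mulmx_suml; apply: eq_bigr => j _.
by rewrite linearZ /= -scalemxAl.
Qed.

Context (M : module L d) (stM : state_module start M).

(** In M, the arrows to the sinks of the block i and of its elements in B kill the
    generator and its products with the loops of the other blocks.  So in N these
    arrows kill some vector outside of the span of the products of m with the loops
    of the other blocks; c and t are its coefficients. *)
Lemma block_relation (N : module L d) (m : 'cV_d) i :
  deg_le a M N -> N e1 *m m = m -> (forall v : 'cV_d, exists x, v = N x *m m) ->
  exists c t, [/\ c != 0 \/ exists2 j, bl j = i & t j != 0,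
    N (line (inl i) c t) *m m = 0
    & forall b, bl (val b) = i -> N (line (inr b) c t) *m m = 0].
Proof.
move=> MN e1m gen; have [f [hf sf kf]] := stM.
pose O : finType := {j | bl j != i}.
pose s := [seq ev k | k <- enum T] ++ ar (inl i) ::
  [seq ar (inr b) | b <- enum {: {j | B j}} & bl (val b) == i].
pose vM (o : option O) : 'cV[K]_d :=
  f *m pvec (if o is Some j then lo (val j) else e1).
pose vN (j : O) : 'cV[K]_d := N (lo (val j)) *m m.
have fk x : f *m pvec x = M x *m (f *m pvec e1).
  by rewrite pvec_gen mulmxA hf mulmxA.
have far k : f *m pvec (ar k) = 0.
  apply/kf; have := mem_line_span (slines start) k.
  by rewrite slines_start.
have sM o x : x \in s -> M x *m vM o = 0.
  rewrite /vM [f *m _]fk mulmxA -moduleM -fk.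
  have arM k : (forall j, bl j != i -> ~~ R k j) ->
      f *m pvec (ar k * (if o is Some j then lo (val j) else e1)) = 0.
    move=> H; case: o => [j|]; last by rewrite pvec_e1 far.
    by rewrite ar_lo_eq0 ?linear0 ?mulmx0 //; apply: H; exact: valP j.
  rewrite mem_cat inE => /or3P[/mapP[k _ ->]|/eqP ->|/mapP[b]].
  - by case: o {arM} => [j|]; rewrite ?ev_lo ?ev_e1 linear0 mulmx0.
  - by apply: arM => j /=.
  - rewrite mem_filter => /andP[/eqP bi _] ->; apply: arM => j /= ji.
    by apply: contraNneq ji => <-; rewrite bi.
have e1P k x : cf (e1 * slines start k) x = 0.
  by rewrite (act_lines _ _ (slines_lines valid_start)) cf_e1 scale0r cf0.
have free c : \sum_o c o *: vM o = 0 -> forall o, c o = 0.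
  move=> E; pose t j := if insub j is Some o then c (Some (o : O)) else 0.
  pose x := loop_part R (c None) t.
  have Ex : \sum_o c o *: vM o = f *m pvec x.
    rewrite sum_option /x /loop_part linearD linearZ /= mulmxDr -scalemxAr.
    congr (_ + _); rewrite linear_sum mulmx_sumr (bigID (fun j => bl j != i)) /=.
    rewrite [X in _ + X]big1 ?addr0 => [|j nj]; last first.
      by rewrite /t insubF ?scale0r ?linear0 ?mulmx0 //; apply/negbTE.
    rewrite -(sum_sig (fun j => bl j != i) (fun j => f *m pvec (t j *: lo j))).
    by apply: eq_bigr => o _; rewrite linearZ /= -scalemxAr /t valK.
  have x0 : pvec x = 0.
    have /line_spanP[b xE] : pvec x \in line_span (slines start) by apply/kf; rewrite -Ex.
    rewrite -[x]e1_loop_part /x -/x -pmodE xE mulmx_sumr big1 // => k _.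
    rewrite -scalemxAr pmodE (_ : _ * _ = 0) ?linear0 ?scaler0 //.
    by apply: cf_inj => y; rewrite e1P cf0.
  have z y : cf x (inl y) = 0 by rewrite -pvecE x0 mxE.
  have loE j : cf x (inl (ploop R j)) = t j.
    rewrite cfD cfZ cf_e1 (_ : _ == _ = false) ?mulr0 ?add0r; last by apply/negbTE/eqP.
    rewrite cf_sum (bigD1 j) //= big1 ?addr0 => [|j' ne].
      by rewrite cfZ cf_lo eq_ploop eqxx mulr1.
    by rewrite cfZ cf_lo eq_ploop eq_sym (negPf ne) mulr0.
  case=> [o|]; first by have := loE (val o); rewrite z /t valK => <-.
  have := z (ptriv R); rewrite cfD cfZ cf_e1 eqxx mulr1 cf_sum big1 ?addr0 // => j _.
  by rewrite cfZ cf_lo (_ : _ == _ = false) ?mulr0 //; apply/negbTE/eqP.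
have lt : (#|O| < #|{: option O}|)%N by rewrite card_option.
have [v vs vN0] := kernel_transfer gen_a vN MN lt sM free.
have evv : v = N e1 *m v.
  rewrite -{1}[v]mul1mx -(module1 N) one_sum linearD mulmxDl linear_sum mulmx_suml.
  rewrite big1 ?addr0 // => k _; apply: vs; rewrite mem_cat; apply/orP; left.
  by apply: map_f; rewrite mem_enum.
have [x xE] := gen v; have [c [t E]] := e1_corner x.
have vE : v = N (loop_part R c t) *m m.
  by rewrite evv xE -{1}e1m !mulmxA -!moduleM E.
exists c, t.
have act k : N (ar k) *m v = N (line k c t) *m m.
  rewrite vE mulmxA -moduleM.
  rewrite -line_ar.
  rewrite line_loop_part; congr (N _ *m _); apply: eq_line => [|j _]; first by rewrite mul1r.
  by rewrite mul0r add0r mul1r.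
split.
- apply: NNPP => /not_or_and[/negP/negPn/eqP c0 t0]; apply: vN0.
  exists (fun j => t (val j)); rewrite vE loop_part_act // /span_e1 c0 scale0r add0r.
  rewrite (bigID (fun j => bl j != i)) /= [X in _ + X]big1 ?addr0 => [|j /negPn/eqP ji].
    by rewrite -(sum_sig (fun j => bl j != i) (fun j => t j *: (N (lo j) *m m))).
  rewrite (_ : t j = 0) ?scale0r //; apply/eqP; apply: contra_notT t0 => tj.
  by exists j.
- by rewrite -act; apply: vs; rewrite mem_cat inE eqxx orbT.
- move=> b bi; rewrite -act; apply: vs; rewrite mem_cat inE; apply/orP; right.
  by apply/orP; right; apply: map_f; rewrite mem_filter bi eqxx mem_enum.
Qed.

(** The space of M at the sink b has dimension one, so that of N has dimension at most
    one. *)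
Lemma aux_relation (N : module L d) (m : 'cV_d) b : deg_le a M N ->
  exists y z : K, (y != 0 \/ z != 0) /\
    y *: (N (ar (inr b)) *m m) + z *: (N (ar (inr b) * lo (val b)) *m m) = 0.
Proof.
move=> MN; have [f [hf sf kf]] := stM; pose k : T := inr b.
have rM : (\rank (M (ev k)) <= 1)%N.
  pose g := f *m pvec (ar k * lo (val b)).
  rewrite -mxrank_tr; apply: leq_trans (rank_leq_row g^T); apply: mxrankS.
  apply/row_subP => i; rewrite -tr_col colE.
  have [v <-] := sf (delta_mx i 0); have [x ->] := pvecW v.
  rewrite mulmxA -hf -mulmxA pmodE -pvec_e1; have [c [t ->]] := ev_corner k x.
  rewrite linearD linearZ /= mulmxDr -scalemxAr.
  have -> : f *m pvec (ar k) = 0.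
    apply/kf; have := mem_line_span (slines start) k.
    by rewrite slines_start.
  rewrite scaler0 add0r (bigD1 (val b)) //= big1 ?addr0 => [|j /andP[/eqP <-]]; last first.
    by rewrite eqxx.
  by rewrite linearZ /= -scalemxAr linearZ /=; apply: scalemx_sub.
have rN : (\rank (N (ev k)) <= 1)%N.
  apply: leq_trans rM; apply: leq_trans (rank_le_ker _) (leq_trans
    (deg_le_rank gen_a (fun=> ev k : L) (q := 1) MN) (rank_le_ker _)) => v.
    by move=> /stackP/(_ ord0).
  by move=> Mv; apply/stackP.
have [y [z [yz E]]] := rank1_dependent (N (ar k) *m m) (N (ar k * lo (val b)) *m m) rN.
exists y, z; split=> //; rewrite -[RHS]E !mulmxA -!moduleM mulrA ev_ar eqxx.
by rewrite scale1r.
Qed.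

(** The relations of the two preceding lemmas are brought to normal form by replacing
    the generator m by m + sum s_j w_j m.  For reasons of dimension there are no
    others. *)
Lemma classification (N : module L d) :
  deg_le a M N -> same_top M N -> exists2 s, valid s & state_module s N.
Proof.
move=> MN MNt.
have [m e1m gen] := same_top_generator (slines_lines valid_start) stM MNt.
have /fin_all_exists[ct Hct] i : exists ct : K * (J -> K),
    [/\ ct.1 != 0 \/ exists2 j, bl j = i & ct.2 j != 0,
     N (line (inl i) ct.1 ct.2) *m m = 0
     & forall b, bl (val b) = i -> N (line (inr b) ct.1 ct.2) *m m = 0].
  by have [c [t H]] := block_relation i MN e1m gen; exists (c, t).
have /fin_all_exists[yz Hyz] b : exists yz : K * K, (yz.1 != 0 \/ yz.2 != 0) /\
    yz.1 *: (N (ar (inr b)) *m m) + yz.2 *: (N (ar (inr b) * lo (val b)) *m m) = 0.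
  by have [y [z H]] := aux_relation m b MN; exists (y, z).
pose c i := (ct i).1; pose t j := (ct (bl j)).2 j.
pose gam (b : {j | B j}) : 'cV[K]_d := N (ar (inr b) * lo (val b)) *m m.
(* The parameters of a block that has not moved are absorbed by the generator.  In a
   block that has moved, this is done at the elements of B that have not moved. *)
pose sh j := if c (bl j) == 0 then
    (if insub j is Some b then (if gam b == 0 then 0 else (yz b).2 / (yz b).1) else 0)
  else t j / c (bl j).
pose s := State (fun i => c i == 0) t (fun b => (c (bl (val b)) == 0) && (gam b == 0)).
pose m' := N (loop_part R 1 sh) *m m.
have shift k d' u : N (line k d' u) *m m' = N (line k d' (fun j => u j + d' * sh j)) *m m.
  rewrite mulmxA -moduleM line_loop_part; congr (N _ *m _); apply: eq_line => [|j _].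
    by rewrite mulr1.
  by rewrite mulr1.
have auxE (b : {j | B j}) d' u : N (line (inr b) d' u) *m m
    = d' *: (N (ar (inr b)) *m m) + u (val b) *: gam b.
  rewrite line_act; congr (_ + _); rewrite (bigD1 (val b)) //= big1 ?addr0 // => j.
  by case/andP=> /eqP <-; rewrite eqxx.
have vs : valid s.
  split=> [i /= /eqP ci|b /= /andP[]//|b /= ci tb].
    have [[/eqP[]//|[j ji tj]] _ _] := Hct i.
    by exists j; rewrite // /t ji.
  rewrite ci /=; have [_ _ /(_ b erefl)] := Hct (bl (val b)).
  rewrite auxE -/(c _) (eqP ci) scale0r add0r => /eqP.
  by rewrite scaler_eq0 -/(t _) (negPf tb).
exists s => //.
apply: (quotient_of_generator (m := m')) => [||v|k].
- exact: slines_lines.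
- by rewrite mulmxA -moduleM e1_loop_part.
- have [x xE] := gen v; exists (x * loop_part R 1 (fun j => - sh j)).
  rewrite moduleM -mulmxA /m' [_ *m (_ *m m)]mulmxA -moduleM loop_part_mul xE -{1}e1m.
  congr (_ *m (N _ *m _)); rewrite /loop_part mulr1 scale1r big1 ?addr0 // => j _.
  by rewrite mulr1 mul1r addNr scale0r.
case: k => [i|b]; rewrite /slines /=.
  case: (boolP (c i == 0)) => ci /=.
    rewrite shift; have [_ E _] := Hct i; rewrite -[RHS]E; congr (N _ *m _).
    apply: eq_line => [|j /eqP ji]; first by rewrite -/(c i) (eqP ci).
    by rewrite mul0r addr0 /t ji.
  rewrite shift; have [_ E _] := Hct i.
  rewrite (_ : line _ _ _ = (c i)^-1 *: line (inl i) (ct i).1 (ct i).2).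
    by rewrite linearZ /= -scalemxAl E scaler0.
  rewrite line_scale; apply: eq_line => [|j /eqP ji]; first by rewrite mulVf.
  by rewrite add0r mul1r /sh ji (negPf ci) /t ji mulrC.
rewrite /gam; case: (boolP (c (bl (val b)) == 0)) => ci /=.
  case: (boolP (gam b == 0)) => gb.
    by rewrite shift auxE scale0r add0r mul0r addr0 scale1r (eqP gb).
  rewrite shift auxE add0r mul1r scale1r /sh ci valK (negPf gb).
  have [yz0 E] := Hyz b.
  have y0 : (yz b).1 != 0.
    apply/eqP => y0; case: yz0 => [|z0]; first by rewrite y0 eqxx.
    move/eqP: E; rewrite y0 scale0r add0r scaler_eq0 (negPf z0) /=.
    by rewrite -/(gam b) (negPf gb).
  have -> : N (ar (inr b)) *m m = - (((yz b).2 / (yz b).1) *: gam b).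
    apply/eqP; rewrite -addr_eq0; apply/eqP.
    apply: (scalerI y0); rewrite scaler0 scalerDr scalerA mulrCA divff // mulr1.
    exact: E.
  by rewrite addNr.
rewrite shift; have [_ _ /(_ b erefl) E] := Hct (bl (val b)).
rewrite (_ : line _ _ _ = (c (bl (val b)))^-1 *:
  line (inr b) (ct (bl (val b))).1 (ct (bl (val b))).2).
  by rewrite linearZ /= -scalemxAl E scaler0.
rewrite line_scale; apply: eq_line => [|j /eqP <-]; first by rewrite mulVf.
by rewrite add0r mul1r /sh (negPf ci) mulrC.
Qed.

End Classification.
End States.

Arguments valid_start {K J A bl B}.
Arguments slines_start {K J A bl B} k.

(** * The poset of degenerations *)

Section Poset.
Context (K : closedFieldType) (J A : finType) (bl : J -> A) (B : pred J).
Local Notation T := (sink A B).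
Local Notation R := (@incidence J A bl B).
Local Notation L := (alg K R).
Local Notation e1 := (e1 K R).
Local Notation lo := (lo K R).
Local Notation ar := (ar K R).
Local Notation line := (@line K J T R).
Local Notation p := #|{: ppath R}|.
Local Notation P := (pmod K R).
Local Notation state := (@state K J A B).
Local Notation valid := (@valid K J A bl B).
Local Notation state_module := (@state_module K J A bl B).
Local Notation slines := (@slines K J A bl B).
Local Notation start := (@start K J A B).
Implicit Types (s : state).

(** A block that has moved keeps its direction, up to a scalar. *)
Definition state_le s s' : Prop :=
  (forall i, moved s i -> moved s' i /\
     exists c, forall j, bl j = i -> direction s j = c * direction s' j) /\
  (forall b, moved_aux s b -> moved_aux s' b).

(** The length of the saturated chains from the start to s. *)
Definition rank s : nat :=
  (\sum_i moved s i + \sum_b (moved_aux s b && (direction s (val b) == 0%R)))%N.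

Lemma rank_start : rank start = 0%N.
Proof. by rewrite /rank !big1. Qed.

Lemma start_le s : state_le start s.
Proof. by split. Qed.

Lemma state_le_coef s s' i c : valid s -> moved s i ->
  (forall j, bl j = i -> direction s j = c * direction s' j) -> c != 0.
Proof.
move=> [sm _ _] /sm[j ji tj] H; apply: contra_neq tj => c0.
by rewrite H // c0 mul0r.
Qed.

Lemma aux_indicator_le s s' b : valid s -> valid s' -> state_le s s' ->
  moved_aux s b && (direction s (val b) == 0) ->
  moved_aux s' b && (direction s' (val b) == 0).
Proof.
move=> vs vs' [le1 le2] /andP[eb /eqP tb]; rewrite le2 //=.
have mb : moved s (bl (val b)) by case: vs => _ + _; apply.
have [_ [c E]] := le1 _ mb.
have := E _ erefl; rewrite tb => /esym/eqP.
by rewrite mulf_eq0 (negPf (state_le_coef vs mb E)).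
Qed.

Lemma rank_mono s s' : valid s -> valid s' -> state_le s s' -> (rank s <= rank s')%N.
Proof.
move=> vs vs' le; apply: leq_add; apply: leq_sum => x _.
  by case E: (moved s x) => //; have [-> _] := le.1 _ E.
case E: (_ && _) => //; by rewrite (aux_indicator_le vs vs' le E).
Qed.

Lemma eq_sum_indicator (I : finType) (f g : I -> bool) :
  (forall i, f i -> g i) -> (\sum_i g i <= \sum_i f i)%N -> f =1 g.
Proof.
move=> fg le i; apply/idP/idP; first exact: fg.
move=> gi; apply: contraT => nfi.
have : (\sum_i f i < \sum_i g i)%N.
  rewrite (bigD1 i) //= (negPf nfi) [X in (_ < X)%N](bigD1 i) //= gi add0n add1n ltnS.
  by apply: leq_sum => j _; case E: (f j) => //; rewrite fg.
by rewrite ltnNge le.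
Qed.

(** In a valid state, the elements of B that have moved are determined by the moved
    blocks, their directions, and the elements of B counted by the rank. *)
Lemma state_rigid s s' : valid s -> valid s' -> state_le s s' -> (rank s' <= rank s)%N ->
  moved s =1 moved s' /\ moved_aux s =1 moved_aux s'.
Proof.
move=> vs vs' le rk.
have le1 : (\sum_i moved s i <= \sum_i moved s' i)%N.
  by apply: leq_sum => i _; case E: (moved s i) => //; have [-> _] := le.1 _ E.
pose f s b := moved_aux s b && (direction s (val b) == 0).
have le2 : (\sum_b f s b <= \sum_b f s' b)%N.
  apply: leq_sum => b _; rewrite /f; case E: (_ && _) => //.
  by rewrite (aux_indicator_le vs vs' le E).
have ge1 : (\sum_i moved s' i <= \sum_i moved s i)%N.
  rewrite leqNgt; apply/negP => lt; have := leq_add lt le2.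
  by rewrite addSn ltnNge => /negP; apply; exact: rk.
have ge2 : (\sum_b f s' b <= \sum_b f s b)%N.
  rewrite leqNgt; apply/negP => lt; have := leq_add le1 lt.
  by rewrite addnS ltnNge => /negP; apply; exact: rk.
have mE : moved s =1 moved s'.
  by apply: eq_sum_indicator ge1 => i /(le.1 _)[].
have fE : f s =1 f s'.
  by apply: eq_sum_indicator ge2 => b; exact: aux_indicator_le.
split=> // b; apply/idP/idP; first exact: le.2.
move=> eb'; have := fE b; rewrite /f eb' /=.
have [tb'|tb' _] := eqVneq (direction s' (val b)) 0; first by case/andP.
have mb : moved s (bl (val b)) by rewrite mE; case: vs' => _ + _; apply.
have [_ [c E]] := le.1 _ mb; have [sm s2 s3] := vs; apply: s3 => //.
by rewrite (E _ erefl) mulf_neq0 // (state_le_coef vs mb E).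
Qed.

(** ** Elementary steps *)

Definition move_block s i (t : J -> K) : state :=
  State (fun i' => moved s i' || (i' == i))
        (fun j => if bl j == i then t j else direction s j)
        (fun b => moved_aux s b || ((bl (val b) == i) && (t (val b) != 0))).

Definition move_aux s b : state :=
  State (moved s) (direction s) (fun b' => moved_aux s b' || (b' == b)).

Lemma valid_move_block s i t : valid s -> ~~ moved s i ->
  (exists2 j, bl j = i & t j != 0) -> valid (move_block s i t).
Proof.
move=> [s1 s2 s3] ni [j0 j0i tj0]; split=> [i'|b|b] /=.
- have [->|ne] := eqVneq i' i; first by exists j0; rewrite ?j0i ?eqxx.
  rewrite orbF => /s1[j ji tj]; exists j => //.
  by rewrite ji (negPf ne).
- by move=> /orP[/s2 ->//|/andP[-> _]]; rewrite orbT.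
- have [bi|ne] := eqVneq (bl (val b)) i => /=.
    by move=> _ ->; rewrite orbT.
  by rewrite !orbF; exact: s3.
Qed.

Lemma valid_move_aux s b : valid s -> moved s (bl (val b)) -> valid (move_aux s b).
Proof.
move=> [s1 s2 s3] mb; split=> [//|b'|b' m t] /=; last by rewrite s3.
by move=> /orP[/s2 //|/eqP ->].
Qed.

Inductive step s : state -> Prop :=
| StepBlock i t : ~~ moved s i -> (exists2 j, bl j = i & t j != 0) ->
    step s (move_block s i t)
| StepAux b : moved s (bl (val b)) -> ~~ moved_aux s b -> step s (move_aux s b).

Lemma step_valid s s' : valid s -> step s s' -> valid s'.
Proof.
move=> vs [i t ni ti|b mb _]; first exact: valid_move_block.
exact: valid_move_aux.
Qed.

Lemma step_le s s' : step s s' -> state_le s s'.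
Proof.
move=> [i t ni ti|b mb _]; split=> [i' mi'|b'] /=.
- split; first by rewrite mi'.
  exists 1 => j ji; rewrite mul1r; case: eqP => // ji'.
  by case/negP: ni; rewrite -ji' ji.
- by move->.
- by split=> //; exists 1 => j _; rewrite mul1r.
- by move->.
Qed.

Lemma rank_step s s' : valid s -> step s s' -> rank s' = (rank s).+1.
Proof.
move=> [s1 s2 s3] [i t ni ti|b mb nb]; rewrite /rank /=.
  rewrite -addSn; congr (_ + _)%N.
  rewrite (bigD1 i) //= eqxx orbT [in RHS](bigD1 i) //= (negPf ni) add0n add1n.
  by congr _.+1; apply: eq_bigr => i' /negPf ->; rewrite orbF.
  apply: eq_bigr => b _; have [bi|_] /= := eqVneq (bl (val b)) i; last by rewrite orbF.
  have -> : moved_aux s b = false.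
    by apply/negbTE; apply: contra ni => /s2; rewrite bi.
  by case: (t (val b) == 0).
rewrite -addnS; congr (_ + _)%N.
rewrite (bigD1 b) //= eqxx orbT [in RHS](bigD1 b) //= (negPf nb) add0n.
have -> : direction s (val b) == 0 by apply: contraNT nb => tb; apply: s3.
by rewrite add1n; congr _.+1; apply: eq_bigr => b' /negPf ->; rewrite orbF.
Qed.

(** Some block that has moved in s' can be moved in s; if there is none, some element
    of B can, for otherwise the ranks agree. *)
Lemma interpolation s s' : valid s -> valid s' -> state_le s s' ->
  (rank s < rank s')%N -> exists2 s1, step s s1 & state_le s1 s'.
Proof.
move=> vs vs' le lt; have [v1 v2 v3] := vs'.
have [/existsP[i /andP[mi' ni]]|] := boolP [exists i, moved s' i && ~~ moved s i].
  exists (move_block s i (direction s')); first by apply: StepBlock => //; exact: v1.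
  split=> [i'|b] /=.
    have [->|ne] := eqVneq i' i.
      by split=> //; exists 1 => j ji; rewrite ji eqxx mul1r.
    rewrite orbF => /(le.1 _)[mi1 [c E]]; split=> //; exists c => j ji.
    by rewrite ji (negPf ne); exact: E.
  case/orP => [/(le.2 _)//|/andP[/eqP bi tb]]; apply: v3 => //.
  by rewrite bi.
rewrite negb_exists => /forallP H.
have mE i : moved s i = moved s' i.
  apply/idP/idP => [/(le.1 _)[]//|mi']; have := H i; rewrite mi' /=.
  by rewrite negbK.
have [/existsP[b /andP[eb' nb]]|] := boolP [exists b, moved_aux s' b && ~~ moved_aux s b].
  have mb : moved s (bl (val b)) by rewrite mE; exact: v2.
  exists (move_aux s b); first exact: StepAux.
  split=> [i /=|b' /= /orP[/(le.2 _)//|/eqP ->//]]; exact: le.1.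
rewrite negb_exists => /forallP H2; move: lt; rewrite ltnNge => /negP[].
rewrite /rank leq_add //; apply: leq_sum => x _; first by rewrite mE.
case E: (_ && _) => //; case/andP: E => eb' /eqP tb'.
have eb : moved_aux s x by have := H2 x; rewrite eb' negbK.
rewrite eb; have mb : moved s (bl (val x)) by case: vs => _ + _; apply.
by have [_ [c ->]] := le.1 _ mb; rewrite // tb' mulr0 eqxx.
Qed.

(** ** The order is the degeneration order *)

Section Modules.
Context (r : nat) (a : 'I_r -> L) (gen_a : algebra_generators a) (d : nat).
Hypothesis dp : (d + #|{: T}| = p)%N.
Implicit Types (N : module L d).

Lemma state_module_annihilates s N k t : valid s -> state_module s N ->
  N (line k 0 t) = 0 <-> pvec (line k 0 t) \in line_span (slines s).
Proof.
move=> vs [f [hf sf kf]]; split=> [N0|H].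
  by apply/kf; rewrite pvec_gen mulmxA hf N0 !mul0mx.
apply: mulmx_colP => v; have [w <-] := sf v; have [x ->] := pvecW w.
rewrite mulmxA -hf -mulmxA pmodE -pvec_e1 mul0mx.
have [c [t' E]] := e1_corner x.
rewrite -line_e1 -!mulrA [e1 * _]mulrA E line_loop_part.
have -> : line k (0 * c) (fun j => t j * c + 0 * t' j) = c *: line k 0 t.
  rewrite line_scale; apply: eq_line => [|j _]; first by rewrite mul0r mulr0.
  by rewrite mul0r addr0 mulrC.
by rewrite linearZ /= -scalemxAr; move/kf: H => ->; rewrite scaler0.
Qed.

(** The lines in the span of the paths of length two that belong to a state are
    visible in the annihilator of its module, and annihilators grow under
    degeneration. *)
Lemma deg_le_state s s' N N' : valid s -> valid s' -> state_module s N ->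
  state_module s' N' -> deg_le a N N' -> state_le s s'.
Proof.
move=> vs vs' sN sN' NN'.
have key k t : pvec (line k 0 t) \in line_span (slines s) ->
    exists c, pvec (line k 0 t) = c *: pvec (slines s' k).
  move/(state_module_annihilates _ _ vs sN)/(deg_le_annihilates gen_a NN').
  move/(state_module_annihilates _ _ vs' sN').
  by apply: lines_memE; [exact: slines_lines | rewrite ev_line eqxx scale1r].
split=> [i mi|b eb].
  have [|c] := key (inl i) (direction s).
    by have := mem_line_span (slines s) (inl i); rewrite slinesE /= mi.
  rewrite -linearZ /= line_scale => /pvec_line_inj[/= /esym c0 E].
  have [j ji tj] : exists2 j, bl j = i & direction s j != 0 by case: vs => + _ _; apply.
  case mi': (moved s' i) c0 E => /= c0 E.
    by split=> //; exists c => j' /eqP/E.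
  by move: tj; rewrite E ?ji // mulr0 eqxx.
have [|c] := key (inr b) (fun=> 1).
  by have := mem_line_span (slines s) (inr b); rewrite slinesE /= eb.
rewrite -linearZ /= line_scale => /pvec_line_inj[/= _ E].
apply: contraT => nb; have := E (val b) (eqxx _); rewrite (negPf nb) mulr0 => /eqP.
by rewrite oner_eq0.
Qed.

Lemma state_module_iso_le s s' N : valid s -> valid s' -> state_le s s' ->
  moved s =1 moved s' -> moved_aux s =1 moved_aux s' -> state_module s N ->
  state_module s' N.
Proof.
move=> vs vs' le mE aE; rewrite /state_module.
have /fin_all_exists2[c c0 cE] (k : T) : exists2 c, c != 0 & slines s k = c *: slines s' k.
  case: k => [i|b]; rewrite !slinesE /= -?mE -?aE; last first.
    by exists 1; rewrite ?oner_eq0 ?scale1r.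
  case: ifP => mi /=; last by exists 1; rewrite ?oner_eq0 ?scale1r.
  have [_ [c E]] := le.1 _ mi; exists c; first exact: state_le_coef mi E.
  by rewrite line_scale mulr0; apply: eq_line => // j /eqP; exact: E.
by rewrite (line_span_scale c0 cE).
Qed.

(** The curve of lines with coefficients sc s' + tau wc at the arrows and st s' at the
    paths of length two ends in the lines of s' at tau = 0; for other tau it consists
    of the images of the lines of s under the automorphism with parameters sh tau. *)
Lemma curve_step s s' (M N : module L d) (wc : T -> K) (pj : T -> J) (sh : K -> J -> K)
    (c : K -> T -> K) : valid s' ->
  (forall k, wc k != 0 -> R k (pj k) /\ st s' k (pj k) != 0) ->
  (forall t k, t != 0 -> c t k != 0) ->
  (forall t k, t != 0 -> sc s k = c t k * (sc s' k + t * wc k)) ->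
  (forall t k j, t != 0 -> R k j ->
     st s k j + sc s k * sh t j = c t k * st s' k j) ->
  state_module s M -> state_module s' N -> deg_le a M N.
Proof.
move=> vs' Hpj c0 Hsc Hst sM sN.
pose w k : L := line k (wc k) (fun=> 0).
pose y k : ppath R := insubd (parr R k) (Some k, Some (pj k)).
pose q k : K := if wc k == 0 then 1 else st s' k (pj k).
have uw t k : slines s' k + t *: w k = line k (sc s' k + t * wc k) (st s' k).
  rewrite line_scale line_add; apply: eq_line => // j _.
  by rewrite mulr0 addr0.
have w0 k : wc k = 0 -> pvec (w k) = 0 by rewrite /w => ->; rewrite line0 linear0.
have yE k : wc k != 0 -> exists v : R k (pj k), y k = plen v.
  move=> /Hpj[v _]; exists v; apply: val_inj; rewrite /y val_insubd.
  by rewrite (_ : nonzero_path _ _ = true).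
have lt t : lines (fun k => slines s' k + t *: w k).
  have [|h1 h2] := @lines_family K J T R (fun k => sc s' k + t * wc k) (st s').
    move=> k; have [wk|wk] := eqVneq (wc k) 0.
      by rewrite wk mulr0 addr0; exact: slines_neq0.
    by right; have [v tk] := Hpj k wk; exists (pj k).
  by split=> k; rewrite uw; [exact: h1 | exact: h2].
apply: (line_curve gen_a dp lt (y := y) (q := q)) => [k k'|k|k k'||t t0].
- have [/w0 ->|wk] := eqVneq (wc k) 0; first by rewrite !scaler0.
  have [v ->] := yE k wk; rewrite cf_line_len /q (negPf wk).
  by case: eqVneq => [->|ne] //; rewrite !mul0r.
- by rewrite /q; case: ifP => [_|/negbT wk]; [exact: oner_neq0 | case: (Hpj k wk)].
- have [/w0 ->|wk] := eqVneq (wc k) 0; first by rewrite scaler0.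
  by have [v ->] := yE k wk; rewrite cf_line_len mulr0 scale0r.
- exact: sN.
apply: (quotient_aut (c := c t) (s := sh t) _ _ sM) => [k|k]; first exact: c0.
rewrite uw -linearZ /= line_loop_part line_scale; congr pvec; apply: eq_line => [|j Rj].
  by rewrite mulr1; exact: Hsc.
by rewrite mulr1; exact: Hst.
Qed.

(** The automorphism has the parameters t_j / tau for j in the block that moves,
    respectively 1 / tau at b. *)
Lemma step_deg_le s s' (M N : module L d) : valid s -> step s s' ->
  state_module s M -> state_module s' N -> deg_le a M N.
Proof.
move=> vs ss'; have vs' := step_valid vs ss'; have [s1 s2 s3] := vs.
case: ss' vs' => [i t ni [j0 j0i tj0]|b mb nb] vs'.
  pose wc (k : T) : K := match k with inl i' => (i' == i)%:R
    | inr b => if (bl (val b) == i) && (t (val b) != 0) then (t (val b))^-1 else 0 end.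
  pose pj (k : T) : J := match k with inl _ => j0 | inr b => val b end.
  pose sh tau j : K := if bl j == i then t j / tau else 0.
  pose c tau (k : T) : K := match k with inl i' => if i' == i then tau^-1 else 1
    | inr b => if (bl (val b) == i) && (t (val b) != 0) then t (val b) / tau else 1 end.
  have na b : bl (val b) = i -> moved_aux s b = false.
    by move=> bi; apply/negbTE; apply: contra ni => /s2; rewrite bi.
  apply: (curve_step (wc := wc) (pj := pj) (sh := sh) (c := c)) => //.
  - case=> [i'|b] /=.
      have [->|_] := eqVneq i' i; last by rewrite eqxx.
      by rewrite j0i eqxx orbT j0i eqxx.
    case: ifP => [/andP[bi tb] _|_ /eqP[]//].
    by split; rewrite ?eqxx // orbT oner_neq0.
  - move=> tau [i'|b] t0 /=; first by case: ifP => _; rewrite ?oner_neq0 ?invr_neq0.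
    by case: ifP => [/andP[_ tb]|_]; rewrite ?oner_neq0 // mulf_neq0 ?invr_neq0.
  - move=> tau [i'|b] t0 /=.
      have [->|_] := eqVneq i' i; last by rewrite orbF mulr0 addr0 mul1r.
      by rewrite (negPf ni) orbT add0r mulr1 mulVf.
    have [bi|_] := eqVneq (bl (val b)) i => /=; last by rewrite orbF mulr0 addr0 mul1r.
    rewrite na //=; case: eqP => [_|/eqP tb] /=; first by rewrite mulr0 addr0 mulr1.
    by rewrite add0r mulrA divfK // divff.
  - move=> tau [i'|b] j t0 /=.
      move=> /eqP ji; have [ii|ne] := eqVneq i' i.
        rewrite ii (negPf ni) orbT add0r mul1r /sh ji ii eqxx mulrC.
        by [].
      rewrite orbF /sh ji (negPf ne) mulr0 addr0 mul1r.
      by case: ifP => //; rewrite ji (negPf ne).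
    move=> /eqP <-; rewrite /sh; have [bi|_] := eqVneq (bl (val b)) i => /=; last first.
      by rewrite orbF mulr0 addr0 mul1r.
    rewrite na //= add0r mul1r; case: eqP => [->|/eqP tb] /=; first by rewrite mul0r mulr0.
    by rewrite mulr1.
pose wc (k : T) : K := match k with inl _ => 0 | inr b' => (b' == b)%:R end.
pose pj (k : T) : J := val b.
pose sh tau j : K := if j == val b then tau^-1 else 0.
pose c (tau : K) (k : T) : K := match k with inl _ => 1
  | inr b' => if b' == b then tau^-1 else 1 end.
apply: (curve_step (wc := wc) (pj := pj) (sh := sh) (c := c)) => //.
- case=> [i'|b'] /=; first by rewrite eqxx.
  have [->|_] := eqVneq b' b; last by rewrite eqxx.
  by rewrite eqxx orbT oner_neq0.
- move=> tau [i'|b'] t0 /=; rewrite ?oner_neq0 //.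
  by case: ifP; rewrite ?oner_neq0 ?invr_neq0.
- move=> tau [i'|b'] t0 /=; first by rewrite mulr0 addr0 mul1r.
  have [->|_] := eqVneq b' b; last by rewrite orbF mulr0 addr0 mul1r.
  by rewrite (negPf nb) orbT add0r mulr1 mulVf.
- move=> tau [i'|b'] j t0 /=.
    move=> /eqP ji; rewrite mul1r; case mi: (moved s i'); first by rewrite mul0r addr0.
    rewrite mul1r add0r /sh; case: eqP => // jb.
    by move: mb; rewrite -jb ji mi.
  move=> /eqP <-; rewrite /sh (inj_eq val_inj); have [->|_] := eqVneq b' b.
    by rewrite (negPf nb) orbT add0r mul1r mulr1.
  by rewrite orbF mulr0 addr0 mul1r.
Qed.

(** ** Saturated chains *)

Context (M : module L d) (stM : state_module start M).

Definition final s : Prop := (forall i, moved s i) /\ (forall b, moved_aux s b).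

Lemma topdeg_state N : topdeg a M N -> exists2 s, valid s & state_module s N.
Proof. by move=> [MN MNt]; exact: (classification gen_a dp stM MN MNt). Qed.

Lemma state_deg_le s s' N N' : valid s -> valid s' -> state_le s s' ->
  state_module s N -> state_module s' N' -> deg_le a N N'.
Proof.
move=> vs vs' le sN sN'; have [m] := ubnP (rank s' - rank s).
elim: m s vs le N sN => // m IH s vs le N sN; rewrite ltnS => lem.
have [lt|ge] := ltnP (rank s) (rank s').
  have [s1 ss1 le1] := interpolation vs vs' le lt; have v1 := step_valid vs ss1.
  have [N1 sN1] := state_module_exists dp v1.
  apply: (deg_le_trans gen_a (step_deg_le vs ss1 sN sN1) (IH s1 v1 le1 N1 sN1 _)).
  rewrite (rank_step vs ss1) subnS; case: (rank s' - rank s)%N lem (subn_gt0 (rank s) (rank s')).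
    by rewrite lt.
  by move=> k + _.
have [mE aE] := state_rigid vs vs' le ge.
have sN1 := state_module_iso_le vs vs' le mE aE sN.
apply: (deg_le_isor gen_a (quotient_unique sN1 sN')); exact: deg_le_refl.
Qed.

Lemma topdeg_of_state s N : valid s -> state_module s N -> topdeg a M N.
Proof.
move=> vs sN; split.
  exact: (state_deg_le valid_start vs (start_le s) stM sN).
exact: (quotient_same_top (slines_lines valid_start) (slines_lines vs) stM sN).
Qed.

Lemma deg_lt_rank s s' N N' : valid s -> valid s' -> state_module s N ->
  state_module s' N' -> deg_lt a N N' <-> state_le s s' /\ (rank s < rank s')%N.
Proof.
move=> vs vs' sN sN'; split=> [[NN' niso]|[le lt]].
  have le := deg_le_state vs vs' sN sN' NN'; split=> //.
  rewrite ltnNge; apply/negP => ge; apply: niso.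
  have [mE aE] := state_rigid vs vs' le ge.
  exact: quotient_unique (state_module_iso_le vs vs' le mE aE sN) sN'.
split; first exact: state_deg_le sN sN'.
move=> iso; have N'N : deg_le a N' N.
  by apply: (deg_le_isol iso); exact: deg_le_refl.
have := rank_mono vs' vs (deg_le_state vs' vs sN' sN N'N).
by rewrite leqNgt lt.
Qed.

Lemma nonfinal_step s : valid s -> (forall i, exists j, bl j = i) -> ~ final s ->
  exists s', step s s'.
Proof.
move=> vs surj nf.
have [/existsP[i ni]|] := boolP [exists i, ~~ moved s i].
  have [j ji] := surj i; exists (move_block s i (fun=> 1)); apply: StepBlock => //.
  by exists j; rewrite // oner_neq0.
rewrite negb_exists => /forallP mv; have mvd i : moved s i by have := mv i; rewrite negbK.
have [/existsP[b nb]|] := boolP [exists b, ~~ moved_aux s b].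
  by exists (move_aux s b); apply: StepAux.
rewrite negb_exists => /forallP av; case: nf; split=> // b.
by have := av b; rewrite negbK.
Qed.

Lemma final_rank s : final s ->
  rank s = (#|A| + \sum_(b : {j | B j}) (direction s (val b) == 0%R))%N.
Proof.
move=> [mv av]; rewrite /rank; congr (_ + _)%N.
  by rewrite (eq_bigr (fun=> 1%N)) ?sum1_card // => i _; rewrite mv.
by apply: eq_bigr => b _; rewrite av.
Qed.

Lemma final_max s s' : valid s -> valid s' -> final s -> state_le s s' ->
  (rank s' <= rank s)%N.
Proof.
move=> vs vs' [mv av] le; rewrite /rank; apply: leq_add.
  by apply: leq_sum => i _; rewrite mv; case: (moved s' i).
apply: leq_sum => b _; rewrite av /=; have [_ [c ->//]] := le.1 _ (mv (bl (val b))).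
by case: (moved_aux s' b) => //=; rewrite mulf_eq0; case: eqP; rewrite ?orbT.
Qed.

(** By interpolation the rank increases by one in each step of a saturated chain, and
    the last state is final because other states admit a step. *)
Lemma chain_final k : (forall i, exists j, bl j = i) -> saturated_chain_length a M k ->
  exists s, [/\ valid s, final s & k = rank s].
Proof.
move=> surj [X [X0 Xtop Xs Xmax]].
have st i : (i <= k)%N -> exists s, [/\ valid s, state_module s (X i) & rank s = i].
  elim: i => [_|i IH lti].
    exists start; split; [exact: valid_start | exact: is_quotient_iso X0 stM |].
    exact: rank_start.
  have [s [vs sX rs]] := IH (ltnW lti).
  have [s' vs' sX'] := topdeg_state (Xtop _ lti); exists s'; split=> //.
  have [lt nint] := Xs _ lti.
  have [le rlt] := (deg_lt_rank vs vs' sX sX').1 lt.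
  apply/eqP; rewrite eqn_leq -{2}rs rlt andbT leqNgt; apply/negP => gt.
  have [s1 ss1 le1] := interpolation vs vs' le rlt; have v1 := step_valid vs ss1.
  have [N1 sN1] := state_module_exists dp v1; apply: nint; exists N1.
  have r1 := rank_step vs ss1; split; first exact: topdeg_of_state sN1.
    by apply/(deg_lt_rank vs v1 sX sN1); rewrite r1; split=> //; exact: step_le.
  by apply/(deg_lt_rank v1 vs' sN1 sX'); rewrite r1 rs.
have [s [vs sX rs]] := st k (leqnn k); exists s; split=> //.
apply: NNPP => /(nonfinal_step vs surj)[s' ss']; have vs' := step_valid vs ss'.
have [N sN] := state_module_exists dp vs'; apply: Xmax; exists N.
split; first exact: topdeg_of_state sN.
apply/(deg_lt_rank vs vs' sX sN); rewrite (rank_step vs ss').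
by split=> //; exact: step_le.
Qed.

(** Interpolation yields a chain of states from the start to s in which the rank
    increases by one in each step; the degenerations of M are those of states, so the
    chain cannot be refined. *)
Lemma final_chain s : valid s -> final s -> saturated_chain_length a M (rank s).
Proof.
move=> vs fs.
have [f [f0 Hf Hs]] : exists f : nat -> state, [/\ f 0%N = start,
    forall i, (i <= rank s)%N -> [/\ valid (f i), state_le (f i) s & rank (f i) = i]
    & forall i, (i < rank s)%N -> state_le (f i) (f i.+1)].
  elim: {-2}(rank s) (leqnn (rank s)) => [_|k IH ltk].
    exists (fun=> start); split=> // i; rewrite leqn0 => /eqP ->.
    by split; [exact: valid_start | exact: start_le | exact: rank_start].
  have [f [f0 Hf Hs]] := IH (ltnW ltk); have [vk lek rk] := Hf k (leqnn k).
  have [|s1 ss1 le1] := interpolation vk vs lek; first by rewrite rk.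
  exists (fun i => if (i <= k)%N then f i else s1); split=> // i.
    rewrite leq_eqVlt ltnS => /orP[/eqP ->|ik]; last by rewrite ik; exact: Hf.
    rewrite ltnn; split=> //; first exact: step_valid ss1.
    by rewrite (rank_step vk ss1) rk.
  rewrite ltnS => ik; rewrite ik; case: (ltnP i k) => [lt|ge]; first exact: Hs.
  have -> : i = k by apply/eqP; rewrite eqn_leq ik.
  exact: step_le.
have /fin_all_exists[X0 HX0] (i : 'I_(rank s).+1) : exists N, state_module (f i) N.
  by have [v _ _] := Hf i (ltn_ord i); exact: (state_module_exists dp v).
pose X (i : nat) := X0 (inord i).
have HX i : (i <= rank s)%N -> state_module (f i) (X i).
  by move=> le; have := HX0 (inord i); rewrite inordK.
exists X; split.
- by apply: (quotient_unique stM); have := HX 0%N isT; rewrite f0.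
- by move=> i le; have [v _ _] := Hf i le; exact: topdeg_of_state (HX i le).
- move=> i lt; have [v _ rv] := Hf i (ltnW lt); have [v' _ rv'] := Hf i.+1 lt.
  have sX := HX i (ltnW lt); have sX' := HX i.+1 lt; split.
    by apply/(deg_lt_rank v v' sX sX'); rewrite rv rv'; split=> //; exact: Hs.
  move=> [N [tN lt1 lt2]]; have [s1 v1 sN] := topdeg_state tN.
  have [_] := (deg_lt_rank v v1 sX sN).1 lt1; have [_] := (deg_lt_rank v1 v' sN sX').1 lt2.
  by rewrite rv rv' ltnS => h1 h2; have := leq_trans h2 h1; rewrite ltnn.
move=> [N [tN lt]]; have [s1 v1 sN] := topdeg_state tN.
have [v le rv] := Hf (rank s) (leqnn _).
have [le1] := (deg_lt_rank v v1 (HX _ (leqnn _)) sN).1 lt.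
have [mE aE] := state_rigid v vs le (eq_leq (esym rv)).
have ff : final (f (rank s)) by case: fs => m1 a1; split=> x; rewrite ?mE ?aE.
by rewrite ltnNge (final_max v v1 ff le1).
Qed.

(** The excess over |A| is the number of elements of B at which the direction vanishes
    at the end of the chain; since B contains no block, the direction may vanish on
    any subset of B. *)
Lemma chain_lengths k : (forall i, exists2 j, bl j = i & ~~ B j) ->
  saturated_chain_length a M k <-> (#|A| <= k <= #|A| + #|{: {j | B j}}|)%N.
Proof.
move=> ne; split=> [ch|/andP[ge le]].
  have [|s [vs fs ->]] := chain_final _ ch; first by move=> i; have [j] := ne i; exists j.
  rewrite final_rank // leq_addr leq_add2l -sum1_card leq_sum // => b _.
  by case: (_ == _).
have [S SB cS] : exists2 S : {set {j | B j}}, true & #|S| = (k - #|A|)%N.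
  have : (k - #|A| <= #|[set: {j | B j}]|)%N by rewrite cardsT leq_subLR.
  case/card_geqP => u [uu su _]; exists [set x in u] => //.
  by rewrite cardsE (card_uniqP uu).
pose t j : K := if insub j is Some b then (b \notin S)%:R else 1.
pose s : state := State (fun=> true) t (fun=> true).
have vs : valid s.
  split=> // i _; have [j ji nj] := ne i; exists j => //=.
  by rewrite /t insubF ?oner_neq0 //; apply/negbTE.
have fs : final s by [].
rewrite (_ : k = rank s); first exact: final_chain.
rewrite final_rank // -(subnKC ge) -cS -sum1_card big_mkcond; congr (_ + _)%N.
apply: eq_bigr => b _; rewrite /= /t valK; case: (b \in S) => /=; first by rewrite eqxx.
by rewrite oner_eq0.
Qed.

End Modules.
End Poset.

(** * Pluecker coordinates *)

Section Pluecker.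
Context (K : fieldType) (q p : nat).
Implicit Types (D : Gr K q p) (u : 'I_q -> 'cV[K]_p) (h : {ffun 'I_q -> 'I_p}).

Definition pl u h : K := \det (\matrix_(i < q, j < q) u i (h j) 0).

Lemma det_pl u h : \det (\matrix_(i < q, j < q) u j (h i) 0) = pl u h.
Proof. by rewrite -det_tr; congr (\det _); apply/matrixP => i j; rewrite !mxE. Qed.

(** The scalar is the determinant of the change of basis. *)
Lemma rep_scaled D (b : q.-tuple 'cV[K]_p) v : basis_of (val D) b ->
  represents D v -> exists2 m : K, m != 0 & forall h, v h = m * pl (tnth b) h.
Proof.
move=> bD [b' [b'D vE]].
have sub : (rows (tnth b') <= rows (tnth b))%MS.
  apply/row_subP => i; have := basis_mem b'D (mem_tnth i b').
  rewrite -(span_basis bD) mem_span_cols; congr (_ <= _)%MS.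
  by apply/rowP => j; rewrite !mxE.
have [X XE] := submxP sub.
exists (\det X).
  rewrite -unitfE -unitmxE -row_free_unit /row_free eqn_leq rank_leq_row /=.
  by have := mxrankM_maxl X (rows (tnth b)); rewrite -XE (eqP (basis_rows_free b'D)).
move=> h; rewrite vE det_pl /pl -det_mulmx; congr (\det _); apply/matrixP => i j.
rewrite !mxE; have /matrixP/(_ i (h j)) := XE; rewrite !mxE => E; apply: etrans E _.
by apply: eq_bigr => k _; rewrite !mxE.
Qed.

Lemma rep_basis D (b : q.-tuple 'cV[K]_p) : basis_of (val D) b ->
  represents D (pl (tnth b)).
Proof. by move=> bD; exists b; split=> // h; rewrite det_pl. Qed.

Lemma rep_scale D v (m : K) : (0 < q)%N -> m != 0 -> represents D v ->
  represents D (fun h => m * v h).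
Proof.
move=> q0 m0 [b [bD vE]]; pose i0 := Ordinal q0.
pose c (i : 'I_q) := if i == i0 then m else 1.
have c0 i : c i != 0 by rewrite /c; case: ifP => // _; exact: oner_neq0.
pose b' := [tuple c i *: tnth b i | i < q].
exists b'; split.
  rewrite basisEdim size_tuple (eqP (valP D)) leqnn andbT.
  apply/subvP => w wD; have := wD; rewrite -(span_basis bD) => /coord_span ->.
  apply: memv_suml => i _; rewrite -[b`_i]scale1r -(mulVf (c0 i)) -scalerA.
  do 2!apply: memvZ; apply: memv_span; rewrite -tnth_nth.
  by apply/tnthP; exists i; rewrite tnth_mktuple.
move=> h; rewrite vE !det_pl /pl -[X in X * _](_ : \det (diag_mx (\row_i c i)) = m).
  rewrite -det_mulmx; congr (\det _); rewrite mul_diag_mx; apply/matrixP => i j.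
  by rewrite !mxE tnth_mktuple !mxE.
rewrite det_diag (bigD1 i0) //= mxE /c eqxx big1 ?mulr1 // => i /negPf ne.
by rewrite mxE ne.
Qed.

Lemma Gr_homogeneous : (0 < q)%N -> homogeneous (Gr K q p).
Proof.
move=> q0 D v w [b [bD vE]] rw; have [m m0 wE] := rep_scaled bD rw.
exists (fun=> m) => [h|E u ru]; first by rewrite wE vE det_pl.
exact: rep_scale.
Qed.

Lemma rep_neq0 D v : represents D v -> exists h, v h != 0.
Proof.
move=> [b [bD vE]]; have rf := basis_rows_free bD.
have full : row_full (rows (tnth b))^T by rewrite /row_full mxrank_tr.
exists [ffun j => fullrankfun full j]; rewrite vE det_pl -unitfE -unitmxE.
rewrite -unitmx_tr -row_free_unit /row_free -[X in _ == X](mxrank_fullrowsub full).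
apply/eqP; congr (\rank _); apply/matrixP => i j; by rewrite !mxE ffunE.
Qed.

Definition plc D : {ffun 'I_q -> 'I_p} -> K :=
  pl (fun i => (vbasis (val D))`_i).

Lemma plcP D : represents D (plc D).
Proof.
have sz : size (vbasis (val D)) == q by rewrite size_tuple (valP D).
exists (Tuple sz); split; first by rewrite /= vbasisP.
by move=> h; rewrite det_pl /plc /pl; congr (\det _); apply/matrixP => i j; rewrite !mxE (tnth_nth 0).
Qed.

End Pluecker.

Section LinePoints.
Context (K : fieldType) (J T : finType) (R : T -> pred J).
Local Notation L := (alg K R).
Local Notation ev := (ev K R).
Local Notation ar := (ar K R).
Local Notation p := #|{: ppath R}|.
Local Notation P := (pmod K R).
Context (q : nat) (hq : q = #|T|).
Local Notation Gr := (Gr K q p).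
Implicit Types (u : T -> L) (k : T).

Definition kt (i : 'I_q) : T := enum_val (cast_ord hq i).

Lemma kt_inj : injective kt.
Proof. by move=> i j /enum_val_inj/cast_ord_inj. Qed.

Lemma kt_surj k : exists i, kt i = k.
Proof.
by exists (cast_ord (esym hq) (enum_rank k)); rewrite /kt cast_ordKV enum_rankK.
Qed.

Definition line_point u (hu : lines u) : Gr :=
  exist _ (line_span u) (introT eqP (etrans (dim_line_span hu) (esym hq))).

Definition line_tuple u : q.-tuple 'cV[K]_p := [tuple pvec (u (kt i)) | i < q].

Lemma line_tuple_basis u : lines u -> basis_of (line_span u) (line_tuple u).
Proof.
move=> hu; rewrite basisEdim size_tuple dim_line_span //; apply/andP; split; last exact: eq_leq hq.
apply/subvP => v /line_spanP[c ->]; apply: memv_suml => k _; apply: memvZ.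
have [i <-] := kt_surj k; apply: memv_span; apply/tnthP; exists i.
by rewrite tnth_mktuple.
Qed.

Definition line_pl u (h : {ffun 'I_q -> 'I_p}) : K :=
  \det (\matrix_(i < q, j < q) cf (u (kt i)) (inl (enum_val (h j)))).

Lemma line_plE u h : pl (tnth (line_tuple u)) h = line_pl u h.
Proof. by congr (\det _); apply/matrixP => i j; rewrite !mxE tnth_mktuple mxE. Qed.

Lemma line_rep (D : Gr) u v : lines u -> val D = line_span u ->
  represents D v -> exists2 m : K, m != 0 & forall h, v h = m * line_pl u h.
Proof.
move=> hu Du rv; have [|m m0 vE] := rep_scaled (b := line_tuple u) _ rv.
  by rewrite Du; exact: line_tuple_basis.
by exists m => // h; rewrite vE line_plE.
Qed.

Lemma line_pl_rep (D : Gr) u : lines u -> val D = line_span u -> represents D (line_pl u).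
Proof.
move=> hu Du; have bD : basis_of (val D) (line_tuple u).
  by rewrite Du; exact: line_tuple_basis.
have [b [bb E]] := rep_basis bD; exists b; split=> // h.
by rewrite -E line_plE.
Qed.

Lemma cf_lines u k (y : ppath R) : lines u -> (val y).1 != Some k ->
  cf (u k) (inl y) = 0.
Proof.
move=> [uk _]; rewrite -uk cfM /mul_cf.
case: y => -[[k'|] [j|]] v /= ne; rewrite !cf_ev /= ?mul0r ?add0r // eq_sink;
  by have -> : (k' == k) = false; [apply: contraNF ne => /eqP -> | rewrite mul0r].
Qed.

Definition one_per_sink (y : T -> ppath R) : {ffun 'I_q -> 'I_p} :=
  [ffun i => enum_rank (y (kt i))].

(** The minor for one coordinate at each sink is that of a diagonal matrix. *)
Lemma line_pl_one_per_sink u y : lines u -> (forall k, (val (y k)).1 = Some k) ->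
  line_pl u (one_per_sink y) = \prod_k cf (u k) (inl (y k)).
Proof.
move=> hu yk; rewrite /line_pl.
have -> : \matrix_(i < q, j < q) cf (u (kt i)) (inl (enum_val (one_per_sink y j)))
        = diag_mx (\row_i cf (u (kt i)) (inl (y (kt i)))).
  apply/matrixP => i j; rewrite !mxE ffunE enum_rankK; have [->|ne] := eqVneq i j.
    by rewrite mulr1n.
  rewrite mulr0n cf_lines // yk; apply: contra_neq ne => -[/kt_inj ->] //.
rewrite det_diag (reindex kt) /=; first by apply: eq_bigr => i _; rewrite mxE.
apply: onW_bij; apply: inj_card_bij; first exact: kt_inj.
by rewrite card_ord hq.
Qed.

Lemma fa_line_pl (X : Type) (S : (X -> K) -> Prop) (alg : function_algebra S)
    (c : T -> X -> K) (t : T -> X -> J -> K) h :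
  (forall k, S (c k)) -> (forall k j, S (fun x => t k x j)) ->
  S (fun x => line_pl (fun k => line R k (c k x) (t k x)) h).
Proof.
move=> cS tS; apply: (fa_det alg) => i j; case: (enum_val (h j)) => -[[k|] [j'|]] w.
- apply: (fa_ext alg) (fa_mul alg (fa_const alg (kt i == k)%:R) (tS (kt i) j')) => x.
  by rewrite -[exist _ _ _]/(plen w) cf_line_len.
- apply: (fa_ext alg) (fa_mul alg (fa_const alg (kt i == k)%:R) (cS (kt i))) => x.
  have -> : exist _ (Some k, None) w = parr R k by apply: val_inj.
  by rewrite cf_line_arr.
- by apply: (fa_ext alg) (fa_const alg 0) => x; rewrite cf_line_out.
- by apply: (fa_ext alg) (fa_const alg 0) => x; rewrite cf_line_out.
Qed.

Lemma line_pl_avoid u k (h : {ffun 'I_q -> 'I_p}) : lines u ->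
  (forall j, (val (enum_val (h j))).1 != Some k) -> line_pl u h = 0.
Proof.
move=> hu hk; have [i ik] := kt_surj k; rewrite /line_pl (expand_det_row _ i).
by apply: big1 => j _; rewrite mxE ik cf_lines // mul0r.
Qed.

Lemma img_line_span u u' (c : T -> K) (g : 'M[K]_p) : (forall k, c k != 0) ->
  (forall k, g *m pvec (u k) = c k *: pvec (u' k)) ->
  (linfun (mulmx g : 'cV[K]_p -> 'cV[K]_p) @: line_span u)%VS = line_span u'.
Proof.
move=> c0 gu; apply/vspaceP => v; apply/memv_imgP/idP => [[w /line_spanP[b ->] ->]|].
  rewrite lfunE /= mulmx_sumr; apply/line_spanP; exists (fun k => b k * c k).
  by apply: eq_bigr => k _; rewrite -scalemxAr gu scalerA.
move=> /line_spanP[b ->]; exists (\sum_k (b k / c k) *: pvec (u k)).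
  by apply/line_spanP; exists (fun k => b k / c k).
rewrite lfunE /= mulmx_sumr; apply: eq_bigr => k _.
by rewrite -scalemxAr gu scalerA divfK.
Qed.

(** ** The orbit of the submodule spanned by the arrows *)

Definition orbit_lines (s : J -> K) k : L := line R k 1 s.

Lemma orbit_lines_lines s : lines (orbit_lines s).
Proof. by apply: lines_family => k; left; exact: oner_neq0. Qed.

Definition arrow_point : Gr := line_point (orbit_lines_lines (fun=> 0)).

(** The scalar c in an automorphism e1 |-> c e1 + sum s_j w_j only changes the
    parameters to s_j / c. *)
Lemma aut_orbitP (D : Gr) : aut_orbit P arrow_point D <->
  exists s, val D = line_span (orbit_lines s).
Proof.
split=> [[g [ug hg DE]]|[s DE]].
  have [c [s [c0 gE]]] := aut_loop_part hg ug; exists (fun j => s j / c).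
  rewrite DE; apply: (img_line_span (c := fun=> c)) => // k.
  rewrite gE line_loop_part -linearZ /= line_scale; congr pvec.
  apply: eq_line => [|j _]; first by rewrite mul1r mulr1.
  by rewrite mul0r mul1r add0r mulrC divfK.
have [g hg [ug gE]] := loop_aut R s; exists g; split=> //.
rewrite DE; apply/esym/(img_line_span (c := fun=> 1)) => [k|k]; first exact: oner_neq0.
rewrite gE line_loop_part scale1r; congr pvec.
by apply: eq_line => [|j _]; rewrite ?mulr1 // mul1r add0r.
Qed.

End LinePoints.

Section OrbitDimension.
Context (K : closedFieldType) (J T : finType) (R : T -> pred J).
Local Notation p := #|{: ppath R}|.
Local Notation P := (pmod K R).
Context (q : nat) (hq : q = #|T|) (q_gt0 : (0 < q)%N).
Context (kk : J -> T) (Rkk : forall j, R (kk j) j).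
Local Notation Gr := (Gr K q p).

Definition ypiv j k : ppath R := insubd (parr R k) (Some k, if k == kk j then Some j else None).

Lemma ypivE j k : val (ypiv j k) = (Some k, if k == kk j then Some j else None).
Proof.
by rewrite val_insubd /=; case: eqP => [->|_] /=; rewrite ?Rkk.
Qed.

Lemma line_pl_arrows s : line_pl hq (orbit_lines R s) (one_per_sink hq (parr R)) = 1 :> K.
Proof.
rewrite line_pl_one_per_sink //; last exact: orbit_lines_lines.
by rewrite big1 // => k _; rewrite cf_line_arr eqxx mulr1.
Qed.

Lemma line_pl_pivot s j : line_pl hq (orbit_lines R s) (one_per_sink hq (ypiv j)) = s j :> K.
Proof.
rewrite line_pl_one_per_sink; last by move=> k; rewrite ypivE.
  rewrite (bigD1 (kk j)) //= big1 ?mulr1 => [|k /negPf ne].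
    have -> : ypiv j (kk j) = plen (Rkk j) by apply: val_inj; rewrite ypivE eqxx.
    by rewrite cf_line_len eqxx mul1r.
  have -> : ypiv j k = parr R k by apply: val_inj; rewrite ypivE ne.
  by rewrite cf_line_arr eqxx mulr1.
exact: orbit_lines_lines.
Qed.

(** The orbit is an affine space: the coordinates s_j are quotients of two
    Pluecker coordinates. *)
Lemma orbit_affine :
  isomorphic_varieties (aut_orbit P (arrow_point K R hq)) (fun _ : affine_space K J => True).
Proof.
pose h0 := one_per_sink hq (parr R); pose hj j := one_per_sink hq (ypiv j).
pose f (D : Gr) : affine_space K J := fun j => plc D (hj j) / plc D h0.
pose g (s : affine_space K J) : Gr := line_point hq (orbit_lines_lines R s).
have ratio (D : Gr) s v j : val D = line_span (orbit_lines R s) -> represents D v ->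
    v h0 != 0 /\ v (hj j) / v h0 = s j.
  move=> Ds rv; have [m m0 vE] := line_rep hq (orbit_lines_lines R s) Ds rv.
  by rewrite !vE line_pl_arrows line_pl_pivot mulr1 mulrC mulKf.
have fE (D : Gr) s j : val D = line_span (orbit_lines R s) -> f D j = s j.
  by move=> Ds; have [] := ratio D s _ j Ds (plcP D).
have pa h := @poly_in_function K Gr _ (poly_function_coord K h).
exists f, g; split=> //.
- apply: lift_morphism => // [D /aut_orbitP[s Ds]|]; last exact: affine_homogeneous.
  have [F0 F0E] := pa h0; have /fin_all_exists[G GE] j := pa (hj j).
  exists F0, G, (plc D); split; first exact: plcP.
    have [j0|nj] := pickP (fun _ : J => true).
      by rewrite F0E; have [] := ratio D s _ j0 Ds (plcP D).
    have [m m0 vE] := line_rep hq (orbit_lines_lines R s) Ds (plcP D).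
    by rewrite F0E vE line_pl_arrows mulr1.
  move=> E v /aut_orbitP[s' Es'] rv Fv j; rewrite F0E GE.
  by have [_ ->] := ratio E s' v j Es' rv; rewrite (fE _ _ _ Es').
- apply: lift_morphism; last first.
  + by move=> s _; apply/aut_orbitP; exists s.
  + exact: Gr_homogeneous.
  have alg := poly_function_algebra K J.
  apply: (@polynomial_lift _ (affine_space K J) Gr _ _
    (fun h v => line_pl hq (orbit_lines R v) h)) => [s _|h|s v _ rv].
  + by exists s.
  + apply: (fa_line_pl hq alg (c := fun _ _ => 1) (t := fun _ v => v)) => [k|k j].
      exact: (fa_const alg).
    exact: poly_function_coord.
  rewrite (_ : v = s); first exact: line_pl_rep (orbit_lines_lines R s) _.
  by apply: functional_extensionality => j; exact: rv.
- move=> D /aut_orbitP[s Ds]; apply: val_inj; rewrite /= Ds; congr (<<_>>%VS).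
  apply: eq_map => k; congr pvec; apply: eq_line => // j _; exact: fE.
- by move=> s _; apply: functional_extensionality_dep => j; exact: fE.
Qed.

End OrbitDimension.

(** * Maximal degenerations *)

Section FixedPoints.
Context (K : fieldType) (J T : finType) (R : T -> pred J).
Local Notation L := (alg K R).
Local Notation ev := (ev K R).
Local Notation p := #|{: ppath R}|.
Local Notation P := (pmod K R).
Context (q : nat) (hq : q = #|T|) (Rne : forall k, exists j, R k j).
Local Notation Gr := (Gr K q p).

Definition top_lines (t : T -> J -> K) k : alg K R := line R k 0 (t k).

Lemma top_lines_lines t : (forall k, exists2 j, R k j & t k j != 0) -> lines (top_lines t).
Proof. by move=> H; apply: lines_family => k; right. Qed.

(** Loops annihilate the paths of length two, so automorphisms act on them by
    scalars. *)
Lemma top_lines_fixed (D D' : Gr) t : val D = line_span (top_lines t) ->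
  aut_orbit P D D' -> D' = D.
Proof.
move=> Dt [g [ug hg DE]]; apply: val_inj.
have [c [s [c0 gE]]] := aut_loop_part hg ug.
rewrite DE Dt; apply: (img_line_span (c := fun=> c)) => // k.
rewrite gE line_loop_part -linearZ /= line_scale; congr pvec.
by apply: eq_line => [|j _]; rewrite ?mul0r ?mulr0 // addr0 mulrC.
Qed.

(** Otherwise a nonzero Pluecker coordinate of D avoids the paths to the sink k, but
    such coordinates vanish on the orbit. *)
Lemma closure_meets_block (D : Gr) k :
  zclosure (aut_orbit P (arrow_point K R hq)) D ->
  exists2 v, v \in val D & P (ev k) *m v != 0.
Proof.
move=> clD; apply: NNPP => H.
have Dk v : v \in val D -> P (ev k) *m v = 0.
  by move=> vD; apply/eqP; apply: contra_notT H => ne; exists v.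
have rD := plcP D; have [h hD] := rep_neq0 rD.
have avoid j : (val (enum_val (h j))).1 != Some k.
  apply: contra hD => /eqP hk; have [b [bD bE]] := rD.
  rewrite bE det_pl /pl (expand_det_col _ j) big1 // => i _; rewrite mxE.
  have [x xE] := pvecW (tnth b i).
  have /Dk : tnth b i \in val D by apply: (basis_mem bD); exact: mem_tnth.
  rewrite xE pmodE => /colP/(_ (h j)); rewrite !mxE cfM /mul_cf.
  case: (enum_val (h j)) hk => -[[k'|] [j'|]] w //= [ek]; (have ekb : (k' == k) = true by apply/eqP);
    rewrite !cf_ev eq_sink ekb /=.
    by rewrite !mul0r !add0r mul1r => ->; rewrite mul0r.
  rewrite mul0r add0r mul1r (_ : exist _ _ _ = parr R k'); last exact: val_inj.
  by move=> ->; rewrite mul0r.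
have [F FE] := @poly_function_coord K {ffun 'I_q -> 'I_p} h.
have : plc D h = 0.
  have := clD F _ _ rD; rewrite /peval -FE; apply => y /aut_orbitP[s ys] v rv.
  have [m _ vE] := line_rep hq (orbit_lines_lines R s) ys rv.
  by rewrite /peval -FE vE (line_pl_avoid _ (k := k)) ?mulr0 //; exact: orbit_lines_lines.
by apply/eqP.
Qed.

(** A submodule in the closure of the orbit is a sum of lines, one for each sink,
    and if it is fixed then its lines lie in the span of the paths of length two:
    otherwise the automorphism for a loop moves it. *)
Lemma max_topdeg_top_lines (D : Gr) : max_topdeg P (arrow_point K R hq) D ->
  exists t, (forall k, exists2 j, R k j & t k j != 0) /\ val D = line_span (top_lines t).
Proof.
move=> [[sD _] clD fixD].
have /fin_all_exists[ct Hct] k : exists ct : K * (J -> K),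
    pvec (line R k ct.1 ct.2) != 0 /\ pvec (line R k ct.1 ct.2) \in val D.
  have [v vD v0] := closure_meets_block k clD; have [x xE] := pvecW v.
  have [c [t E]] := ev_corner k x; exists (c, t) => /=.
  have -> : pvec (line R k c t) = P (ev k) *m v by rewrite xE pmodE -[pvec (_ * x)]pvec_e1 E.
  by split=> //; exact: sD.
pose u k := line R k (ct k).1 (ct k).2.
have hu : lines u.
  by split=> k; [rewrite ev_line eqxx scale1r | have [] := Hct k].
have Du : val D = line_span u.
  apply/esym/eqP; rewrite eqEdim (eqP (valP D)) dim_line_span // (eq_leq hq) andbT.
  by apply/subvP => v /line_spanP[c ->]; apply: memv_suml => k _; apply: memvZ; have [] := Hct k.
have c0 k : (ct k).1 = 0.
  apply/eqP; apply: contraT => ck; have [j0 Rj0] := Rne k.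
  pose s j : K := (j == j0)%:R.
  have [g hg [ug gE]] := loop_aut R s.
  pose gD := (linfun (mulmx g : 'cV[K]_p -> 'cV[K]_p) @: val D)%VS.
  have dgD : \dim gD == q.
    rewrite -[X in _ == X](eqP (valP D)); apply/eqP/limg_dim_eq.
    apply/eqP; rewrite -subv0; apply/subvP => v; rewrite memv_cap memv_ker lfunE /=.
    by case/andP=> _ /eqP gv; rewrite memv0 -[v](mulKmx ug) gv mulmx0.
  have gDD : gD = val D.
    have <- // : (exist _ gD dgD : Gr) = D.
    by apply: fixD; exists g.
  have mem1 : pvec (line R k (ct k).1 (ct k).2 * loop_part R 1 s) \in val D.
    rewrite -gE -gDD; have [_ m] := Hct k.
    by rewrite -[g *m _]/(mulmx g _) -(lfunE (mulmx g)) memv_img.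
  have mem2 : pvec (line R k 0 (fun j => (ct k).1 * s j)) \in line_span u.
    rewrite -Du (_ : line _ _ _ _ = line R k (ct k).1 (ct k).2 * loop_part R 1 s
      + (-1) *: line R k (ct k).1 (ct k).2).
      by rewrite linearD linearZ /=; apply: memvD => //; apply: memvZ; have [] := Hct k.
    rewrite line_loop_part line_scale line_add; apply: eq_line => [|j _].
      by rewrite mulr1 mulN1r subrr.
    by rewrite mulr1 mulN1r addrAC subrr add0r.
  have [|d] := lines_memE (k := k) hu _ mem2; first by rewrite ev_line eqxx scale1r.
  rewrite -linearZ /= line_scale => /pvec_line_inj[/esym/eqP + E].
  rewrite mulf_eq0 (negPf ck) orbF => /eqP d0; have := E j0 Rj0.
  by rewrite d0 mul0r /s eqxx mulr1 => /eqP; rewrite (negPf ck).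
exists (fun k => (ct k).2); split=> [k|].
  apply: NNPP => H; have [/eqP ne _] := Hct k; apply: ne; rewrite c0.
  rewrite (_ : line _ _ _ _ = 0) ?linear0 // -[RHS](line0 K R k).
  by apply: eq_line => // j Rj; apply/eqP; apply: contra_notT H => tj; exists j.
rewrite Du; congr (<<_>>%VS); apply: eq_map => k.
by rewrite /u c0.
Qed.

End FixedPoints.

Section MaximalPoints.
Context (K : closedFieldType) (J A : finType) (bl : J -> A) (B : pred J).
Local Notation T := (sink A B).
Local Notation R := (@incidence J A bl B).
Local Notation p := #|{: ppath R}|.
Local Notation P := (pmod K R).
Context (q : nat) (hq : q = #|{: T}|) (q_gt0 : (0 < q)%N).
Context (bl_surj : forall i, exists j, bl j = i).
Local Notation Gr := (Gr K q p).
Local Notation C := (arrow_point K R hq).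

Lemma incidence_nonempty k : exists j, R k j.
Proof.
case: k => [i|b] /=; last by exists (val b); rewrite eqxx.
by have [j <-] := bl_surj i; exists j; rewrite eqxx.
Qed.

(** At the sink of b in B the line of g_b w_b is the only one of its kind, whatever the
    component of t at b. *)
Definition block_lines (t : J -> K) : T -> alg K R :=
  top_lines R (fun k : T => match k with inl _ => t | inr _ => fun=> 1 end).

Definition nonzero_on_blocks (t : J -> K) : Prop :=
  forall i, exists2 j, bl j = i & t j != 0.

Lemma block_lines_lines t : nonzero_on_blocks t -> lines (block_lines t).
Proof.
move=> t0; apply: top_lines_lines => -[i|b] /=.
  by have [j <- tj] := t0 i; exists j.
by exists (val b); rewrite ?oner_neq0.
Qed.

(** The submodule for t is the limit tau -> 0 of the submodules of the orbit with
    parameters (t_j + tau [t_j = 0]) / tau^2.  The correction by tau makes all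
    parameters tend to infinity, so that the lines for b in B have the limit
    g_b w_b even when t_b = 0. *)
Lemma block_lines_closure (D : Gr) t : nonzero_on_blocks t ->
  val D = line_span (block_lines t) -> zclosure (aut_orbit P C) D.
Proof.
move=> t0 Dt F FC v rv.
have [m m0 vE] := line_rep hq (block_lines_lines t0) Dt rv.
(* The factors cc k tau make the lines of the orbit a family that extends to tau = 0. *)
pose cc (k : T) (tau : K) : K := match k with inl _ => tau ^+ 2
  | inr b => if t (val b) == 0 then tau else tau ^+ 2 / t (val b) end.
pose tt (k : T) (tau : K) j : K := match k with
  inl _ => t j + tau * (t j == 0)%:R | inr _ => 1 end.
pose u tau k : alg K R := line R k (cc k tau) (tt k tau).
have hu tau : lines (u tau).
  apply: (lines_family (c := cc^~ tau) (t := fun k => tt k tau)) => -[i|b] /=; last first.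
    by right; exists (val b); rewrite ?oner_neq0.
  have [->|tau0] := eqVneq tau 0; last by left; rewrite expf_neq0.
  right; have [j <- tj] := t0 i; exists j => //.
  by rewrite mul0r addr0.
have u0 k : u 0 k = block_lines t k.
  case: k => [i|b]; apply: eq_line => [|j _] //=.
  - by rewrite expr0n.
  - by rewrite mul0r addr0.
  - by case: eqP; rewrite ?expr0n ?mul0r.
pose val0 tau := peval (X := Gr) F (fun h => m * line_pl hq (u tau) h).
have -> : peval F v = val0 0.
  apply: peval_ext => h; rewrite vE; congr (_ * \det _).
  by apply/matrixP => i j; rewrite !mxE u0.
apply: (curve_function_eq0 (f := val0)) => [|tau tau0].
  have alg := curve_function_algebra K.
  apply: (fa_meval alg F (f := fun k tau => m * line_pl hq (u tau) (enum_val k))) => k.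
  apply: (fa_mul alg); first exact: (fa_const alg).
  have ccc k' : curve_function (cc k').
    rewrite /cc; case: k' => [i|b]; first exact: (fa_exp alg 2 (curve_function_id K)).
    case: (t (val b) == 0); first exact: curve_function_id.
    by apply: (fa_mul alg (fa_exp alg 2 (curve_function_id K))); apply: (fa_const alg).
  have ttc k' j : curve_function (fun tau => tt k' tau j).
    rewrite /tt; case: k' => [i|b]; last exact: (fa_const alg).
    apply: (fa_add alg); first exact: (fa_const alg).
    by apply: (fa_mul alg (curve_function_id K)); apply: (fa_const alg).
  exact: (fa_line_pl hq alg (c := cc) (t := tt)).
pose z j := (t j + tau * (t j == 0)%:R) / tau ^+ 2.
have tau2 : tau ^+ 2 != 0 by rewrite expf_neq0.
have spanE : val (line_point hq (hu tau)) = line_span (orbit_lines R z).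
  apply: (line_span_scale (c := cc^~ tau)) => [[i|b] /=|k].
  - by [].
  - by case: ifP => // /negbT tb; rewrite mulf_neq0 ?invr_neq0.
  rewrite line_scale; apply: eq_line => [|j Rj]; first by rewrite mulr1.
  case: k Rj => [i|b] /= Rj; first by rewrite /z [RHS]mulrC divfK.
  rewrite /z -(eqP Rj); case: ifP => [/eqP->|/negbT tb].
    by rewrite mulr1 add0r mulrA -expr2 divff.
  by rewrite mulr0 addr0 mulrA divfK // divff.
apply: (FC (line_point hq (hu tau))); first by apply/aut_orbitP; exists z.
apply: rep_scale => //; exact: line_pl_rep.
Qed.

(** The lines in [max_topdeg_top_lines] at the sinks of elements of B carry no
    information, so the vectors for the blocks remain. *)
Lemma max_topdegP (D : Gr) : max_topdeg P C D <->
  exists t, nonzero_on_blocks t /\ val D = line_span (block_lines t).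
Proof.
split=> [/(max_topdeg_top_lines incidence_nonempty)[t [t0 Dt]]|[t [t0 Dt]]].
  exists (fun j => t (inl (bl j)) j); split.
    by move=> i; have [j /eqP bj tj] := t0 (inl i); exists j; rewrite ?bj.
  rewrite Dt; pose c (k : T) := match k with inl _ => 1 | inr b => t (inr b) (val b) end.
  apply: (line_span_scale (c := c)) => [[i|b]|k] /=; first exact: oner_neq0.
    by have [j /eqP -> tj] := t0 (inr b).
  rewrite line_scale; apply: eq_line => [|j Rj]; first by rewrite mulr0.
  case: k Rj => [i|b] /= /eqP <-; first by rewrite mul1r.
  by rewrite mulr1.
have hl := block_lines_lines t0; split.
- rewrite /in_Grass Dt; split; first exact: line_span_submodule.
  by move=> v; apply: rad_line_span.
- exact: block_lines_closure Dt.
- by move=> D'; apply: top_lines_fixed Dt.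
Qed.

End MaximalPoints.

(** * Products of projective spaces *)

Section ProjectiveLines.
Context (K : fieldType).

Lemma vline_scale m (v w : 'rV[K]_m) : <[v]>%VS = <[w]>%VS -> v != 0 ->
  exists2 c, c != 0 & w = c *: v.
Proof.
move=> E v0; have /vlineP[c wE] : w \in <[v]>%VS by rewrite E memv_line.
exists c => //; apply: contra_neq v0 => c0.
have /vlineP[b ->] : v \in <[w]>%VS by rewrite -E memv_line.
by rewrite wE c0 scale0r scaler0.
Qed.

Lemma vline_scaled m (v : 'rV[K]_m) c : c != 0 -> <[c *: v]>%VS = <[v]>%VS.
Proof.
move=> c0; apply/eqP; rewrite eqEsubv -!memvE; apply/andP; split.
  by apply: memvZ; exact: memv_line.
by apply/vlineP; exists c^-1; rewrite scalerA mulVf // scale1r.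
Qed.

Lemma default_point_dim m : \dim <[(const_mx 1)%R : 'rV[K]_m.+1]>%VS == 1%N.
Proof.
rewrite dim_vline (_ : _ == 0 = false) //; apply/negbTE/eqP => /rowP/(_ 0).
by rewrite !mxE => /eqP; rewrite oner_eq0.
Qed.

Definition proj_point m (U : {vspace 'rV[K]_m.+1}) : Proj_points K m :=
  insubd (exist (fun V : {vspace 'rV[K]_m.+1} => \dim V == 1%N) _ (default_point_dim m)) U.

Lemma val_proj_point m (U : {vspace 'rV[K]_m.+1}) : \dim U = 1%N -> val (proj_point U) = U.
Proof. by move=> dU; rewrite val_insubd dU. Qed.

Context (s : nat) (n : 'I_s -> nat).
Local Notation Tg i j := (Tagged (fun i => 'I_(n i).+1) (j : 'I_(n i).+1)).
Local Notation row_at v i := (\row_(j < (n i).+1) v (Tg i j)).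

Lemma proj_row_neq0 (x : ProdProj K n) v i : represents x v -> row_at v i != 0 :> 'rV[K]__.
Proof.
move=> /(_ i) xE; apply/eqP => v0; have := valP (x i).
by rewrite /= xE v0 dim_vline eqxx.
Qed.

Lemma ProdProj_homogeneous : homogeneous (ProdProj K n).
Proof.
move=> x v w rv rw.
have /fin_all_exists2[c c0 wE] i : exists2 c, c != 0 & row_at w i = c *: row_at v i.
  by apply: vline_scale; [rewrite -rv -rw | exact: proj_row_neq0 rv].
exists (fun y => c (tag y)) => [[i j]|y u ru i].
  by have /rowP/(_ j) := wE i; rewrite !mxE.
rewrite (ru i) -[RHS](vline_scaled _ (c0 i)) -[LHS](vline_scaled _ (c0 i)).
rewrite -[RHS](vline_scaled _ (invr_neq0 (c0 i))) scalerA mulVf // scale1r.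
by congr (<[_]>%VS); apply/rowP => j; rewrite !mxE.
Qed.

End ProjectiveLines.

Section MaxTopdegProjective.
Context (K : closedFieldType) (s : nat) (n : 'I_s -> nat) (m : nat).
Local Notation J := ({i : 'I_s & 'I_(n i).+1} + 'I_m)%type.
Local Notation A := ('I_s + 'I_m)%type.
Local Notation Tg i j := (Tagged (fun i => 'I_(n i).+1) (j : 'I_(n i).+1)).
Local Notation row_at v i := (\row_(j < (n i).+1) v (Tg i j)).

(** The block of i gives the factor P^(n i).  A block with one element gives a point,
    but adds a step to each chain of degenerations. *)
Definition block_of (j : J) : A :=
  match j with inl y => inl (tag y) | inr c => inr c end.

Context (B : pred J).
Local Notation T := (sink A B).
Local Notation R := (@incidence J A block_of B).
Local Notation p := #|{: ppath R}|.
Local Notation P := (pmod K R).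
Context (q : nat) (hq : q = #|{: T}|) (q_gt0 : (0 < q)%N).
Local Notation Gr := (Gr K q p).
Local Notation C := (arrow_point K R hq).
Local Notation block_lines := (@block_lines K J A block_of B).
Local Notation nonzero_on_blocks := (@nonzero_on_blocks K J A block_of).

Lemma block_of_surj i : exists j, block_of j = i.
Proof. by case: i => [i|c]; [exists (inl (Tg i ord0)) | exists (inr c)]. Qed.

(** All nonzero values at an element that is a block by itself give the same point. *)
Definition param (v : {i : 'I_s & 'I_(n i).+1} -> K) (j : J) : K :=
  match j with inl y => v y | inr _ => 1 end.

Lemma param_nonzero v : (forall i, row_at v i != 0) -> nonzero_on_blocks (param v).
Proof.
move=> v0 [i|c]; last by exists (inr c); rewrite ?oner_neq0.
have /rV0Pn[j] := v0 i; rewrite mxE => vj.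
by exists (inl (Tg i j)).
Qed.

Lemma block_lines_scale t t' (c : A -> K) : (forall i, c i != 0) ->
  (forall j, t j = c (block_of j) * t' j) ->
  line_span (block_lines t) = line_span (block_lines t').
Proof.
move=> c0 tE; pose d (k : T) := match k with inl i => c i | inr _ => 1 end.
apply: (line_span_scale (c := d)) => [[i|b]|k] //=; first exact: oner_neq0.
rewrite line_scale; apply: eq_line => [|j]; first by rewrite mulr0.
by case: k => [i|b] /=; rewrite ?mulr1 // => /eqP <-.
Qed.

(** Coordinates, one at each sink, that select a Pluecker coordinate equal to a product
    of the parameters in the blocks. *)
Definition pivot (c : forall i, 'I_(n i).+1) (k : T) : ppath R :=
  match k with
  | inl (inl i) => @plen J T R (inl (inl i)) (inl (Tg i (c i))) (eqxx _)
  | inl (inr d) => @plen J T R (inl (inr d)) (inr d) (eqxx _)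
  | inr b => @plen J T R (inr b) (val b) (eqxx _)
  end.

Definition pivot_value (t : J -> K) (c : forall i, 'I_(n i).+1) (k : T) : K :=
  match k with
  | inl (inl i) => t (inl (Tg i (c i)))
  | inl (inr d) => t (inr d)
  | inr b => 1
  end.

Lemma line_pl_pivots t c : nonzero_on_blocks t ->
  line_pl hq (block_lines t) (one_per_sink hq (pivot c)) = \prod_k pivot_value t c k.
Proof.
move=> t0; rewrite line_pl_one_per_sink; last by case=> [[i|d]|b].
  by apply: eq_bigr => -[[i|d]|b] _; rewrite cf_line_len eqxx mul1r.
exact: block_lines_lines.
Qed.

Lemma pivot_ratio t c i (j : 'I_(n i).+1) : nonzero_on_blocks t ->
  t (inl (Tg i (c i))) * line_pl hq (block_lines t) (one_per_sink hq (pivot (dfwith c j)))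
  = t (inl (Tg i j)) * line_pl hq (block_lines t) (one_per_sink hq (pivot c)).
Proof.
move=> t0; rewrite !line_pl_pivots // (bigD1 (inl (inl i))) //= [in RHS](bigD1 (inl (inl i))) //=.
rewrite dfwith_in mulrCA; congr (_ * (_ * _)); apply: eq_bigr => -[[i'|d]|b] //= ne.
rewrite dfwith_out //; apply: contra_neq ne => -> //.
Qed.

Lemma unit_block (t : J -> K) d : nonzero_on_blocks t -> t (inr d) != 0.
Proof. by move=> /(_ (inr d)) [[y|d'] //= [<-]]. Qed.

Lemma factor_block (t : J -> K) i : nonzero_on_blocks t ->
  row_at (fun y => t (inl y)) i != 0.
Proof.
move=> /(_ (inl i)) [[[i' j]|d'] //= [ei]] tj; apply/rV0Pn.
by case: _ / ei; exists j; rewrite mxE.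
Qed.

Definition factor (i : 'I_s) (v : 'cV[K]_p) : 'rV[K]_(n i).+1 :=
  \row_j v (enum_rank (@plen J T R (inl (inl i)) (inl (Tg i j)) (eqxx _))) 0.

Lemma factor_is_linear i : linear (factor i).
Proof. by move=> c u v; apply/rowP => j; rewrite !mxE. Qed.
HB.instance Definition _ i :=
  GRing.isLinear.Build K _ _ _ (factor i) (factor_is_linear i).

Lemma factor_line_span t i :
  (linfun (factor i) @: line_span (block_lines t))%VS = <[row_at (fun y => t (inl y)) i]>%VS.
Proof.
have fE k : factor i (pvec (block_lines t k))
    = (k == inl (inl i))%:R *: row_at (fun y => t (inl y)) i.
  apply/rowP => j; rewrite !mxE enum_rankK cf_line_len.
  by case: eqP => [->|_] //; rewrite !mul0r.
apply/vspaceP => w; apply/memv_imgP/vlineP => [[v /line_spanP[c ->] ->]|[c ->]].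
  exists (c (inl (inl i))); rewrite lfunE linear_sum (bigD1 (inl (inl i))) //=.
  rewrite linearZ /= fE eqxx scale1r big1 ?addr0 // => k /negPf ne.
  by rewrite linearZ /= fE ne scale0r scaler0.
exists (c *: pvec (block_lines t (inl (inl i)))).
  by apply: memvZ; exact: mem_line_span.
by rewrite lfunE linearZ /= fE eqxx scale1r.
Qed.

(** Homogeneous coordinates of the i-th factor are quotients of Pluecker
    coordinates at pivots that differ only in the i-th block. *)
Lemma max_topdeg_ProdProj :
  isomorphic_varieties (max_topdeg P C) (fun _ : ProdProj K n => True).
Proof.
pose f (D : Gr) : ProdProj K n := fun i => proj_point (linfun (factor i) @: val D)%VS.
pose coo (x : ProdProj K n) (y : {i : 'I_s & 'I_(n i).+1}) : K := (vpick (val (x (tag y)))) 0 (tagged y).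
have coo_rep (x : ProdProj K n) : represents x (coo x).
  move=> i; rewrite (_ : row_at (coo x) i = vpick (val (x i))); last first.
    by apply/rowP => j; rewrite mxE.
  apply/esym/eqP; rewrite eqEdim -memvE memv_pick (eqP (valP (x i))) dim_vline vpick0.
  by rewrite -dimv_eq0 (eqP (valP (x i))).
have rep_nz (x : ProdProj K n) v : represents x v -> nonzero_on_blocks (param v).
  by move=> rv; apply: param_nonzero => i; exact: proj_row_neq0 rv.
pose g (x : ProdProj K n) : Gr :=
  line_point hq (block_lines_lines B (rep_nz x _ (coo_rep x))).
have gE x v : represents x v -> val (g x) = line_span (block_lines (param v)).
  move=> rv; have [c cE _] := ProdProj_homogeneous rv (coo_rep x).
  have /fin_all_exists2[d d0 dE] i : exists2 c, c != 0 & row_at (coo x) i = c *: row_at v i.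
    by apply: vline_scale; [rewrite -rv -coo_rep | exact: proj_row_neq0 rv].
  pose e (i : A) : K := match i with inl i' => d i' | inr _ => 1 end.
  apply: (block_lines_scale (c := e)) => [[i|i]|[[i j]|i]] /=; rewrite ?oner_neq0 ?mulr1 //.
  by have /rowP/(_ j) := dE i; rewrite !mxE.
have fE (D : Gr) t i : nonzero_on_blocks t -> val D = line_span (block_lines t) ->
    val (f D i) = <[row_at (fun y => t (inl y)) i]>%VS.
  move=> t0 Dt; rewrite val_proj_point Dt factor_line_span //.
  by rewrite dim_vline factor_block.
have mt D := @max_topdegP K J A block_of B q hq q_gt0 block_of_surj D.
exists f, g; split=> //.
- apply: lift_morphism => //; last exact: ProdProj_homogeneous.
  move=> D /mt[t [t0 Dt]].
  have /fin_all_exists[c tc] i : exists j : 'I_(n i).+1, t (inl (Tg i j)) != 0.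
    by have /rV0Pn[j] := factor_block i t0; rewrite mxE; exists j.
  have pa h := @poly_in_function K Gr _ (poly_function_coord K h).
  have [F0 F0E] := pa (one_per_sink hq (pivot c)).
  have /fin_all_exists[G GE] (y : {i : 'I_s & 'I_(n i).+1}) :=
    pa (one_per_sink hq (pivot (dfwith c (tagged y)))).
  exists F0, G, (plc D); split; first exact: plcP.
    have [m0 m0n vE] := line_rep hq (block_lines_lines B t0) Dt (plcP D).
    rewrite F0E vE mulf_neq0 // line_pl_pivots // prodf_seq_neq0; apply/allP => k _ /=.
    by case: k => [[i|d]|b] //=; [exact: unit_block | exact: oner_neq0].
  move=> E v /mt[t' [t0' Es']] rv; rewrite F0E => F0v i.
  have [m0 m0n vE] := line_rep hq (block_lines_lines B t0') Es' rv.
  have tc' : t' (inl (Tg i (c i))) != 0.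
    apply: contraNneq F0v => z; rewrite vE line_pl_pivots //.
    by rewrite (bigD1 (inl (inl i))) //= z mul0r mulr0.
  rewrite (fE _ _ _ t0' Es') -(vline_scaled _ (invr_neq0 tc')).
  congr (<[_]>%VS); apply/rowP => j; rewrite !mxE GE /=.
  apply: (mulfI tc'); rewrite mulVKf // mulrA [in RHS]vE mulrCA pivot_ratio // mulrCA -vE.
  by rewrite mulfK.
- apply: lift_morphism; last first.
  + by move=> x _; apply/mt; exists (param (coo x)); split=> //; exact: (rep_nz x _ (coo_rep x)).
  + exact: Gr_homogeneous.
  have alg := poly_function_algebra K {i : 'I_s & 'I_(n i).+1}.
  apply: (@polynomial_lift _ (ProdProj K n) Gr _ _
    (fun h v => line_pl hq (block_lines (param v)) h)) => [x _|h|x v _ rv].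
  + by exists (coo x).
  + apply: (fa_line_pl hq alg (c := fun _ _ => 0) (t := fun (k : T) v =>
      match k with inl _ => param v | inr _ => fun=> 1 end)) => [k|k j].
      exact: (fa_const alg).
    case: k => _; last exact: (fa_const alg).
    by case: j => [y|d]; [exact: poly_function_coord | exact: (fa_const alg)].
  exact: line_pl_rep (block_lines_lines B (rep_nz x v rv)) (gE x v rv).
- move=> D Dm; have [t [t0 Dt]] := (mt D).1 Dm; apply: val_inj.
  have rv : represents (f D) (fun y => t (inl y)) by move=> i; exact: fE.
  rewrite (gE _ _ rv) Dt; pose e (i : A) : K := match i with inl _ => 1 | inr d => (t (inr d))^-1 end.
  apply: (block_lines_scale (c := e)) => [[i|d]|[y|d]] /=; rewrite ?oner_neq0 ?mul1r //.
    by rewrite invr_neq0 // unit_block.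
  by rewrite mulVf // unit_block.
- move=> x _; apply: functional_extensionality_dep => i; apply: val_inj.
  by rewrite (fE _ _ _ (rep_nz x _ (coo_rep x)) (erefl (val (g x)))) [RHS]coo_rep.
Qed.

End MaxTopdegProjective.

Section Realization.
Context (K : closedFieldType) (s : nat) (n : 'I_s -> nat) (m : nat) (s_gt0 : (0 < s)%N).
Local Notation J := ({i : 'I_s & 'I_(n i).+1} + 'I_m)%type.
Local Notation A := ('I_s + 'I_m)%type.
Local Notation block_of := (@block_of s n m).

Lemma card_parameters : #|{: J}| = (s + m + \sum_(i < s) n i)%N.
Proof.
rewrite card_sum card_tagged sumnE big_map big_enum card_ord /=.
under eq_bigr => i _ do rewrite card_ord -addn1.
by rewrite big_split /= sum1_card card_ord -addnA addnC.
Qed.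

(** The numbers m and |B| adjust the smallest and the largest length of a chain; they
    do not affect the variety of maximal degenerations. *)
Lemma realization (B : pred J) : (forall i, exists2 j, block_of j = i & ~~ B j) ->
  exists (L : falgType K) (p d : nat) (P : module L p) (M : module L d)
      (C : Gr K (p - d) p),
    [/\ is_bound_quiver_algebra L, local_module M, presents P M (val C) & in_Grass P C] /\
    [/\ isomorphic_varieties (max_topdeg P C) (fun _ : ProdProj K n => True),
        has_dim (aut_orbit P C) (s + m + \sum_(i < s) n i)
      & forall (r : nat) (a : 'I_r -> L), algebra_generators a ->
          forall k, saturated_chain_length a M k <->
                    (s + m <= k <= s + m + #|{: {j | B j}}|)%N].
Proof.
move=> ne; pose T := sink A B; pose R := @incidence J A block_of B.
pose p := #|{: ppath R}|; pose d := (p - #|{: T}|)%N.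
have Tp : (#|{: T}| <= p)%N.
  by apply: (leq_card (parr R)) => k k' /(congr1 val) [].
have hq : (p - d)%N = #|{: T}| by rewrite subKn.
have q_gt0 : (0 < p - d)%N.
  by rewrite hq; apply/card_gt0P; exists (inl (inl (Ordinal s_gt0))).
have dp : (d + #|{: T}|)%N = p by rewrite subnK.
have vs := @valid_start K J A block_of B.
have [M sM] := @state_module_exists K J A block_of B d dp _ vs.
have hl := slines_lines vs.
have spanE : val (arrow_point K R hq) = line_span (slines block_of (start K A B)).
  by congr (<<_>>%VS); apply: eq_map => k; rewrite slines_start [orbit_lines _ _ _]line_ar.
exists (alg K R), p, d, (pmod K R), M, (arrow_point K R hq); split; split.
- exact: alg_bound_quiver.
- exact: quotient_local hl sM.
- by rewrite spanE; exact: quotient_presents hl sM.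
- split; rewrite spanE; first exact: line_span_submodule.
  by move=> v; exact: rad_line_span.
- exact: max_topdeg_ProdProj.
- rewrite -card_parameters; apply: has_dim_iso (has_dim_affine K J).
  exact: (@orbit_affine K J T R _ hq q_gt0 (fun j => inl (block_of j)) (fun j => eqxx _)).
- move=> r a gen k; have := chain_lengths gen dp sM k ne.
  by rewrite card_sum !card_ord.
Qed.

End Realization.

Theorem theorem4p5 (K : closedFieldType) (s : nat) (n : 'I_s -> nat) (l : nat)
    (s_gt0 : (0 < s)%N) (n_gt0 : forall i, (0 < n i)%N) (le_s_l : (s <= l)%N) :
  let realized (L : falgType K) (p d : nat) (P : module L p) (M : module L d)
      (C : Gr K (p - d) p) : Prop :=
    [/\ is_bound_quiver_algebra L,
        local_module M, presents P M (val C) & in_Grass P C] /\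
    [/\ isomorphic_varieties (max_topdeg P C) (fun _ : ProdProj K n => True),
        has_dim (aut_orbit P C) (l + \sum_(i < s) n i)
      & forall (r : nat) (a : 'I_r -> L), algebra_generators a ->
          saturated_chain_length a M l /\
          forall k, saturated_chain_length a M k -> (l <= k)%N] in
  (exists (L : falgType K) (p d : nat) (P : module L p) (M : module L d)
      (C : Gr K (p - d) p),
    realized L p d P M C /\
    forall (r : nat) (a : 'I_r -> L), algebra_generators a ->
    forall k, saturated_chain_length a M k <->
              (l <= k <= (l - s) + \sum_(i < s) n i)%N)
  /\
  (exists (L : falgType K) (p d : nat) (P : module L p) (M : module L d)
      (C : Gr K (p - d) p),
    realized L p d P M C /\
    forall (r : nat) (a : 'I_r -> L), algebra_generators a ->
    forall k, saturated_chain_length a M k -> k = l).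
Proof.
move=> realized.
have main (B : pred ({i : 'I_s & 'I_(n i).+1} + 'I_(l - s))) :
    (forall i, exists2 j, block_of j = i & ~~ B j) ->
    exists (L : falgType K) (p d : nat) (P : module L p) (M : module L d)
      (C : Gr K (p - d) p), realized L p d P M C /\
    forall (r : nat) (a : 'I_r -> L), algebra_generators a ->
    forall k, saturated_chain_length a M k <-> (l <= k <= l + #|{: {j | B j}}|)%N.
  move=> /(realization K s_gt0)[L [p [d [P [M [C [alg [iso dim len]]]]]]]].
  rewrite (subnKC le_s_l) in dim len.
  exists L, p, d, P, M, C; split=> //; split=> //; split=> // r a gen.
  have H := len r a gen; split=> [|k]; first by apply/H; rewrite leqnn leq_addr.
  by move=> /H/andP[].
split.
  (* Any n i - 1 of the n i + 1 elements of the block of i would do. *)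
  pose B (j : {i : 'I_s & 'I_(n i).+1} + 'I_(l - s)) : bool :=
    if j is inl y then (0 < tagged y < n (tag y))%N else false.
  have cardB : (l + #|{: {j | B j}}| = l - s + \sum_(i < s) n i)%N.
    rewrite card_sig -sum1_card big_sumType /= [X in (_ + (_ + X))%N]big_pred0 // addn0.
    have -> : (\sum_(y : {i : 'I_s & 'I_(n i).+1} | B (inl y)) 1 = \sum_(i < s) (n i).-1)%N.
      rewrite -(@sig_big_dep _ _ _ 'I_s (fun i => 'I_(n i).+1) xpredT
        (fun i j => (0 < j < n i)%N) (fun _ _ => 1%N)) /=.
      apply: eq_bigr => i _; case: (n i) (n_gt0 i) => // k _.
      rewrite big_mkcond big_ord_recl big_ord_recr /= ltnn /= add0n addn0.
      rewrite (eq_bigr (fun=> 1%N)) ?sum1_card ?card_ord // => j _ /=.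
      by rewrite /bump leq0n add1n ltnS ltn_ord.
    have -> : (\sum_(i < s) n i = s + \sum_(i < s) (n i).-1)%N.
      rewrite -[X in (X + _)%N]card_ord -sum1_card -big_split /=.
      by apply: eq_bigr => i _; rewrite add1n prednK.
    by rewrite addnA subnK.
  have [|L [p [d [P [M [C [rl len]]]]]]] := main B.
    by case=> [i|c]; [exists (inl (Tagged (fun i => 'I_(n i).+1) (@ord0 (n i)))) | exists (inr c)].
  by exists L, p, d, P, M, C; split=> // r a gen k; rewrite -cardB; exact: len.
have [|L [p [d [P [M [C [rl len]]]]]]] := main (fun=> false).
  by case=> [i|c]; [exists (inl (Tagged (fun i => 'I_(n i).+1) (@ord0 (n i)))) | exists (inr c)].
exists L, p, d, P, M, C; split=> // r a gen k /(len r a gen); rewrite card_sig.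
by rewrite (eq_card0 (fun _ => erefl)) addn0 -eqn_leq => /eqP.
Qed.
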